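(* (1) Let $\alpha\ge1$, $1\le p\le+\infty$ and $X=l_a^p(\alpha)$. There exist constants $c,A>0$ depending only on $\alpha$ and $p$ such that for all integers $n\ge1$ and all $r\in[0,1)$: $$C_{n,r}(X,H^\infty)\ \ge\ c\,\frac{1}{(1-r)^{\alpha-1/p}};$$ if $1\le p\le2$, $$C_{n,r}(X,H^\infty)\ \le\ A\left(\frac{n}{1-r}\right)^{\alpha-1/2};$$ and if $2\le p\le+\infty$, $$C_{n,r}(X,H^\infty)\ \le\ A\left(\frac{n}{1-r}\right)^{\alpha+1/2-2/p}$$ (with $1/p=0$ if $p=+\infty$). (2) Let $\beta>-1$, $1\le p\le2$ and $X=L_a^p(\beta)$. There exists a constant $A'>0$ depending only on $\beta$ and $p$ such that for all $\lambda\in\mathbb{D}$ and all integers $n\ge1$, $$c(\sigma_{\lambda,n},X,H^\infty)\ \le\ A'\left(\frac{n}{1-|\lambda|}\right)^{(\beta+2)/p},$$ where $\sigma_{\lambda,n}=\{\lambda,\dots,\lambda\}$ ($n$ times).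
   Context: $\mathbb{D}=\{z\in\mathbb{C}:|z|<1\}$, $\mathrm{Hol}(\mathbb{D})$ is the space of holomorphic functions on $\mathbb{D}$, and $H^\infty$ is the space of bounded holomorphic functions on $\mathbb{D}$ with norm $\|f\|_\infty=\sup_{z\in\mathbb{D}}|f(z)|$. For $\alpha\ge1$ and $1\le p\le\infty$, $l_a^p(\alpha)=l_a^p\left(\frac{1}{(k+1)^{\alpha-1}}\right)$ is the space of functions $f(z)=\sum_{k\ge0}\hat f(k)z^k$ on $\mathbb{D}$ with $$\|f\|^p=\sum_{k\ge0}|\hat f(k)|^p\frac{1}{(k+1)^{p(\alpha-1)}}<\infty$$ (for $p=\infty$: $\|f\|=\sup_{k\ge0}|\hat f(k)|(k+1)^{-(\alpha-1)}<\infty$). For $\beta>-1$ and $1\le p\le2$, $L_a^p(\beta)=L_a^p\left((1-|z|^2)^\beta dxdy\right)$ is the weighted Bergman space of holomorphic functions $f$ on $\mathbb{D}$ with $$\|f\|^p=\int_{\mathbb{D}}|f(z)|^p(1-|z|^2)^\beta\,dxdy<\infty.$$ A finite set $\sigma=\{\lambda_1,\dots,\lambda_n\}\subset\mathbb{D}$ is understood as a finite family in which points may be repeated; $\#\sigma$ counts multiplicities. Put $B=\prod_{i=1}^n b_{\lambda_i}$ with $b_\lambda(z)=\frac{\lambda-z}{1-\overline{\lambda}z}$. For $f,g\in\mathrm{Hol}(\mathbb{D})$, the condition $g_{|\sigma}=f_{|\sigma}$ means $f-g\in B\,\mathrm{Hol}(\mathbb{D})$ (interpolation counted with multiplicity).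 For a Banach space $X$ of holomorphic functions on $\mathbb{D}$ and $Y=H^\infty$, $$c(\sigma,X,Y)=\sup_{f\in X,\ \|f\|_X\le1}\ \inf\{\|g\|_Y:\ g\in Y,\ g_{|\sigma}=f_{|\sigma}\},$$ and for an integer $n\ge1$ and $r\in[0,1)$, $$C_{n,r}(X,Y)=\sup\{c(\sigma,X,Y):\ \#\sigma\le n,\ |\lambda|\le r\ \text{for all }\lambda\in\sigma\}.$$ *)

(* Defs.v *)
From HB Require Import structures.
From mathcomp Require Import all_boot all_order all_algebra.
From mathcomp Require Import all_classical all_reals all_analysis.
From mathcomp Require Import complex.

Set Implicit Arguments.
Unset Strict Implicit.
Unset Printing Implicit Defensive.

Import Order.TTheory GRing.Theory Num.Theory.
Import numFieldNormedType.Exports.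
Import Normc.

Local Open Scope classical_set_scope.
Local Open Scope complex_scope.
Local Open Scope ring_scope.

(* R[i] is a numFieldType, hence R[i]^o is a normed module over R[i]; these two
   instances transfer its topology to R[i] itself, so that limits and
   derivatives of functions R[i] -> R[i] are the complex ones. *)
HB.instance Definition _ (R : realType) := PseudoPointedMetric.copy R[i] R[i]^o.
HB.instance Definition _ (R : realType) := NormedModule.copy R[i] R[i]^o.

Section Definitions.
Variable R : realType.
Local Notation C := R[i].

(* [normc z : R] is the real-valued modulus; [`|z|] lives in R[i]. *)
Definition disc : set C := [set z | normc z < 1].

(* A function on the disc is represented by a total function C -> C; none of
   the notions below depends on its values outside the disc. *)
Definition Hol : set (C -> C) :=
  [set f | forall z, disc z -> derivable f z 1].

Definition taylor_coef (f : C -> C) (k : nat) : C :=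
  derive1n k f 0 / (k`!)%:R.

(* The norm is given as an extended-real function on all of C -> C; only its
   values on the carrier are relevant. *)
Record hol_space := HolSpace {
  hol_carrier : set (C -> C);
  hol_norm : (C -> C) -> \bar R
}.

Definition Hinf_norm (f : C -> C) : \bar R :=
  ereal_sup [set (normc (f z))%:E | z in disc].

Definition Hinf : hol_space :=
  HolSpace [set f | Hol f /\ (Hinf_norm f < +oo)%E] Hinf_norm.

(* The value at p = -oo is a dummy: only 1 <= p is considered. *)
Definition lap_norm (alpha : R) (p : \bar R) (f : C -> C) : \bar R :=
  match p with
  | q%:E => ((\sum_(0 <= k <oo)
      (normc (taylor_coef f k) `^ q * (1 / k.+1%:R `^ (q * (alpha - 1))))%:E)
      `^ q^-1)%E
  | +oo%E => ereal_sup
      [set (normc (taylor_coef f k) * k.+1%:R `^ (- (alpha - 1)))%:E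
        | k in [set: nat]]
  | -oo%E => +oo%E
  end.

(* The expansion condition makes every member holomorphic on the disc. *)
Definition lap (alpha : R) (p : \bar R) : hol_space :=
  HolSpace
    [set f | (forall z, disc z ->
                series (fun k => taylor_coef f k * z ^+ k) @ \oo --> f z)
             /\ (lap_norm alpha p f < +oo)%E]
    (lap_norm alpha p).

Definition bergman_norm (beta p : R) (f : C -> C) : \bar R :=
  ((\int[(@lebesgue_measure R \x @lebesgue_measure R)%E]_(w in
        [set w : R * R | disc (w.1 +i* w.2)])
      (normc (f (w.1 +i* w.2)) `^ p
        * (1 - normc (w.1 +i* w.2) ^+ 2) `^ beta)%:E) `^ p^-1)%E.

Definition bergman (beta p : R) : hol_space :=
  HolSpace [set f | Hol f /\ (bergman_norm beta p f < +oo)%E]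
    (bergman_norm beta p).

Definition blaschke_factor (lambda z : C) : C :=
  (lambda - z) / (1 - lambda^* * z).

Definition blaschke (sigma : seq C) (z : C) : C :=
  \prod_(lambda <- sigma) blaschke_factor lambda z.

(* g and f agree on sigma counted with multiplicity: f - g \in B Hol(disc). *)
Definition agree_on (sigma : seq C) (g f : C -> C) : Prop :=
  exists2 h, Hol h & forall z, disc z -> f z - g z = blaschke sigma z * h z.

Definition interp_const (sigma : seq C) (X Y : hol_space) : \bar R :=
  ereal_sup
    [set ereal_inf
           [set hol_norm Y g | g in [set g | hol_carrier Y g
                                             /\ agree_on sigma g f]]
      | f in [set f | hol_carrier X f /\ (hol_norm X f <= 1)%E]].

Definition interp_const_nr (n : nat) (r : R) (X Y : hol_space) : \bar R :=
  ereal_sup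
    [set interp_const sigma X Y
      | sigma in [set sigma : seq C | (size sigma <= n)%N
                    /\ forall lambda, lambda \in sigma -> normc lambda <= r]].

End Definitions.

(* Main.v *)
(* Everything reduces to the Hardy space of the disc |z| < rho, where rho = 1 - (1-r)/(4n).
   Let f = sum_k a_k z^k with sum_k |a_k|^2 rho^(2k) <= S.  Split off one node at a time:
   f = f(lambda) kappa + b f1, where b is the Blaschke factor and kappa the normalized
   Szegő kernel of |z| < rho at lambda.  This decomposition is orthogonal, so S only
   decreases, and since |b|^2 <= 1 + 4/n on the unit disc, the sum of the n kernel terms is
   an interpolant g with |g|^2 <= 8 e^4 S n/(1-r).

   It remains to bound S on the unit ball of X.  For l_a^p this is Hölder's inequality.  For
   the Bergman spaces, the mean value property gives sup |f| near the circle |z| = rho, hence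
   |f|^2 <= |f|^p sup |f|^(2-p) on an annulus of width comparable to 1 - rho, on which the
   mean of |f|^2 dominates sum_k |a_k|^2 rho^(2k).  Polar coordinates are avoided: means over
   circles are replaced by means over the rotations by N-th roots of unity, N large, and a
   rotation preserves Lebesgue measure because it is a product of three shears.

   Members of Hol(D) enter only through their Taylor expansions.  Goursat's theorem in the
   coordinate log z shows that the integrals over circles centered at 0 do not depend on the
   radius, which yields Cauchy's formula.

   For the lower bound, one node at r and f = sum_(k < N) (k+1)^(alpha-1) z^k, suitably
   normalized, with N about 1/(1-r), suffice. *)
Require Import Defs.
From HB Require Import structures.
From mathcomp Require Import all_boot all_order all_algebra.
From mathcomp Require Import all_classical all_reals all_analysis.
From mathcomp Require Import complex.
From mathcomp Require Import measurable_realfun.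
From mathcomp Require Import cyclic separable cyclotomic.
From mathcomp Require Import ring lra.
Import Order.TTheory GRing.Theory Num.Theory.
Import numFieldNormedType.Exports.
Import Normc.
Set Implicit Arguments.
Unset Strict Implicit.
Unset Printing Implicit Defensive.

Local Open Scope classical_set_scope.
Local Open Scope complex_scope.
Local Open Scope ring_scope.

(** Members of X need not lie in the Hardy space of the unit disc, where one would project onto the
    kernels at the nodes. On a smaller disc they do, but its Blaschke factors b exceed 1 near the
    unit circle. The excess of |b|^2 over 1 is of order (1 - rho)/(1 - r) and n factors are
    multiplied, so 1 - rho must be of order (1 - r)/n. Write M = n/(1 - r). If X embeds into l^2
    with weights (k+1)^(-t), then S is of order M^t. Each kernel satisfies |kappa|^2 <= 8/(1 - r)
    times its squared norm, so the n of them contribute a factor M to |g|^2, and |g| is of order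
    M^((t + 1)/2). Here t = 2(alpha - 1) for p <= 2 and t = 2(alpha - 1) + 2 - 4/p for p >= 2. For
    the Bergman spaces S is of order M^(2(beta + 2)/p - 1). The Hardy norm appears only as a bound
    on finite sums of squares: orthogonality becomes a polynomial identity that telescopes along the
    coefficients. *)

Local Notation Re := (@complex.Re _).
Local Notation Im := (@complex.Im _).

(** * Real-valued estimates for the complex modulus *)

Section Modulus.
Variable R : realType.
Local Notation C := R[i].
Implicit Types (x y z : C) (a b : R).

Lemma normcE z : `|z| = (normc z)%:C. Proof. by []. Qed.

Lemma normc_ge0 z : 0 <= normc z.
Proof. by case: z => a b; exact: sqrtr_ge0. Qed.

Lemma normc_eq0 z : (normc z == 0) = (z == 0).
Proof.
apply/eqP/eqP => [/eq0_normc//|->]; exact: normc0.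
Qed.

Lemma normc_gt0 z : (0 < normc z) = (z != 0).
Proof. by rewrite lt_def normc_ge0 andbT normc_eq0. Qed.

Lemma normcNE z : normc (- z) = normc z. Proof. exact: normcN. Qed.

Lemma normc_distC x y : normc (x - y) = normc (y - x).
Proof. by rewrite -normcNE opprB. Qed.

Lemma ler_normcD x y : normc (x + y) <= normc x + normc y.
Proof. exact: le_normcD. Qed.

Lemma ler_normcB x y : normc (x - y) <= normc x + normc y.
Proof. by rewrite -(normcNE y) ler_normcD. Qed.

Lemma ler_distcD z x y : normc (x - y) <= normc (x - z) + normc (z - y).
Proof. by rewrite (le_trans _ (ler_normcD _ _))// addrA subrK. Qed.

Lemma lerB_normc x y : normc x - normc y <= normc (x - y).
Proof. by rewrite lerBlDr (le_trans _ (ler_normcD _ _)) ?subrK. Qed.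

Lemma normc_sum (I : Type) (s : seq I) (P : pred I) (F : I -> C) :
  normc (\sum_(i <- s | P i) F i) <= \sum_(i <- s | P i) normc (F i).
Proof.
elim/big_ind2 : _ => [|x a y b xa yb|//]; first by rewrite normc0.
by rewrite (le_trans (ler_normcD _ _))// lerD.
Qed.

Lemma normcX z n : normc (z ^+ n) = normc z ^+ n.
Proof. by elim: n => [|n IHn]; rewrite ?expr0 ?normc1// !exprS normcM IHn. Qed.

Lemma normcf_div x y : normc (x / y) = normc x / normc y.
Proof. by rewrite normcM normcV. Qed.

Lemma normc_real a : normc a%:C = `|a|.
Proof. by rewrite /= expr0n /= addr0 sqrtr_sqr. Qed.

Lemma normc_nat n : normc (n%:R : C) = n%:R.
Proof. by rewrite -(rmorph_nat (real_complex R)) normc_real ger0_norm. Qed.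

Lemma normc_conj z : normc z^* = normc z.
Proof. by case: z => a b; rewrite /= sqrrN. Qed.

Lemma sqr_normcE z : normc z ^+ 2 = Re z ^+ 2 + Im z ^+ 2.
Proof. by case: z => a b /=; rewrite sqr_sqrtr// addr_ge0 ?sqr_ge0. Qed.

Lemma mulconjc z : z * z^* = (normc z ^+ 2)%:C.
Proof.
by rewrite sqr_normcE; case: z => a b; apply/eqP; rewrite eq_complex/=; apply/andP; split; apply/eqP; ring.
Qed.

Lemma normc_Re z : `|Re z| <= normc z.
Proof.
by rewrite -(@ler_pXn2r _ 2) ?nnegrE ?normc_ge0// real_normK ?num_real// sqr_normcE lerDl sqr_ge0.
Qed.

Lemma normc_Im z : `|Im z| <= normc z.
Proof.
by rewrite -(@ler_pXn2r _ 2) ?nnegrE ?normc_ge0// real_normK ?num_real// sqr_normcE lerDr sqr_ge0.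
Qed.

Lemma normc_le_ReIm z : normc z <= `|Re z| + `|Im z|.
Proof.
rewrite -(@ler_pXn2r _ 2) ?nnegrE ?normc_ge0 ?addr_ge0// sqr_normcE sqrrD.
by rewrite !real_normK ?num_real// lerD2r lerDl mulrn_wge0// mulr_ge0.
Qed.

Lemma cvg_normcP (u : nat -> C) (l : C) :
  u @ \oo --> l <->
  forall e : R, 0 < e -> exists N, forall n, (N <= n)%N -> normc (u n - l) < e.
Proof.
split => [/cvgrPdist_lt H e e0|H].
- have /H[N _ HN] : 0 < e%:C by rewrite ltcR.
  by exists N => n Nn; rewrite normc_distC -ltcR -normcE; exact: HN.
- apply/cvgrPdist_lt => e e0.
  have er : e = (Re e)%:C by rewrite RRe_real// gtr0_real.
  have {e0} : 0 < Re e by rewrite -ltcR -er.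
  move=> /H[N HN]; exists N => // n Nn; rewrite er /= normcE ltcR normc_distC.
  exact: HN.
Qed.

Lemma normc_rate (l w h : C) : h != 0 ->
  normc (w - l * h) / normc h = normc (l - h^-1 * w).
Proof. by move=> h0; rewrite -normcf_div mulrBl mulfK// normc_distC mulrC. Qed.

(** Turns the complex difference quotient into a real estimate with real epsilon and delta. The
    increment 0 may be included because both sides vanish there. *)
Lemma derivable_normcP (f : C -> C) z :
  derivable f z 1 <-> exists l : C, forall e : R, 0 < e -> exists2 d : R, 0 < d &
    forall h, normc h < d -> normc (f (z + h) - f z - l * h) <= e * normc h.
Proof.
split.
- move=> /cvg_ex[l /cvgrPdist_le H]; exists l => e e0.
  have /H : 0 < e%:C by rewrite ltcR.
  rewrite /prop_near1/= => -[d /= d0 Hd].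
  have dr : d = (Re d)%:C by rewrite RRe_real// gtr0_real.
  exists (Re d); first by rewrite -ltcR -dr.
  move=> h hd; have [->|h0] := eqVneq h 0.
    by rewrite addr0 mulr0 subrr subr0 normc0 mulr0.
  have := Hd h; rewrite /= sub0r !normrN !normcE dr ltcR lecR => /(_ hd h0).
  rewrite /GRing.scale/= mulr1 => Hh.
  by rewrite -ler_pdivrMr ?normc_gt0// normc_rate// (addrC z).
- move=> [l H]; apply/cvg_ex; exists l; apply/cvgrPdist_le => e e0.
  have er : e = (Re e)%:C by rewrite RRe_real// gtr0_real.
  have {e0} : 0 < Re e by rewrite -ltcR -er.
  move=> /H[d d0 Hd]; rewrite /prop_near1; exists d%:C; first by rewrite /= ltcR.
  move=> h /=; rewrite sub0r normrN !normcE ltcR => hd h0.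
  rewrite er lecR /GRing.scale/= mulr1.
  have := Hd _ hd; rewrite -ler_pdivrMr ?normc_gt0//.
  by rewrite normc_rate// (addrC z).
Qed.

Lemma derivable_continuous_normc (f : C -> C) z : derivable f z 1 ->
  forall e : R, 0 < e -> exists2 d : R, 0 < d &
    forall h, normc h < d -> normc (f (z + h) - f z) < e.
Proof.
move=> /derivable_normcP[l] /(_ 1 ltr01)[d d0 Hd] e e0.
have l1 : 0 < normc l + 1 by rewrite ltr_wpDl ?normc_ge0.
exists (Num.min d (e / (normc l + 1))); first by rewrite lt_min d0 divr_gt0.
move=> h; rewrite lt_min ltr_pdivlMr// => /andP[hd he].
apply: le_lt_trans he.
rewrite -[X in normc X](subrK (l * h)) (le_trans (ler_normcD _ _))// normcM.
by have := Hd _ hd; lra.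
Qed.

End Modulus.

(** * Power series converging on the unit disc *)

Section PowerSeries.
Variable R : realType.
Local Notation C := R[i].
Implicit Types (a b : nat -> C) (z w lambda : C) (x y q M : R).

Lemma sum_geometric_le q n m : 0 <= q < 1 ->
  \sum_(n <= k < m) q ^+ k <= q ^+ n / (1 - q).
Proof.
move=> /andP[q0 q1]; have q1' : 0 < 1 - q by rewrite subr_gt0.
have [nm|/ltnW mn] := leqP n m; last first.
  by rewrite big_geq// divr_ge0 ?exprn_ge0// ltW.
rewrite ler_pdivlMr// -(subnK nm).
suff -> j : (\sum_(n <= k < j + n) q ^+ k) * (1 - q) = q ^+ n - q ^+ (j + n).
  by rewrite lerBlDr lerDl exprn_ge0.
elim: j => [|j IHj]; first by rewrite big_geq// mul0r add0n subrr.
by rewrite addSn big_nat_recr ?leq_addl//= mulrDl IHj exprS; ring.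
Qed.

(** The limit is assembled from the real series of real and imaginary parts, each dominated by the
    geometric series. The tail bound is the one for partial sums, passed to the limit. *)
Lemma cvg_geometric_dominated (u : nat -> C) M q : 0 <= q < 1 ->
  (forall k, normc (u k) <= M * q ^+ k) ->
  exists2 l, series u @ \oo --> l &
    forall n, normc (l - series u n) <= M * q ^+ n / (1 - q).
Proof.
move=> q01 uM; have /andP[q0 q1] := q01; have q1' : 0 < 1 - q by rewrite subr_gt0.
have M0 : 0 <= M by have := uM 0%N; rewrite expr0 mulr1; apply: le_trans; exact: normc_ge0.
have part n m : (n <= m)%N ->
    normc (series u m - series u n) <= M * q ^+ n / (1 - q).
  move=> nm; rewrite sub_series nm (le_trans (normc_sum _ _ _))//.
  apply: (@le_trans _ _ (M * \sum_(n <= k < m) q ^+ k)); last first.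
    by rewrite -mulrA ler_wpM2l// sum_geometric_le.
  by rewrite mulr_sumr; apply: ler_sum => k _; exact: uM.
have comp (p : C -> R) : (forall z, `|p z| <= normc z) ->
    cvgn (series (p \o u)).
  move=> pn; apply: normed_cvg.
  have := @is_cvg_geometric_series _ M q; rewrite ger0_norm// => /(_ q1).
  apply: series_le_cvg => k /=; first exact: normr_ge0.
    by rewrite /geometric/= mulr_ge0 ?exprn_ge0.
  exact: le_trans (pn _) (uM _).
have /cvg_ex[l1 /cvgrPdist_lt Hl1] := comp Re (@normc_Re R).
have /cvg_ex[l2 /cvgrPdist_lt Hl2] := comp Im (@normc_Im R).
have sRe n : Re (series u n) = series (Re \o u) n.
  rewrite /series/=; elim: n => [|n IHn]; first by rewrite !big_geq.
  by rewrite !big_nat_recr//= -IHn; case: (\sum_(_ <= _ < _) _) (u n) => [? ?] [].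
have sIm n : Im (series u n) = series (Im \o u) n.
  rewrite /series/=; elim: n => [|n IHn]; first by rewrite !big_geq.
  by rewrite !big_nat_recr//= -IHn; case: (\sum_(_ <= _ < _) _) (u n) => [? ?] [].
have ul : series u @ \oo --> l1 +i* l2.
  apply/cvg_normcP => e e0.
  have e2 : 0 < e / 2 by rewrite divr_gt0.
  have [N1 _ H1] := Hl1 _ e2; have [N2 _ H2] := Hl2 _ e2.
  exists (maxn N1 N2) => n; rewrite geq_max => /andP[n1 n2].
  apply: le_lt_trans (normc_le_ReIm _) _.
  have := H1 n n1; have := H2 n n2; rewrite /= -sRe -sIm => h2 h1.
  rewrite [e]splitr; apply: ltrD.
    by rewrite [X in `|X|](_ : _ = Re (series u n) - l1) 1?distrC//; case: (series u n).
  by rewrite [X in `|X|](_ : _ = Im (series u n) - l2) 1?distrC//; case: (series u n).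
exists (l1 +i* l2) => // n; apply/ler_addgt0Pr => e e0.
have /cvg_normcP/(_ _ e0)[N HN] := ul.
set m := maxn n N.
rewrite (le_trans (ler_distcD (series u m) _ _))// addrC.
by rewrite lerD ?part ?leq_maxl// normc_distC ltW// HN// leq_maxr.
Qed.

(* The radius of convergence is at least 1. *)
Definition tame a := forall x, 0 <= x < 1 ->
  exists M, forall k, normc (a k) * x ^+ k <= M.

Definition psum a z : C := lim (series (fun k => a k * z ^+ k) @ \oo).

Lemma psumE a z l : series (fun k => a k * z ^+ k) @ \oo --> l -> psum a z = l.
Proof. by move=> /cvg_lim; apply; exact: norm_hausdorff. Qed.

Lemma cvg_series_normc_bounded (u : nat -> C) (l : C) : series u @ \oo --> l ->
  exists M, forall k, normc (u k) <= M.
Proof.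
move=> /cvg_normcP/(_ _ ltr01)[N HN].
exists (2 + \sum_(0 <= k < N.+1) normc (u k)) => k.
have [kN|Nk] := leqP k N.
  rewrite big_mkord (bigD1 (Ordinal (kN : (k < N.+1)%N)))//= addrCA lerDl.
  by rewrite addr_ge0// sumr_ge0// => i _; exact: normc_ge0.
rewrite ler_wpDr ?sumr_ge0//; first by move=> i _; exact: normc_ge0.
have := HN _ (leqW (ltnW Nk)); have := HN _ (ltnW Nk) => h1 h2.
have -> : u k = series u k.+1 - series u k.
  by rewrite /series/= big_nat_recr//= addrAC subrr add0r.
rewrite (le_trans (ler_distcD l _ _))//.
by rewrite -[2]/(1 + 1) lerD ?ltW// normc_distC.
Qed.

Lemma tame_of_cvg a (f : C -> C) :
  (forall z, disc z -> series (fun k => a k * z ^+ k) @ \oo --> f z) -> tame a.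
Proof.
move=> H x /andP[x0 x1].
have /H/cvg_series_normc_bounded[M HM] : disc x%:C.
  by rewrite /disc /mkset normc_real ger0_norm.
exists M => k; apply: le_trans (HM k).
by rewrite normcM normcX normc_real ger0_norm.
Qed.

Lemma tame_dominated a x y : tame a -> 0 <= x < y -> y < 1 ->
  exists2 M, 0 <= M & forall k, normc (a k) * x ^+ k <= M * (x / y) ^+ k.
Proof.
move=> ta /andP[x0 xy] y1; have y0 : 0 < y by exact: le_lt_trans xy.
have [|M HM] := ta y; first by rewrite y1 ltW.
exists M => [|k].
  by apply: le_trans (HM 0%N); rewrite mulr_ge0 ?normc_ge0 ?exprn_ge0// ltW.
rewrite exprMn exprVn mulrA ler_pdivlMr ?exprn_gt0// mulrAC.
by rewrite ler_wpM2r ?exprn_ge0.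
Qed.

Lemma psum_cvg a z : tame a -> disc z ->
  series (fun k => a k * z ^+ k) @ \oo --> psum a z.
Proof.
move=> ta; rewrite /disc/= => z1; have z0 := normc_ge0 z.
have [||M M0 HM] := @tame_dominated a (normc z) ((normc z + 1) / 2) ta; [lra|lra|].
have y0 : 0 < (normc z + 1) / 2 by lra.
have [||l Hl _] := @cvg_geometric_dominated (fun k => a k * z ^+ k) M (normc z / ((normc z + 1) / 2)).
- by rewrite divr_ge0// ?ltW//= ltr_pdivrMr//; lra.
- by move=> k; rewrite normcM normcX.
- by rewrite (psumE Hl).
Qed.

(** Comparison with the bounded terms at radius (x + 1)/2 gives M and q depending on x only, hence
    uniformity on |z| <= x. *)
Lemma psum_tail a x : tame a -> 0 <= x < 1 -> exists M q, [/\ 0 <= M, 0 <= q < 1 &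
  forall z n, normc z <= x ->
    normc (psum a z - \sum_(k < n) a k * z ^+ k) <= M * q ^+ n].
Proof.
move=> ta /andP[x0 x1].
have [||M M0 HM] := @tame_dominated a x ((x + 1) / 2) ta; [lra|lra|].
have y0 : 0 < (x + 1) / 2 by lra.
set q := x / _ in HM.
have q01 : 0 <= q < 1 by rewrite divr_ge0// ?ltW//= ltr_pdivrMr//; lra.
have q1 : 0 < 1 - q by rewrite subr_gt0; case/andP: q01.
exists (M / (1 - q)), q; split => //; first by rewrite divr_ge0// ltW.
move=> z n zx.
have [|l Hl] := @cvg_geometric_dominated (fun k => a k * z ^+ k) M q q01.
  move=> k; rewrite normcM normcX (le_trans _ (HM k))//.
  by rewrite ler_wpM2l ?normc_ge0// lerXn2r ?nnegrE ?normc_ge0.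
by move=> /(_ n); rewrite (psumE Hl) /series/= big_mkord mulrAC.
Qed.

Lemma psum_bounded a x : tame a -> 0 <= x < 1 ->
  exists2 M, 0 <= M & forall z, normc z <= x -> normc (psum a z) <= M.
Proof.
move=> ta /(psum_tail ta)[M [q [M0 _ H]]]; exists M => // z /(H _ 0%N).
by rewrite big_ord0 subr0 expr0 mulr1.
Qed.

Lemma tame_shift a m : tame a -> tame (fun k => a (k + m)%N).
Proof.
move=> ta x /andP[x0 x1].
have [|M HM] := ta ((x + 1) / 2); first by lra.
have y0 : 0 < (x + 1) / 2 by lra.
exists (M / ((x + 1) / 2) ^+ m) => k.
rewrite ler_pdivlMr ?exprn_gt0// (le_trans _ (HM (k + m)%N))// exprD mulrA.
rewrite ler_wpM2r ?exprn_ge0 ?(ltW y0)// ler_wpM2l ?normc_ge0//.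
by rewrite lerXn2r ?nnegrE//; lra.
Qed.

Lemma tame_linear a b (c d : C) : tame a -> tame b ->
  tame (fun k => c * a k + d * b k).
Proof.
move=> ta tb x x01; have /andP[x0 _] := x01.
have [M HM] := ta x x01; have [N HN] := tb x x01.
exists (normc c * M + normc d * N) => k.
rewrite (le_trans (ler_wpM2r _ (ler_normcD _ _))) ?exprn_ge0// mulrDl !normcM -!mulrA.
by rewrite lerD// ler_wpM2l ?normc_ge0.
Qed.

Lemma psum_linear a b (c d : C) z : tame a -> tame b -> disc z ->
  psum (fun k => c * a k + d * b k) z = c * psum a z + d * psum b z.
Proof.
move=> ta tb dz; apply: psumE.
rewrite [X in X @ _ --> _](_ : _ =
  (fun n => c * series (fun k => a k * z ^+ k) n + d * series (fun k => b k * z ^+ k) n)).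
  by apply: cvgD; apply: cvgMr; exact: psum_cvg.
apply/funext => n; rewrite /series/= !mulr_sumr -big_split/=.
by apply: eq_bigr => k _; rewrite mulrDl !mulrA.
Qed.

Lemma psum_shift a z : tame a -> disc z ->
  psum a z = a 0%N + z * psum (fun k => a k.+1) z.
Proof.
move=> ta dz; apply: psumE; apply/cvg_normcP => e e0.
have ts : tame (fun k => a k.+1).
  rewrite (_ : (fun k => _) = (fun k => a (k + 1)%N)); first exact: tame_shift.
  by apply/funext => k; rewrite addn1.
have /cvg_normcP/(_ _ e0)[N HN] := psum_cvg ts dz.
exists N.+1 => -[//|n]; rewrite ltnS => /HN; apply: le_lt_trans.
rewrite {1}/series/= big_nat_recl// expr0 mulr1 opprD addrACA subrr add0r.
rewrite (_ : \sum_(_ <= _ < _) _ = z * series (fun k => a k.+1 * z ^+ k) n).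
  rewrite -mulrBr normcM ler_piMl ?normc_ge0//; exact: ltW.
by rewrite mulr_sumr; apply: eq_bigr => k _; rewrite exprS; ring.
Qed.

(* Taylor coefficients of the difference quotient
   [z |-> (psum a z - psum a lambda) / (z - lambda)]. *)
Definition dquot lambda a (m : nat) : C := psum (fun k => a (k + m.+1)%N) lambda.

Lemma dquot_rec lambda a m : tame a -> disc lambda ->
  dquot lambda a m = a m.+1 + lambda * dquot lambda a m.+1.
Proof.
move=> ta dl; rewrite /dquot psum_shift//; last exact: tame_shift.
by rewrite add0n; under [in RHS]eq_fun do rewrite addnS -addSn.
Qed.

Lemma psum_dquot0 lambda a : tame a -> disc lambda ->
  psum a lambda = a 0%N + lambda * dquot lambda a 0.
Proof.
by move=> ta dl; rewrite psum_shift// /dquot; under [in RHS]eq_fun do rewrite addn1.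
Qed.

Lemma tame_dquot lambda a : tame a -> disc lambda -> tame (dquot lambda a).
Proof.
move=> ta; rewrite /disc/= => l1 x /andP[x0 x1].
have l0 := normc_ge0 lambda.
(* The radius y exceeds both x and |lambda|: the powers of |lambda|/y sum the inner series, and the
   factor y^(-m) that is left compensates x^m. *)
have [y [y1 ly xy]] : exists y, [/\ y < 1, normc lambda < y & x < y].
  exists ((Num.max x (normc lambda) + 1) / 2).
  have lx : Num.max x (normc lambda) < 1 by rewrite gt_max x1.
  have xl : x <= Num.max x (normc lambda) by rewrite le_max lexx.
  have ll : normc lambda <= Num.max x (normc lambda) by rewrite le_max lexx orbT.
  by split; lra.
have y0 : 0 < y by exact: le_lt_trans xy.
have [|M HM] := ta y; first by rewrite y1 ltW.
have q01 : 0 <= normc lambda / y < 1 by rewrite divr_ge0 ?(ltW y0)//= ltr_pdivrMr// mul1r.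
have q1 : 0 < 1 - normc lambda / y by rewrite subr_gt0; case/andP: q01.
exists (M / y / (1 - normc lambda / y)) => m.
have [|l Hl /(_ 0%N)] := @cvg_geometric_dominated (fun k => a (k + m.+1)%N * lambda ^+ k) (M / y ^+ m.+1) _ q01.
  move=> k; rewrite normcM normcX exprMn exprVn mulrCA mulrC.
  rewrite ler_wpM2l ?exprn_ge0 ?normc_ge0// -mulrA -invfM -exprD addnC.
  by rewrite ler_pdivlMr ?exprn_gt0 1?addnC.
rewrite /dquot (psumE Hl) /series/= big_geq// subr0 expr0 mulr1 => Hb.
rewrite (le_trans (ler_wpM2l (normc_ge0 _) (lerXn2r m _ _ (ltW xy))))// ?nnegrE ?(ltW y0)//.
rewrite (le_trans (ler_wpM2r (exprn_ge0 _ (ltW y0)) Hb))//.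
rewrite mulrAC ler_wpM2r ?invr_ge0 ?(ltW q1)//.
by rewrite exprS invfM mulrA divfK// expf_neq0// gt_eqF.
Qed.

Lemma psum_dquot lambda a z : tame a -> disc lambda -> disc z ->
  psum a z = psum a lambda + (z - lambda) * psum (dquot lambda a) z.
Proof.
move=> ta dl dz; have td := tame_dquot ta dl.
have z1 : normc z < 1 by [].
have [||M M0 HM] := @tame_dominated (dquot lambda a) (normc z) ((normc z + 1) / 2) td; first by rewrite normc_ge0/=; lra.
  by lra.
apply: psumE; apply/cvg_normcP => e e0.
pose q := normc z / ((normc z + 1) / 2).
have q01 : 0 <= q < 1.
  have z0 := normc_ge0 z.
  by rewrite divr_ge0 ?normc_ge0//= ?ltr_pdivrMr//; lra.
have e2 : 0 < e / 2 by rewrite divr_gt0.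
have [N1 HN1] : exists N, forall n, (N <= n)%N -> M * q ^+ n < e / 2.
  have /cvgrPdist_lt/(_ _ e2)[N _ HN] : geometric M q @ \oo --> (0 : R).
    by apply: cvg_geometric; rewrite ger0_norm; case/andP: q01.
  by exists N => n /HN; rewrite sub0r normrN; apply: le_lt_trans; exact: ler_norm.
have zl : 0 < normc (z - lambda) + 1 by rewrite ltr_wpDl ?normc_ge0.
have /cvg_normcP/(_ (e / 2 / (normc (z - lambda) + 1)))[|N2 HN2] := psum_cvg td dz.
  by rewrite divr_gt0.
exists (maxn N1 N2).+1 => -[//|n]; rewrite ltnS geq_max => /andP[n1 n2].
(* Summation by parts through [dquot_rec]. The boundary term tends to 0 because [dquot lambda a] is
   tame. *)
have -> : series (fun k => a k * z ^+ k) n.+1 =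
    psum a lambda + (z - lambda) * series (fun k => dquot lambda a k * z ^+ k) n.+1 - dquot lambda a n * z ^+ n.+1.
  rewrite /series/=; elim: {n1 n2}n => [|n IHn].
    by rewrite !big_nat1 expr0 !mulr1 expr1 psum_dquot0//; ring.
  rewrite big_nat_recr// IHn/= [in RHS]big_nat_recr//= (dquot_rec n ta dl) !exprS; ring.
set S := series _ n.+1; set P := psum (dquot lambda a) z.
rewrite (_ : _ - _ = (z - lambda) * (S - P) - dquot lambda a n * z ^+ n.+1); last by ring.
rewrite (le_lt_trans (ler_normcB _ _))// [e]splitr; apply: ltr_leD.
  have /(HN2 n.+1) : (N2 <= n.+1)%N by exact: leqW.
  rewrite ltr_pdivlMr// mulrC normcM; apply: le_lt_trans.
  by rewrite ler_wpM2r ?normc_ge0// lerDl.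
rewrite ltW// (le_lt_trans _ (HN1 n n1))// (le_trans _ (HM n))// normcM normcX exprS.
by rewrite ler_wpM2l ?normc_ge0// ler_piMl ?exprn_ge0 ?normc_ge0// ltW.
Qed.

Lemma disc_near z : disc z -> exists2 d, 0 < d & exists2 x : R, 0 <= x < 1 &
  forall h : C, normc h < d -> normc (z + h) <= x.
Proof.
rewrite /disc/= => z1; have z0 := normc_ge0 z.
exists ((1 - normc z) / 2); first by lra.
exists ((normc z + 1) / 2); first by lra.
by move=> h hd; rewrite (le_trans (ler_normcD _ _))//; lra.
Qed.

(** Taking the difference quotient twice at z gives the exact expansion f(z + h) = f(z) + h (f1(z) +
    h f2(z + h)) with f2 bounded near z. *)
Lemma derivable_psum a z : tame a -> disc z -> derivable (psum a) z 1.
Proof.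
move=> ta dz; have td := tame_dquot ta dz; have tdd := tame_dquot td dz.
apply/derivable_normcP; exists (psum (dquot z a) z) => e e0.
have [d d0 [x x01 Hd]] := disc_near dz.
have [M M0 HM] := psum_bounded tdd x01.
exists (Num.min d (e / (M + 1))); first by rewrite lt_min d0 divr_gt0// ltr_wpDl.
move=> h; rewrite lt_min => /andP[hd he].
have dzh : disc (z + h) by rewrite /disc/= (le_lt_trans (Hd _ hd))//; case/andP: x01.
rewrite (psum_dquot ta dz dzh) (psum_dquot td dz dzh).
have -> : z + h - z = h by rewrite addrAC subrr add0r.
have -> u v w : u + h * (v + h * w) - u - v * h = h * h * w by move=> *; ring.
rewrite !normcM mulrAC ler_wpM2r ?normc_ge0//.
rewrite ltr_pdivlMr ?ltr_wpDl// in he; rewrite (le_trans _ (ltW he))//.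
by rewrite ler_wpM2l ?normc_ge0// (le_trans (HM _ (Hd _ hd)))// lerDl.
Qed.

Lemma Hol_psum a (f : C -> C) : tame a -> (forall z, disc z -> f z = psum a z) -> Hol f.
Proof.
move=> ta fa z dz; have /derivable_normcP[l H] := derivable_psum ta dz.
apply/derivable_normcP; exists l => e /H[d1 d10 H1].
have [d2 d20 [x /andP[_ x1] Hd]] := disc_near dz.
exists (Num.min d1 d2); first by rewrite lt_min d10.
move=> h; rewrite lt_min => /andP[h1 h2]; rewrite !fa//; first exact: H1.
by rewrite /disc/= (le_lt_trans (Hd _ h2)).
Qed.

End PowerSeries.

(** * Closure properties of Hol on the disc *)

Section Holomorphic.
Variable R : realType.
Local Notation C := R[i].
Implicit Types (f g : C -> C).

Lemma Hol_cst (c : C) : Hol (fun=> c).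
Proof. by move=> z _; exact: derivable_cst. Qed.

Lemma Hol_id : Hol (fun z : C => z).
Proof. by move=> z _; exact: derivable_id. Qed.

Lemma HolD f g : Hol f -> Hol g -> Hol (fun z => f z + g z).
Proof. by move=> Hf Hg z dz; apply: derivableD; [exact: Hf|exact: Hg]. Qed.

Lemma HolB f g : Hol f -> Hol g -> Hol (fun z => f z - g z).
Proof. by move=> Hf Hg z dz; apply: derivableB; [exact: Hf|exact: Hg]. Qed.

Lemma HolM f g : Hol f -> Hol g -> Hol (fun z => f z * g z).
Proof. by move=> Hf Hg z dz; apply: derivableM; [exact: Hf|exact: Hg]. Qed.

Lemma HolV f : Hol f -> (forall z, disc z -> f z != 0) -> Hol (fun z => (f z)^-1).
Proof. by move=> Hf f0 z dz; apply: derivableV; [exact: f0|exact: Hf]. Qed.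

End Holomorphic.

(** * Interpolation in the Hardy space of a smaller disc *)

Section Interpolation.
Variable R : realType.

(* Cauchy-Schwarz for (sqrt U, sqrt V) and (sqrt Q, sqrt W). *)
Lemma sqrD_le (A B U V Q W : R) : 0 <= A -> 0 <= B -> 0 <= U -> 0 <= V ->
  0 <= Q -> 0 <= W -> A ^+ 2 <= U * Q -> B ^+ 2 <= V * W ->
  (A + B) ^+ 2 <= (U + V) * (Q + W).
Proof.
move=> A0 B0 U0 V0 Q0 W0 A2 B2.
have AB : 2 * (A * B) <= U * W + V * Q.
  have h : (A * B) ^+ 2 <= (U * W) * (V * Q).
    by rewrite exprMn (le_trans (ler_pM _ _ A2 B2)) ?sqr_ge0//; lra.
  rewrite -(@ler_pXn2r _ 2) ?nnegrE ?mulr_ge0 ?addr_ge0 ?mulr_ge0// exprMn.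
  have := sqr_ge0 (U * W - V * Q); move: h.
  move: (A * B) (U * W) (V * Q) => x y z; rewrite sqrrB sqrrD; lra.
rewrite sqrrD; lra.
Qed.

Local Notation C := R[i].
Implicit Types (a : nat -> C) (z w lambda : C).

Lemma disc_conj_neq0 (c : R) lambda z : disc z -> normc lambda < c ->
  c%:C - lambda^* * z != 0.
Proof.
rewrite /disc/= => z1 lc; have l0 := normc_ge0 lambda; have z0 := normc_ge0 z.
rewrite subr_eq0; apply/eqP => /(congr1 (@normc _)).
rewrite normc_real normcM normc_conj gtr0_norm; last exact: le_lt_trans lc.
move=> E; move: lc; rewrite E ltNge => /negP; apply.
by rewrite ler_piMr// ltW.
Qed.

Variables (rho : R).
Hypothesis rho01 : 0 < rho < 1.

(* Blaschke factor of the disc of radius rho. *)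
Definition rblaschke lambda z : C :=
  rho%:C * (lambda - z) / ((rho ^+ 2)%:C - lambda^* * z).

(* Szegő kernel of the disc of radius rho at lambda, normalized to take the value 1 at
   lambda. *)
Definition rszego lambda z : C :=
  (rho ^+ 2 - normc lambda ^+ 2)%:C / ((rho ^+ 2)%:C - lambda^* * z).

(* [psum a = psum a lambda * rszego lambda + rblaschke lambda * psum (bshift lambda a)]
   is the orthogonal decomposition of H^2(|z| < rho) along rszego lambda. *)
Definition bshift lambda a (m : nat) : C :=
  lambda^* / rho%:C * a m +
  - ((rho ^+ 2 - normc lambda ^+ 2) / rho)%:C * dquot lambda a m.

Let rho0 : 0 < rho. Proof. by case/andP: rho01. Qed.
Let rho1 : rho < 1. Proof. by case/andP: rho01. Qed.

Lemma tame_bshift lambda a : tame a -> disc lambda -> tame (bshift lambda a).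
Proof. by move=> ta dl; apply: tame_linear => //; exact: tame_dquot. Qed.

Let rho_mid : rho < (rho + 1) / 2 < 1.
Proof. by move: rho1; lra. Qed.

Let rhoC0 : rho%:C != 0 :> C.
Proof. by rewrite eq_complex/= eqxx andbT gt_eqF. Qed.

Let sqr_rhoC : (rho ^+ 2)%:C = rho%:C ^+ 2 :> C. Proof. exact: rmorphXn. Qed.

Let rho_subC lambda :
  (rho ^+ 2 - normc lambda ^+ 2)%:C = rho%:C ^+ 2 - lambda * lambda^*.
Proof. by rewrite mulconjc -sqr_rhoC; exact: rmorphB. Qed.

Let rho_divC lambda :
  ((rho ^+ 2 - normc lambda ^+ 2) / rho)%:C = (rho%:C ^+ 2 - lambda * lambda^*) / rho%:C.
Proof. by rewrite -rho_subC -(fmorphV (real_complex R)); exact: rmorphM. Qed.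

Let szego_ge0 lambda : normc lambda < rho ^+ 2 ->
  0 <= (rho ^+ 2 - normc lambda ^+ 2) / rho ^+ 2.
Proof.
move=> lr; rewrite divr_ge0 ?sqr_ge0// subr_ge0 lerXn2r ?nnegrE ?normc_ge0 ?(ltW rho0)//.
by rewrite (le_trans (ltW lr))// expr2 ger_pMl// ltW.
Qed.

Lemma psum_bshift lambda a z : tame a -> normc lambda < rho ^+ 2 -> disc z ->
  psum a z = psum a lambda * rszego lambda z
             + rblaschke lambda z * psum (bshift lambda a) z.
Proof.
move=> ta lr dz.
have dl : disc lambda by rewrite /disc/= (lt_trans lr)// expr_lt1// ltW.
have td := tame_dquot ta dl.
rewrite psum_linear// (psum_dquot ta dl dz).
have := disc_conj_neq0 dz lr; rewrite /rszego /rblaschke.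
rewrite rho_divC rho_subC sqr_rhoC.
set P := psum _ z; set F := psum a lambda.
move: (rho%:C) rhoC0 => r r0 h; field.
by rewrite r0.
Qed.

(** Homogenized and rescaled form of |1 - lambda w|^2 - |lambda^* - w|^2 = (1 - |lambda|^2)(1 -
    |w|^2). For consecutive terms p, q of a sequence, the right side weighted by rho^(2m)
    telescopes. *)
Lemma sqr_normc_bshift lambda (p q : C) :
  rho ^+ 2 * normc (p - lambda * q) ^+ 2
    - normc (lambda^* * p - (rho ^+ 2)%:C * q) ^+ 2
  = (rho ^+ 2 - normc lambda ^+ 2) * (normc p ^+ 2 - rho ^+ 2 * normc q ^+ 2).
Proof.
rewrite !sqr_normcE; case: lambda p q => [l1 l2] [p1 p2] [q1 q2] /=; ring.
Qed.

(** Pythagoras for the decomposition [psum_bshift]: (rho^2 - |lambda|^2)/rho^2 is the squared norm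
    of [rszego lambda] in the Hardy space of |z| < rho, so the subtracted term is the squared norm
    of the kernel part. *)
Lemma bshift_sum_sqr_le lambda a S : tame a -> normc lambda < rho ^+ 2 ->
  (forall K, \sum_(k < K) normc (a k) ^+ 2 * rho ^+ k ^+ 2 <= S) ->
  forall K, \sum_(k < K) normc (bshift lambda a k) ^+ 2 * rho ^+ k ^+ 2 <=
    S - (rho ^+ 2 - normc lambda ^+ 2) / rho ^+ 2 * normc (psum a lambda) ^+ 2.
Proof.
move=> ta lr HS K.
have dl : disc lambda by rewrite /disc/= (lt_trans lr)// expr_lt1// ltW.
have td := tame_dquot ta dl.
(* Prefixing [dquot lambda a] with the value at lambda makes both [a] and [bshift lambda a] two-term
   combinations of consecutive terms of [e], as [sqr_normc_bshift] requires. *)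
pose e m := if m is m'.+1 then dquot lambda a m' else psum a lambda.
have ae m : a m = e m - lambda * e m.+1.
  by case: m => [|m] /=; [rewrite psum_dquot0// addrK|rewrite dquot_rec// addrK].
have be m : normc (bshift lambda a m) ^+ 2 =
    normc (lambda^* * e m - (rho ^+ 2)%:C * e m.+1) ^+ 2 / rho ^+ 2.
  rewrite -expr_div_n -{2}(gtr0_norm rho0) -normc_real -normcf_div.
  congr (normc _ ^+ 2).
  rewrite /bshift rho_divC ae sqr_rhoC/=.
  by move: (rho%:C) rhoC0 => r r0; field.
set c := _ / rho ^+ 2.
have c0 : 0 <= c by exact: szego_ge0.
have tele n : \sum_(k < n) normc (bshift lambda a k) ^+ 2 * rho ^+ k ^+ 2 =
    \sum_(k < n) normc (a k) ^+ 2 * rho ^+ k ^+ 2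
    - c * normc (psum a lambda) ^+ 2 + c * (normc (e n) * rho ^+ n) ^+ 2.
  elim: n => [|n IHn]; first by rewrite !big_ord0/= expr0 mulr1 add0r addNr.
  rewrite !big_ord_recr/= IHn be ae.
  have := sqr_normc_bshift lambda (e n) (e n.+1) => E.
  have -> : normc (lambda^* * e n - (rho ^+ 2)%:C * e n.+1) ^+ 2 =
    rho ^+ 2 * normc (e n - lambda * e n.+1) ^+ 2 - (rho ^+ 2 - normc lambda ^+ 2) * (normc (e n) ^+ 2 - rho ^+ 2 * normc (e n.+1) ^+ 2) by lra.
  rewrite /c [rho ^+ n.+1]exprS -[dquot lambda a n]/(e n.+1).
  have rn0 : rho != 0 by rewrite gt_eqF.
  by move: (rho ^+ n) (normc (e n.+1)) => x y; field.
(* The identity [tele] carries the nonnegative boundary term c (|e_n| rho^n)^2. It is made smaller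
   than eps by enlarging the number of terms, which only increases the left side. *)
apply/ler_addgt0Pr => eps eps0.
have /andP[mid1 mid2] := rho_mid.
have [||M M0 HM] := @tame_dominated _ _ rho ((rho + 1) / 2) td => //.
  by rewrite (ltW rho0).
set q := rho / _ in HM.
have q0 : 0 <= q by rewrite /q divr_ge0 ?(ltW rho0)// (le_trans (ltW rho0))// ltW.
have q1 : q < 1 by rewrite /q ltr_pdivrMr ?mul1r// (lt_trans rho0).
(* With del <= 1, a quantity at most del has its square at most del as well. *)
pose del := Num.min 1 (eps / (c + 1)).
have del0 : 0 < del by rewrite lt_min ltr01 divr_gt0// ltr_wpDl.
have /cvgrPdist_lt/(_ _ del0)[N _ HN] : geometric M q @ \oo --> (0 : R).
  by apply: cvg_geometric; rewrite ger0_norm.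
pose n := maxn K N.
have := HN n (leq_maxr _ _); rewrite /= sub0r normrN ger0_norm ?mulr_ge0 ?exprn_ge0//.
move=> Hn.
have en : c * (normc (e n.+1) * rho ^+ n.+1) ^+ 2 <= eps.
  have h0 : 0 <= normc (e n.+1) * rho ^+ n.+1.
    by rewrite mulr_ge0 ?normc_ge0 ?exprn_ge0// ltW.
  have h1 : normc (e n.+1) * rho ^+ n.+1 <= del.
    rewrite /= exprS mulrCA (le_trans _ (ltW Hn))// (le_trans _ (HM n))//.
    by rewrite ler_piMl// ?(ltW rho1)// mulr_ge0 ?normc_ge0 ?exprn_ge0// ltW.
  have h2 : (normc (e n.+1) * rho ^+ n.+1) ^+ 2 <= eps / (c + 1).
    apply: (@le_trans _ _ del); last by rewrite ge_min lexx orbT.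
    rewrite expr2 (le_trans (ler_wpM2r h0 h1))// -[leRHS]mulr1 ler_wpM2l ?(ltW del0)//.
    by rewrite (le_trans h1)// ge_min lexx.
  rewrite (le_trans (ler_wpM2l c0 h2))// mulrA ler_pdivrMr ?ltr_wpDl// mulrC.
  by rewrite ler_wpM2l ?(ltW eps0)// lerDl.
have mono m : (K <= m)%N -> \sum_(k < K) normc (bshift lambda a k) ^+ 2 * rho ^+ k ^+ 2 <=
  \sum_(k < m) normc (bshift lambda a k) ^+ 2 * rho ^+ k ^+ 2.
  move=> Km; rewrite (big_ord_widen _ (fun k => normc (bshift lambda a k) ^+ 2 * rho ^+ k ^+ 2) Km).
  rewrite big_mkcond/=; apply: ler_sum => k _; case: ifP => // _.
  by rewrite mulr_ge0 ?sqr_ge0.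
rewrite (le_trans (mono n.+1 _))//; first by rewrite leqW// leq_maxl.
rewrite tele; have := HS n.+1; lra.
Qed.

Variables (r Q q : R).
Hypotheses (rrho : r < rho ^+ 2) (q1 : 1 <= q) (Q0 : 0 <= Q).
Hypothesis bq : forall lambda z, normc lambda <= r -> disc z ->
  normc (rblaschke lambda z) ^+ 2 <= q.
Hypothesis kQ : forall lambda z, normc lambda <= r -> disc z ->
  normc (rszego lambda z) ^+ 2 <= Q * ((rho ^+ 2 - normc lambda ^+ 2) / rho ^+ 2).

Lemma Hol_rden lambda : normc lambda <= r ->
  Hol (fun z => ((rho ^+ 2)%:C - lambda^* * z)^-1).
Proof.
move=> lr; apply: HolV => [|z dz].
  by apply: HolB; [exact: Hol_cst|apply: HolM; [exact: Hol_cst|exact: Hol_id]].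
by apply: disc_conj_neq0 => //; exact: le_lt_trans rrho.
Qed.

(** Induction over the nodes. At each step S splits into the squared norm of the kernel term and
    what is left for the remaining nodes; the Cauchy-Schwarz inequality [sqrD_le] then makes the
    costs Q of the nodes add up, which gives a bound linear in the number of nodes apart from the
    powers of q. *)
Lemma Hol_interpolation sigma a S : tame a ->
  (forall lambda, lambda \in sigma -> normc lambda <= r) ->
  (forall K, \sum_(k < K) normc (a k) ^+ 2 * rho ^+ k ^+ 2 <= S) ->
  exists g h, [/\ Hol g, Hol h,
    forall z, disc z -> psum a z = g z + blaschke sigma z * h z &
    forall z, disc z -> normc (g z) ^+ 2 <= S * (size sigma)%:R * Q * q ^+ size sigma].
Proof.
elim: sigma a S => [|lambda sigma IH] a S ta Hs HS.
  exists (fun=> 0), (psum a); split.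
  - exact: Hol_cst.
  - exact: (Hol_psum ta).
  - by move=> z dz; rewrite /blaschke big_nil mul1r add0r.
  - by move=> z dz; rewrite normc0 expr0n/= mulr0 !mul0r.
have lr : normc lambda <= r by apply: Hs; rewrite mem_head.
have lr2 : normc lambda < rho ^+ 2 by exact: le_lt_trans rrho.
have dl : disc lambda by rewrite /disc/= (lt_trans lr2)// expr_lt1// ltW.
have /(IH _ _ (tame_bshift ta dl))[|g1 [h1 [Hg1 Hh1 E1 B1]]] := bshift_sum_sqr_le ta lr2 HS.
  by move=> l ls; apply: Hs; rewrite inE ls orbT.
pose c := psum a lambda.
(* Quotient of the Blaschke factor of |z| < rho by that of the unit disc. Moving it into the
   cofactor h restores the product [blaschke] required by [agree_on]. *)
pose u z := rho%:C * (1 - lambda^* * z) * ((rho ^+ 2)%:C - lambda^* * z)^-1.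
exists (fun z => c * rszego lambda z + rblaschke lambda z * g1 z), (fun z => u z * h1 z).
have Hb : Hol (rblaschke lambda).
  apply: HolM; last exact: Hol_rden.
  by apply: HolM; [exact: Hol_cst|apply: HolB; [exact: Hol_cst|exact: Hol_id]].
have Hu : Hol u.
  apply: HolM; last exact: Hol_rden.
  apply: HolM; first exact: Hol_cst.
  by apply: HolB; [exact: Hol_cst|apply: HolM; [exact: Hol_cst|exact: Hol_id]].
split.
- apply: HolD; last exact: HolM.
  by apply: HolM; [exact: Hol_cst|apply: HolM; [exact: Hol_cst|exact: Hol_rden]].
- exact: HolM.
- move=> z dz; rewrite (psum_bshift ta lr2 dz) E1// mulrDr addrA; congr (_ + _).
  rewrite /blaschke big_cons -/(blaschke sigma z).
  suff -> : rblaschke lambda z = blaschke_factor lambda z * u z by ring.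
  rewrite /rblaschke /blaschke_factor /u.
  have d1 := disc_conj_neq0 dz lr2.
  have d2 : 1 - lambda^* * z != 0 by have := @disc_conj_neq0 1 _ _ dz dl.
  by move: ((rho ^+ 2)%:C) (rho%:C) d1 => x y d1; field; rewrite d1 d2.
move=> z dz; rewrite [size (_ :: _)]/= -natr1 [q ^+ _.+1]exprSr.
set m : R := (size sigma)%:R; set qm := q ^+ size sigma.
have m0 : 0 <= m by exact: ler0n.
have q0 : 0 <= q by exact: le_trans q1.
have qm1 : 1 <= qm by rewrite exprn_ege1.
have := B1 z dz; rewrite -/m -/qm -/c.
have := kQ lr dz; have := bq lr dz.
have := szego_ge0 lr2; set s := (_ - _) / rho ^+ 2 => s0.
set x := normc (rblaschke _ _); set y := normc (rszego _ _); set v := normc (g1 z).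
move=> xq yQ vS.
have uS : s * normc c ^+ 2 <= S.
  have := bshift_sum_sqr_le ta lr2 HS 0; rewrite big_ord0 -/s -/c; lra.
have nz : 0 <= normc c * y + x * v by rewrite addr_ge0// mulr_ge0 ?normc_ge0.
apply: (@le_trans _ _ ((normc c * y + x * v) ^+ 2)).
  rewrite lerXn2r ?nnegrE ?normc_ge0// (le_trans (ler_normcD _ _))//.
  by rewrite (normcM c) (normcM (rblaschke lambda z)).
set U := s * normc c ^+ 2 in vS uS; set S1 := S - U in vS.
have y2 : (normc c * y) ^+ 2 <= U * Q.
  have -> : U * Q = normc c ^+ 2 * (Q * s) by rewrite /U; ring.
  by rewrite exprMn ler_wpM2l ?sqr_ge0.
have v2 : (x * v) ^+ 2 <= q * (S1 * m * Q * qm).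
  by rewrite exprMn ler_pM ?sqr_ge0.
pose W := m * Q * (qm * q).
have W0 : 0 <= W by rewrite !mulr_ge0// (le_trans ler01).
have {}v2 : (x * v) ^+ 2 <= S1 * W by rewrite (le_trans v2)// /W; lra.
have U0 : 0 <= U by rewrite mulr_ge0 ?sqr_ge0.
have S10 : 0 <= S1 by rewrite subr_ge0.
(* The weights are paired as (U, Q) for the kernel term and (S1, W) for the remainder, with U + S1 =
   S. *)
have cs : (normc c * y + x * v) ^+ 2 <= S * (Q + W).
  have -> : S = U + S1 by rewrite addrC subrK.
  by apply: sqrD_le => //; rewrite mulr_ge0 ?normc_ge0.
rewrite (le_trans cs)//.
have S0 : 0 <= S by exact: le_trans uS.
have -> : S * (m + 1) * Q * (qm * q) = S * (Q * (qm * q) + W) by rewrite /W; ring.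
rewrite ler_wpM2l// lerD2r ler_peMr// -[1]mulr1 ler_pM//.
Qed.

End Interpolation.

(** * Explicit constants for interpolation on the unit disc *)

Section EffectiveInterpolation.
Variable R : realType.
Local Notation C := R[i].
Implicit Types (a : nat -> C) (z w lambda : C).

(* The factor 4 makes the Blaschke factors of the disc of radius [interp_radius r n] bounded
   by 1 + O(1/n) on the unit disc, so that products of n of them are O(1) there. *)
Definition interp_radius (r : R) (n : nat) : R := 1 - (1 - r) / (4 * n%:R).

Section Bounds.
Variables (r : R) (n : nat).
Hypotheses (r01 : 0 <= r < 1) (n1 : (1 <= n)%N).
Let rho := interp_radius r n.
Let d := (1 - r) / (4 * n%:R).

Let n_ge1 : 1 <= n%:R :> R. Proof. by rewrite ler1n. Qed.
Let n_gt0 : 0 < n%:R :> R. Proof. by rewrite ltr0n. Qed.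
Let r0 : 0 <= r. Proof. by case/andP: r01. Qed.
Let r1 : r < 1. Proof. by case/andP: r01. Qed.

Let d_gt0 : 0 < d.
Proof. by rewrite divr_gt0// ?subr_gt0// mulr_gt0. Qed.

Let dE : 4 * n%:R * d = 1 - r.
Proof. by rewrite /d mulrC divfK// gt_eqF// mulr_gt0. Qed.

Let d_le : d <= (1 - r) / 4.
Proof. by rewrite -dE; have := ler_wpM2r (ltW d_gt0) n_ge1; lra. Qed.

Lemma interp_radius_itv : 0 < rho < 1.
Proof. by rewrite /rho /interp_radius -/d; have := d_le; have := d_gt0; have := r0; lra. Qed.

Let sqr_rho : (1 - rho ^+ 2 <= 2 * d) /\ (rho ^+ 2 <= 1).
Proof.
have -> : rho ^+ 2 = 1 - 2 * d + d ^+ 2 by rewrite /rho /interp_radius -/d; ring.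
have := sqr_ge0 d; split; first lra.
by have := d_le; have := d_gt0; have := r0; rewrite expr2; nra.
Qed.

Lemma interp_radius_gt : r < rho ^+ 2.
Proof. by have [h _] := sqr_rho; have := d_le; have := r1; lra. Qed.

Section Point.
Variables (lambda z : C).
Hypotheses (lr : normc lambda <= r) (dz : disc z).
Let s := normc lambda.

Let s_ge0 : 0 <= s. Proof. exact: normc_ge0. Qed.
Let sr : s <= r. Proof. exact: lr. Qed.

Let den_ge : (1 - s) / 2 <= rho ^+ 2 - s.
Proof. by have [h _] := sqr_rho; have := d_le; have := sr; lra. Qed.

Let D2 := normc ((rho ^+ 2)%:C - lambda^* * z) ^+ 2.

Let D2_ge : (1 - s) ^+ 2 / 4 <= D2.
Proof.
have h : (1 - s) / 2 <= normc ((rho ^+ 2)%:C - lambda^* * z).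
  rewrite (le_trans den_ge)// (le_trans _ (lerB_normc _ _))//.
  rewrite normcM normc_conj normc_real ger0_norm ?sqr_ge0// lerD2l lerN2.
  by rewrite ler_piMr ?normc_ge0// ltW.
have s1 : 0 <= (1 - s) / 2 by have := r1; have := sr; lra.
have -> : (1 - s) ^+ 2 / 4 = ((1 - s) / 2) ^+ 2 by field.
by rewrite /D2 lerXn2r ?nnegrE ?normc_ge0.
Qed.

Let s_lt1 : s < 1. Proof. exact: le_lt_trans sr r1. Qed.

Let D2_gt0 : 0 < D2.
Proof. by apply: lt_le_trans D2_ge; rewrite divr_gt0// exprn_gt0// subr_gt0. Qed.

Let num_le : rho ^+ 2 - s ^+ 2 <= 2 * (1 - s).
Proof. by have [_ h] := sqr_rho; have := s_ge0; have := s_lt1; rewrite (expr2 s); nra. Qed.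

Let num_ge0 : 0 <= rho ^+ 2 - s ^+ 2.
Proof. by have := den_ge; have := s_ge0; have := s_lt1; rewrite (expr2 s); nra. Qed.

(** The excess over 1 equals (rho^2 - s^2)(|z|^2 - rho^2)/D2. The factors are at most 2(1 - s), 2d
    and 4/(1 - s)^2, and 16 d/(1 - s) <= 4/n since 4 n d = 1 - r <= 1 - s. *)
Lemma rblaschke_le : normc (rblaschke rho lambda z) ^+ 2 <= 1 + 4 / n%:R.
Proof.
rewrite /rblaschke normcf_div expr_div_n -/D2 ler_pdivrMr// normcM exprMn normc_real.
rewrite real_normK ?num_real//.
have E : rho ^+ 2 * normc (lambda - z) ^+ 2 =
    D2 - (rho ^+ 2 - s ^+ 2) * (rho ^+ 2 - normc z ^+ 2).
  rewrite /D2 /s !sqr_normcE; case: lambda z => [l1 l2] [z1 z2] /=; ring.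
rewrite E [leRHS]mulrDl mul1r lerD2l -mulrN opprB.
have [h1 h2] := sqr_rho.
have z1 : normc z ^+ 2 <= 1 by rewrite expr_le1 ?normc_ge0// ltW.
apply: (@le_trans _ _ ((2 * (1 - s)) * (2 * d))).
  apply: (@le_trans _ _ ((rho ^+ 2 - s ^+ 2) * (2 * d))).
    by rewrite ler_wpM2l//; lra.
  by rewrite ler_wpM2r// mulr_ge0// ltW.
apply: (@le_trans _ _ (4 / n%:R * ((1 - s) ^+ 2 / 4))); last first.
  by rewrite ler_wpM2l// divr_ge0// ltW.
have -> : 2 * (1 - s) * (2 * d) = (1 - r) * (1 - s) / n%:R.
  by rewrite -dE; field; rewrite gt_eqF.
have -> : 4 / n%:R * ((1 - s) ^+ 2 / 4) = (1 - s) * (1 - s) / n%:R.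
  by field; rewrite gt_eqF.
by rewrite ler_pM2r ?invr_gt0// ler_wpM2r// ?lerB// subr_ge0 ltW.
Qed.

(** Relative to the squared norm of the kernel there remains (rho^2 - s^2) rho^2/D2, at most 2(1 -
    s) times 4/(1 - s)^2, that is 8/(1 - s). *)
Lemma rszego_le : normc (rszego rho lambda z) ^+ 2 <=
  8 / (1 - r) * ((rho ^+ 2 - normc lambda ^+ 2) / rho ^+ 2).
Proof.
have [h1 h2] := sqr_rho; have /andP[rho0 _] := interp_radius_itv.
rewrite /rszego normcf_div expr_div_n -/D2 ler_pdivrMr// normc_real -/s.
rewrite real_normK ?num_real// expr2 [leRHS](_ : _ =
  (rho ^+ 2 - s ^+ 2) * (8 / (1 - r) * D2 / rho ^+ 2)); last by ring.
rewrite ler_wpM2l// ler_pdivlMr ?exprn_gt0//.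
apply: (@le_trans _ _ (rho ^+ 2 - s ^+ 2)); first by rewrite ler_piMr.
rewrite (le_trans num_le)// mulrAC ler_pdivlMr ?subr_gt0//.
apply: (@le_trans _ _ (8 * ((1 - s) ^+ 2 / 4))); last by rewrite ler_wpM2l.
have -> : 8 * ((1 - s) ^+ 2 / 4) = 2 * (1 - s) * (1 - s) by field.
by rewrite ler_wpM2l ?lerB// mulr_ge0// subr_ge0 ltW.
Qed.

End Point.

Lemma Hinf_interpolation sigma a S : tame a -> (size sigma <= n)%N ->
  (forall lambda, lambda \in sigma -> normc lambda <= r) ->
  (forall K, \sum_(k < K) normc (a k) ^+ 2 * rho ^+ k ^+ 2 <= S) ->
  exists g h, [/\ Hol g, Hol h,
    forall z, disc z -> psum a z = g z + blaschke sigma z * h z &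
    forall z, disc z -> normc (g z) ^+ 2 <= 8 * expR 4 * S * (n%:R / (1 - r))].
Proof.
move=> ta sn Hs HS.
have q1 : 1 <= 1 + 4 / n%:R :> R by rewrite lerDl divr_ge0// ltW.
have Q0 : 0 <= 8 / (1 - r) by rewrite divr_ge0// subr_ge0 ltW.
have [g [h [Hg Hh E B]]] := Hol_interpolation interp_radius_itv interp_radius_gt
  q1 Q0 rblaschke_le rszego_le ta Hs HS.
exists g, h; split => // z dz; rewrite (le_trans (B z dz))//.
have S0 : 0 <= S by have := HS 0; rewrite big_ord0.
have qn : (1 + 4 / n%:R) ^+ size sigma <= expR 4 :> R.
  apply: (@le_trans _ _ ((1 + 4 / n%:R) ^+ n)); first exact: ler_weXn2l.
  have -> : expR 4 = expR (4 / n%:R) ^+ n :> R.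
    by rewrite -expRM_natr divfK// gt_eqF.
  by rewrite lerXn2r ?nnegrE ?expR_ge0 ?expR_ge1Dx// (le_trans ler01).
have sn' : (size sigma)%:R <= n%:R :> R by rewrite ler_nat.
have q0 : 0 <= (1 + 4 / n%:R) ^+ size sigma :> R by rewrite exprn_ge0// (le_trans ler01).
have -> : 8 * expR 4 * S * (n%:R / (1 - r)) = S * n%:R * (8 / (1 - r)) * expR 4 by ring.
apply: ler_pM => //; first by apply: mulr_ge0 => //; exact: mulr_ge0.
by rewrite ler_wpM2r// ler_wpM2l.
Qed.

End Bounds.

Lemma Hinf_normP (g : C -> C) (B : R) :
  (Hinf_norm g <= B%:E)%E <-> forall z, disc z -> normc (g z) <= B.
Proof.
split => [H z dz|H].
  rewrite -lee_fin (le_trans _ H)//; apply: ereal_sup_ubound; by exists z.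
by apply: ge_ereal_sup => _ [z dz <-]; rewrite lee_fin; exact: H.
Qed.

(** The space X enters only through the last hypothesis: its unit ball lies in a ball of the Hardy
    space of |z| < [interp_radius r n]. *)
Lemma interp_const_le (n : nat) (r S B : R) sigma (X : hol_space R) :
  (1 <= n)%N -> 0 <= r < 1 -> (size sigma <= n)%N ->
  (forall lambda, lambda \in sigma -> normc lambda <= r) -> 0 <= B ->
  8 * expR 4 * S * (n%:R / (1 - r)) <= B ^+ 2 ->
  (forall f, hol_carrier X f -> (hol_norm X f <= 1)%E -> exists a, [/\ tame a,
    forall z, disc z -> f z = psum a z &
    forall K, \sum_(k < K) normc (a k) ^+ 2 * interp_radius r n ^+ k ^+ 2 <= S]) ->
  (interp_const sigma X (Hinf R) <= B%:E)%E.
Proof.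
move=> n1 r01 sn Hs B0 SB HX; apply: ge_ereal_sup => _ [f [Xf f1] <-].
have [a [ta fa Sa]] := HX f Xf f1.
have [g [h [Hg Hh E Bg]]] := Hinf_interpolation r01 n1 ta sn Hs Sa.
have gB : (Hinf_norm g <= B%:E)%E.
  apply/Hinf_normP => z dz.
  by rewrite -(@ler_pXn2r _ 2) ?nnegrE ?normc_ge0// (le_trans (Bg z dz)).
apply: (le_trans _ gB); apply: ereal_inf_lbound; exists g => //; split.
  by split => //; exact: le_lt_trans gB (ltry B).
by exists h => // z dz; rewrite fa// E// addrAC subrr add0r.
Qed.

End EffectiveInterpolation.

(** * Weighted sequence spaces *)

Section SequenceSpaces.
Variable R : realType.
Local Notation C := R[i].

(** The inequality y <= (t + 1) exp(y/(t + 1)) is raised to the power t. Dividing by t + 1 rather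
    than t covers t = 0. *)
Lemma powR_le_expR (t y : R) : 0 <= t -> 0 <= y -> y `^ t <= (t + 1) `^ t * expR y.
Proof.
move=> t0 y0; have t1 : 0 < t + 1 by rewrite ltr_wpDl.
have h : y <= (t + 1) * expR (y / (t + 1)).
  rewrite -ler_pdivrMl// mulrC (le_trans _ (expR_ge1Dx _))//.
  by rewrite lerDr.
apply: (@le_trans _ _ (((t + 1) * expR (y / (t + 1))) `^ t)).
  by rewrite ge0_ler_powR ?nnegrE// mulr_ge0 ?expR_ge0 ?ltW.
rewrite powRM ?expR_ge0 ?(ltW t1)// ler_wpM2l ?powR_ge0//.
rewrite -expRM ler_expR mulrAC ler_pdivrMr// ler_wpM2l// lerDl//.
Qed.

(** Apply [powR_le_expR] at y = (k + 1) d. The resulting exponential is absorbed by (1 - d)^(2k) <=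
    exp(-2kd), which leaves exp(d - kd) <= e. *)
Lemma powR_exprn_le (t d : R) k : 0 <= t -> 0 < d <= 1 ->
  k.+1%:R `^ t * (1 - d) ^+ k ^+ 2 <= (t + 1) `^ t * expR 1 * (d^-1) `^ t.
Proof.
move=> t0 /andP[d0 d1].
have y0 : 0 <= k.+1%:R * d by rewrite mulr_ge0// ltW.
have -> : k.+1%:R `^ t = (k.+1%:R * d) `^ t * (d^-1) `^ t :> R.
  by rewrite -powRM// ?invr_ge0 ?(ltW d0)// mulfK// gt_eqF.
rewrite mulrAC ler_wpM2r ?powR_ge0//.
have h : (1 - d) ^+ k <= expR (- (k%:R * d)).
  rewrite -mulrN mulrC expRM_natr lerXn2r ?nnegrE ?subr_ge0 ?expR_ge0//.
  exact: expR_ge1Dx.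
have h2 : (1 - d) ^+ k ^+ 2 <= expR (- (k%:R * d) + - (k%:R * d)).
  by rewrite expRD -expr2 lerXn2r ?nnegrE ?expR_ge0// exprn_ge0// subr_ge0.
rewrite (le_trans (ler_pM (powR_ge0 _ _) _ (powR_le_expR t0 y0) h2))//.
  by rewrite sqr_ge0.
rewrite -mulrA ler_wpM2l ?powR_ge0// -expRD ler_expR -natr1.
have : 0 <= k%:R * d by rewrite mulr_ge0// ltW.
by rewrite mulrDl mul1r; lra.
Qed.

Lemma invr_1_interp_radius (r : R) (n : nat) :
  1 - interp_radius r n = (4 * (n%:R / (1 - r)))^-1.
Proof. by rewrite /interp_radius opprB addrC subrK !invfM invrK mulrA mulrC. Qed.

Lemma div_1_ge1 (r : R) (n : nat) : (1 <= n)%N -> 0 <= r < 1 -> 1 <= n%:R / (1 - r).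
Proof.
move=> n1 /andP[r0 r1]; rewrite ler_pdivlMr ?subr_gt0// mul1r.
by rewrite (@le_trans _ _ 1) ?gerBl// ler1n.
Qed.

(* A space embedded in the weighted l^2 space with weights (k+1)^(-t). *)
Lemma interp_const_nr_le (t T : R) (X : hol_space R) : 0 <= t -> 0 <= T ->
  (forall f, hol_carrier X f -> (hol_norm X f <= 1)%E -> exists a, [/\ tame a,
    forall z, disc z -> f z = psum a z &
    forall K, \sum_(k < K) normc (a k) ^+ 2 * k.+1%:R `^ (- t) <= T]) ->
  exists2 A : R, 0 < A & forall (n : nat) (r : R), (1 <= n)%N -> 0 <= r < 1 ->
    (interp_const_nr n r X (Hinf R) <= (A * (n%:R / (1 - r)) `^ ((t + 1) / 2))%:E)%E.
Proof.
move=> t0 T0 HX.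
pose D : R := (t + 1) `^ t * expR 1 * 4 `^ t.
have D0 : 0 <= D by rewrite !mulr_ge0 ?powR_ge0 ?expR_ge0.
have c0 : 0 <= 8 * expR 4 * T * D.
  by do 3 (apply: mulr_ge0 => //); exact: expR_ge0.
exists (Num.sqrt (8 * expR 4 * T * D) + 1); first by rewrite ltr_wpDl ?sqrtr_ge0.
move=> n r n1 r01.
have M1 := div_1_ge1 n1 r01; set M := n%:R / (1 - r) in M1 *.
have M0 : 0 < M by exact: lt_le_trans M1.
apply: ge_ereal_sup => _ [sigma [sn Hs] <-].
have A0 : 0 <= Num.sqrt (8 * expR 4 * T * D) + 1 by rewrite addr_ge0 ?sqrtr_ge0.
(* This S comes from [powR_exprn_le] with d = 1/(4M). Its product with M is of order M^(t + 1),
   whose square root gives the exponent (t + 1)/2. *)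
apply: (@interp_const_le _ n r (T * (D * M `^ t))) => //.
- by rewrite mulr_ge0 ?powR_ge0.
- rewrite -/M exprMn.
  have t1 : 0 < t + 1 by rewrite ltr_wpDl.
  have -> : M `^ ((t + 1) / 2) ^+ 2 = M `^ t * M.
    rewrite -powR_mulrn ?powR_ge0// -powRrM divfK// powRD ?(gt_eqF t1)//.
    by rewrite powRr1// ltW.
  have -> : 8 * expR 4 * (T * (D * M `^ t)) * M = 8 * expR 4 * T * D * (M `^ t * M) by ring.
  apply: ler_wpM2r; first by apply: mulr_ge0; [exact: powR_ge0|exact: ltW].
  rewrite -[leLHS]sqr_sqrtr//.
  by rewrite lerXn2r ?nnegrE ?sqrtr_ge0// lerDl.
- move=> f Xf f1; have [a [ta fa Ha]] := HX f Xf f1.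
  exists a; split => // K.
  apply: (@le_trans _ _ (\sum_(k < K) (normc (a k) ^+ 2 * k.+1%:R `^ (- t)) * (D * M `^ t))).
    apply: ler_sum => k _; rewrite -mulrA ler_wpM2l ?sqr_ge0// powRN mulrC.
    rewrite ler_pdivlMr ?powR_gt0// mulrC.
    have dE : interp_radius r n = 1 - (4 * M)^-1.
      by rewrite -invr_1_interp_radius opprB addrC subrK.
    have M4 : 0 < 4 * M by exact: mulr_gt0.
    have M4' : 1 <= 4 * M by apply: (le_trans M1); rewrite ler_peMl ?(ltW M0)// ler1n.
    rewrite dE (le_trans (powR_exprn_le _ t0 _))//; first by rewrite invr_gt0 M4 invf_le1.
    by rewrite invrK powRM ?(ltW M0)// /D; lra.
  by rewrite -mulr_suml ler_wpM2r// mulr_ge0 ?powR_ge0.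
Qed.

Lemma sum_inv_sqr_le K : \sum_(k < K) (k.+1%:R ^+ 2)^-1 <= 2 :> R.
Proof.
suff H : \sum_(k < K.+1) (k.+1%:R ^+ 2)^-1 <= 2 - K.+1%:R^-1 :> R.
  apply: (@le_trans _ _ (\sum_(k < K.+1) (k.+1%:R ^+ 2)^-1)).
    by rewrite big_ord_recr/= lerDl invr_ge0 sqr_ge0.
  by rewrite (le_trans H)// gerBl.
elim: K => [|K IH]; first by rewrite big_ord1 expr1n invr1; lra.
rewrite big_ord_recr/=.
have h : (K.+2%:R ^+ 2)^-1 <= K.+1%:R^-1 - K.+2%:R^-1 :> R.
  have -> : K.+1%:R^-1 - K.+2%:R^-1 = (K.+1%:R * K.+2%:R)^-1 :> R.
    have gen (x : R) : x != 0 -> x + 1 != 0 -> x^-1 - (x + 1)^-1 = (x * (x + 1))^-1.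
      by move=> x0 x1; field; rewrite x0 x1.
    by rewrite -[K.+2%:R]natr1 gen// natr1.
  by rewrite expr2 lef_pV2 ?posrE ?mulr_gt0// ler_wpM2r// ler_nat.
by rewrite (le_trans (lerD IH h))// addrA subrK.
Qed.

(* For q >= 2, Hoelder's inequality l^q c l^2((k+1)^-(2-4/q)), in pointwise form. *)
Lemma sqr_powR_le (q x w : R) : 2 <= q -> 0 <= x -> 0 < w ->
  x ^+ 2 * w `^ (1 - 2 / q) <= x `^ q + w.
Proof.
move=> q2 x0 w0; have q0 : 0 < q by exact: lt_le_trans q2.
have e0 : 0 <= 1 - 2 / q by rewrite subr_ge0 ler_pdivrMr// mul1r.
have [wx|xw] := leP w (x `^ q).
  have xp : 0 < x by rewrite (@gt0_powR _ _ q) // (lt_le_trans w0).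
  rewrite -[leLHS]addr0 lerD ?(ltW w0)//.
  apply: (@le_trans _ _ (x ^+ 2 * (x `^ q) `^ (1 - 2 / q))).
    by rewrite ler_wpM2l ?sqr_ge0// ge0_ler_powR ?nnegrE ?powR_ge0 ?(ltW w0).
  rewrite -powRrM mulrBr mulr1 mulrCA divff ?gt_eqF// mulr1.
  by rewrite -powR_mulrn// -powRD ?gt_eqF ?implybT// addrC subrK.
rewrite -[leLHS]add0r lerD ?powR_ge0//.
have xE : x ^+ 2 = (x `^ q) `^ (2 / q).
  by rewrite -powRrM mulrCA divff ?gt_eqF// mulr1 powR_mulrn.
apply: (@le_trans _ _ (w `^ (2 / q) * w `^ (1 - 2 / q))).
  rewrite ler_wpM2r ?powR_ge0// xE ge0_ler_powR ?nnegrE ?powR_ge0 ?(ltW w0) ?(ltW xw)//.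
  by rewrite divr_ge0// ltW.
by rewrite -powRD ?(gt_eqF w0) ?implybT// [X in w `^ X]addrC subrK powRr1 ?(ltW w0).
Qed.

Lemma poweR_inv_le1 (q : R) (x : \bar R) : 0 < q -> (0 <= x)%E ->
  (x `^ q^-1 <= 1)%E -> (x <= 1)%E.
Proof.
move=> q0 x0 H; have -> : x = ((x `^ q^-1) `^ q)%E.
  by rewrite -poweRrM mulVf ?lt0r_neq0// poweRe1.
rewrite -[leRHS](poweR1r q); apply: gt0_ler_poweR => //; first exact: ltW.
- by rewrite in_itv/= poweR_ge0 leey.
- by rewrite in_itv/= lee_fin ler01 leey.
Qed.

Section LapNorm.
Variables (alpha : R) (f : C -> C).
Let x k := normc (taylor_coef f k) * k.+1%:R `^ (- (alpha - 1)).

Lemma lap_norm_fin_le (q : R) : 0 < q -> (lap_norm alpha q%:E f <= 1)%E ->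
  forall K, \sum_(k < K) x k `^ q <= 1.
Proof.
move=> q0 H K.
pose u k := normc (taylor_coef f k) `^ q * (1 / k.+1%:R `^ (q * (alpha - 1))).
have uE k : u k = x k `^ q.
  rewrite /x powRM ?normc_ge0 ?powR_ge0//; congr (_ * _).
  by rewrite div1r -powRN -powRrM mulNr mulrC.
have u0 k : (0 <= (u k)%:E)%E by rewrite uE lee_fin powR_ge0.
have s0 : (0 <= \sum_(0 <= k <oo) (u k)%:E)%E by apply: nneseries_ge0.
have s1 : (\sum_(0 <= k <oo) (u k)%:E <= 1)%E.
  exact: poweR_inv_le1 q0 s0 H.
have := le_trans (nneseries_lim_ge K (fun k _ _ => u0 k)) s1.
by rewrite sumEFin lee_fin big_mkord; under eq_bigr do rewrite uE.
Qed.

Lemma lap_norm_pinfty_le : (lap_norm alpha +oo f <= 1)%E -> forall k, x k <= 1.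
Proof.
move=> H k; rewrite -lee_fin (le_trans _ H)//.
by apply: ereal_sup_ubound; exists k.
Qed.

Lemma lap_l2_le (tau : R) K T :
  \sum_(k < K) x k ^+ 2 * k.+1%:R `^ (- tau) <= T ->
  \sum_(k < K) normc (taylor_coef f k) ^+ 2 *
     k.+1%:R `^ (- (2 * (alpha - 1) + tau)) <= T.
Proof.
apply: le_trans; apply: ler_sum => k _.
rewrite /x exprMn -[leRHS]mulrA -(powR_mulrn 2 (powR_ge0 k.+1%:R (- (alpha - 1)))).
by rewrite -powRrM -powRD ?pnatr_eq0 ?implybT// opprD mulNr [X in _ `^ (- X + _)]mulrC.
Qed.

End LapNorm.

(** For p <= 2 the weighted coefficients are at most 1, so their squares are below their p-th
    powers. For finite p >= 2, [sqr_powR_le] is used with the summable weight w = (k + 1)^(-2); then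
    3 is 1 for the norm plus 2 for the sum of the weights. At p = +oo the weights alone suffice. *)
Lemma lap_l2 (alpha : R) (p : \bar R) (f : C -> C) : (1 <= p)%E ->
  (lap_norm alpha p f <= 1)%E ->
  ((p <= 2%:E)%E -> forall K, \sum_(k < K) normc (taylor_coef f k) ^+ 2 *
     k.+1%:R `^ (- (2 * (alpha - 1))) <= 3) /\
  ((2%:E <= p)%E -> forall K, \sum_(k < K) normc (taylor_coef f k) ^+ 2 *
     k.+1%:R `^ (- (2 * (alpha - 1) + (2 - 4 * fine (p^-1)%E))) <= 3).
Proof.
case: p => [q| |//].
- rewrite !lee_fin => q1 /lap_norm_fin_le => /(_ (lt_le_trans ltr01 q1)) H.
  have q0 : 0 < q by exact: lt_le_trans q1.
  split.
    move=> q2 K; rewrite -[2 * _]addr0; apply: lap_l2_le.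
    apply: (le_trans _ (le_trans (H K) _)); last lra.
    apply: ler_sum => k _; rewrite oppr0 powRr0 mulr1.
    set x := _ * _; have x0 : 0 <= x by rewrite mulr_ge0 ?normc_ge0 ?powR_ge0.
    have x1 : x `^ q <= 1.
      apply: le_trans (H k.+1); rewrite big_ord_recr/= lerDr.
      by apply: sumr_ge0 => i _; exact: powR_ge0.
    have [->|xn0] := eqVneq x 0; first by rewrite expr0n/= powR_ge0.
    have {}x1 : x <= 1.
      rewrite leNgt; apply/negP => x1'; move: x1; rewrite leNgt => /negP; apply.
      by have := gt0_ltr_powR q0; move=> /(_ 1 x); rewrite powR1; apply => //; rewrite nnegrE.
    by rewrite -powR_mulrn// ger_powR// x1 andbT lt_def xn0.
  move=> q2 K; rewrite fine_invr; apply: lap_l2_le.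
  apply: (@le_trans _ _ (\sum_(k < K) ((normc (taylor_coef f k) * k.+1%:R `^ (- (alpha - 1))) `^ q + (k.+1%:R ^+ 2)^-1))).
    apply: ler_sum => k _.
    set x := normc _ * _; have x0 : 0 <= x by rewrite mulr_ge0 ?normc_ge0 ?powR_ge0.
    have w0 : 0 < (k.+1%:R ^+ 2)^-1 :> R by rewrite invr_gt0 exprn_gt0.
    apply: le_trans (sqr_powR_le q2 x0 w0).
    rewrite ler_wpM2l ?sqr_ge0// -powR_invn// -powRrM.
    have -> : 1 *- 2 * (1 - 2 / q) = - (2 - 4 / q) :> R by ring.
    by [].
  by rewrite big_split/=; have := sum_inv_sqr_le K; have := H K; lra.
- move=> _ /lap_norm_pinfty_le H; split => // _ K.
  rewrite invey/= mulr0 subr0; apply: lap_l2_le.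
  apply: (le_trans _ (le_trans (sum_inv_sqr_le K) _)); last lra.
  apply: ler_sum => k _; rewrite (powRN k.+1%:R 2) powR_mulrn// -[leRHS]mul1r ler_wpM2r ?invr_ge0 ?sqr_ge0//.
  by rewrite expr_le1// mulr_ge0 ?normc_ge0 ?powR_ge0.
Qed.

Lemma lap_upper (alpha : R) (p : \bar R) : 1 <= alpha -> (1 <= p)%E ->
  exists2 A : R, 0 < A & forall (n : nat) (r : R), (1 <= n)%N -> 0 <= r < 1 ->
   ((p <= 2%:E)%E -> (interp_const_nr n r (lap alpha p) (Hinf R)
       <= (A * (n%:R / (1 - r)) `^ (alpha - 1 / 2))%:E)%E) /\
   ((2%:E <= p)%E -> (interp_const_nr n r (lap alpha p) (Hinf R)
       <= (A * (n%:R / (1 - r)) `^ (alpha + 1 / 2 - 2 * fine (p^-1)%E))%:E)%E).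
Proof.
move=> alpha1 p1.
have base f : hol_carrier (lap alpha p) f -> tame (taylor_coef f) /\
    forall z, disc z -> f z = psum (taylor_coef f) z.
  move=> [Hf _]; split; first exact: tame_of_cvg Hf.
  by move=> z dz; rewrite (psumE (Hf z dz)).
have t0 : 0 <= 2 * (alpha - 1) by lra.
have [p2|p2] := leP p 2%:E.
- have [|f Xf f1|A1 A10 H1] := @interp_const_nr_le (2 * (alpha - 1)) 3 (lap alpha p) t0.
  + by [].
  + have [ta fa] := base f Xf; exists (taylor_coef f); split => //.
    by have [H _] := lap_l2 p1 f1; exact: H.
  have E1 : (2 * (alpha - 1) + 1) / 2 = alpha - 1 / 2 by field.
  rewrite E1 in H1.
  (* At p = 2 both bounds are due with one constant; their exponents coincide. *)
  have [p2'|p2'] := leP 2%:E p; last first.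
    by exists A1 => // n r n1 r01; split => // _; exact: H1.
  have E : p = 2%:E by apply/eqP; rewrite eq_le p2 p2'.
  exists A1 => // n r n1 r01; split => _; first exact: H1.
  have -> : alpha + 1 / 2 - 2 * fine p^-1 = alpha - 1 / 2.
    by rewrite E fine_invr; field.
  exact: H1.
- have pV : fine (p^-1)%E <= 1 / 2.
    case: p p1 p2 {base} => [q| |//]; last by rewrite invey/= => _ _; lra.
    rewrite fine_invr lte_fin => _ q2; rewrite div1r lef_pV2 ?posrE//; last by rewrite (lt_trans _ q2).
    exact: ltW.
  have [||f Xf f1|A1 A10 H1] := @interp_const_nr_le (2 * (alpha - 1) + (2 - 4 * fine (p^-1)%E)) 3 (lap alpha p).
  + by rewrite addr_ge0//; lra.
  + by [].
  + have [ta fa] := base f Xf; exists (taylor_coef f); split => //.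
    by have [_ H] := lap_l2 p1 f1; apply: H; exact: ltW.
  exists A1 => // n r n1 r01; split => // _.
  have -> : alpha + 1 / 2 - 2 * fine p^-1 = (2 * (alpha - 1) + (2 - 4 * fine (p^-1)%E) + 1) / 2.
    by field.
  exact: H1.
Qed.

End SequenceSpaces.

(** * Polynomial test functions for the lower bound *)

Section LowerBound.
Variable R : realType.
Local Notation C := R[i].

Lemma is_derive_horner (p : {poly C}) (z : C) :
  is_derive z 1 (horner p) (p^`()).[z].
Proof.
elim/poly_ind: p => [|p c IH].
  rewrite deriv0 horner0 [X in is_derive _ _ X _](_ : _ = cst 0).
    exact: is_derive_cst.
  by apply/funext => x; rewrite horner0.
rewrite [X in is_derive _ _ X _](_ : _ = (horner p * id) + cst c).
  rewrite derivD derivM derivX derivC addr0 mulr1 hornerD hornerM hornerX.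
  apply: is_derive_eq; rewrite addr0 /GRing.scale/= mulr1 addrC [X in X + _]mulrC.
  by [].
by apply/funext => x; rewrite hornerMXaddC.
Qed.

Lemma derive1n_horner (p : {poly C}) k :
  (derive1n k (horner p) : C -> C) = horner (p^`(k)).
Proof.
elim: k => [|k IH]; first by rewrite derivn0.
rewrite derive1nS IH derivnS; apply/funext => z.
by rewrite derive1E; have [_ ->] := is_derive_horner (p^`(k)) z.
Qed.

Lemma taylor_coef_horner (p : {poly C}) k : taylor_coef (horner p) k = p`_k.
Proof.
rewrite /taylor_coef derive1n_horner horner_coef0 coef_derivn addn0 ffactnn.
by rewrite -[X in X / _]mulr_natr mulfK// pnatr_eq0 -lt0n fact_gt0.
Qed.

Lemma cvg_series_horner (p : {poly C}) (z : C) :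
  series (fun k => p`_k * z ^+ k) @ \oo --> p.[z].
Proof.
apply/cvg_normcP => e e0; exists (size p) => n pn.
rewrite /series/= big_mkord horner_coef.
rewrite (big_ord_widen _ (fun i => p`_i * z ^+ i) pn) [X in _ - X]big_mkcond/= -sumrB.
rewrite big1 ?normc0// => i _; case: ifPn => [_|]; first by rewrite subrr.
by rewrite -leqNgt => pi; rewrite nth_default// mul0r subr0.
Qed.

Lemma blaschke1_id (lambda : C) : blaschke [:: lambda] lambda = 0.
Proof. by rewrite /blaschke big_seq1 /blaschke_factor subrr mul0r. Qed.

Lemma interp_const_nr_ge (n : nat) (r B : R) (X : hol_space R) f :
  (1 <= n)%N -> 0 <= r < 1 -> hol_carrier X f -> (hol_norm X f <= 1)%E ->
  B <= normc (f r%:C) -> (B%:E <= interp_const_nr n r X (Hinf R))%E.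
Proof.
move=> n1 /andP[r0 r1] Xf f1 Bf.
have dr : disc r%:C by rewrite /disc /mkset normc_real ger0_norm.
apply: (@le_trans _ _ (interp_const [:: r%:C] X (Hinf R))); last first.
  apply: ereal_sup_ubound; exists [:: r%:C] => //; split => // lambda.
  by rewrite inE => /eqP ->; rewrite normc_real ger0_norm.
apply: (@le_trans _ _ (ereal_inf [set hol_norm (Hinf R) g | g in
  [set g | hol_carrier (Hinf R) g /\ agree_on [:: r%:C] g f]])); last first.
  by apply: ereal_sup_ubound; exists f.
apply: le_ereal_inf_tmp => _ [g [_ [h Hh E]] <-] /=.
have := E _ dr; rewrite blaschke1_id mul0r => /subr0_eq fg.
apply: (@le_trans _ _ (normc (g r%:C))%:E); first by rewrite lee_fin -fg.
by apply: ereal_sup_ubound; exists r%:C.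
Qed.

(** Pair k with N - 1 - k: at least one of k + 1 and N - k is no less than N/2. *)
Lemma sum_powR_ge (s : R) N : 0 <= s ->
  (N%:R / 2) * (N%:R / 2) `^ s <= \sum_(k < N) k.+1%:R `^ s :> R.
Proof.
move=> s0.
have H : N%:R * (N%:R / 2) `^ s <= \sum_(k < N) k.+1%:R `^ s + \sum_(k < N) k.+1%:R `^ s :> R.
  rewrite {2}(reindex_inj rev_ord_inj)/= -big_split/=.
  have -> : N%:R * (N%:R / 2) `^ s = \sum_(k < N) (N%:R / 2) `^ s :> R.
    by rewrite sumr_const card_ord mulr_natl.
  apply: ler_sum => k _.
  have [h|h] := leP (N%:R / 2) (k.+1%:R : R).
    by rewrite -[leLHS]addr0 lerD ?powR_ge0// ge0_ler_powR ?nnegrE ?divr_ge0.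
  rewrite -[leLHS]add0r lerD ?powR_ge0// ge0_ler_powR ?nnegrE ?divr_ge0//.
  rewrite subnSK// natrB; last exact: ltnW.
  by move: h; rewrite -natr1; lra.
by move: H; lra.
Qed.

(** From 1/r = 1 + (1 - r)/r <= exp((1 - r)/r) one gets r^m >= exp(-m(1 - r)/r). The case m = 0 is
    separate because r may then be 0. *)
Lemma exprn_ge_expRN1 (r : R) m : 0 <= r < 1 -> m%:R * (1 - r) <= r ->
  expR (-1) <= r ^+ m.
Proof.
move=> /andP[r0 r1] mr; case: m mr => [|m] mr.
  by rewrite expr0 -[leRHS]expR0 ler_expR lerN10.
have rp : 0 < r.
  by apply: lt_le_trans mr; rewrite mulr_gt0// subr_gt0.
have h : expR (- ((1 - r) / r)) <= r.
  rewrite expRN -[leRHS]invrK lef_pV2 ?posrE ?expR_gt0 ?invr_gt0//.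
  apply: le_trans (expR_ge1Dx _); rewrite mulrBl divff ?gt_eqF//; lra.
apply: (@le_trans _ _ (expR (- ((1 - r) / r)) ^+ m.+1)).
  rewrite -expRM_natr ler_expR mulNr lerN2 mulrAC ler_pdivrMr// mul1r.
  by rewrite mulrC.
by rewrite lerXn2r ?nnegrE ?expR_ge0// ltW.
Qed.

Section TestFunction.
Variables (alpha : R) (p : \bar R) (N : nat).
Hypotheses (alpha1 : 1 <= alpha) (p1 : (1 <= p)%E) (N0 : (0 < N)%N).
Let e : R := fine (p^-1)%E.

(** The factor N^(-1/p) makes each of the N weighted coefficients contribute 1/N to the sum of p-th
    powers. At p = +oo, where [e] is 0, every weighted coefficient is 1. *)
Definition lap_extremal : {poly C} :=
  \poly_(k < N) ((k.+1%:R `^ (alpha - 1) * N%:R `^ (- e))%:C).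

Let coef_norm k : normc (taylor_coef (horner lap_extremal) k) =
  if (k < N)%N then k.+1%:R `^ (alpha - 1) * N%:R `^ (- e) else 0.
Proof.
rewrite taylor_coef_horner coef_poly; case: ifP => _; last exact: normc0.
by rewrite normc_real ger0_norm// mulr_ge0 ?powR_ge0.
Qed.

Lemma lap_norm_extremal : (lap_norm alpha p (horner lap_extremal) <= 1)%E.
Proof.
have cases : (exists q, p = q%:E) \/ p = +oo%E.
  by move: p1; case: p => [q| |//] _; [left; exists q|right].
have [[q pq]|py] := cases; last first.
  have e0 : e = 0 by rewrite /e py invey.
  rewrite py; apply: ge_ereal_sup => _ [k _ <-].
  rewrite lee_fin coef_norm; case: ifP => _; last by rewrite mul0r.
  by rewrite e0 oppr0 powRr0 mulr1 -powRD ?pnatr_eq0 ?implybT// subrr powRr0.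
have eE : e = q^-1 by rewrite /e pq fine_invr.
have q1 : 1 <= q by rewrite -lee_fin -pq.
have q0 : 0 < q by exact: lt_le_trans q1.
rewrite pq.
pose u (k : nat) : \bar R := (normc (taylor_coef (horner lap_extremal) k) `^ q
  * (1 / k.+1%:R `^ (q * (alpha - 1))))%:E.
rewrite -[lap_norm _ _ _]/((\sum_(0 <= k <oo) u k) `^ q^-1)%E.
have uE k : u k = (if (k < N)%N then N%:R^-1 else 0)%:E.
  rewrite /u coef_norm; case: ifP => _; last by rewrite powR0 ?mul0r// gt_eqF.
  rewrite eE powRM ?powR_ge0// -!powRrM mulNr mulVf ?gt_eqF// powR_inv1//.
  rewrite div1r [q * _]mulrC mulrAC divff ?mul1r// gt_eqF// powR_gt0//.
have u0 k : (0 <= u k)%E by rewrite uE lee_fin; case: ifP.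
have s0 : (0 <= \sum_(0 <= k <oo) u k)%E by apply: nneseries_ge0.
have s1 : (\sum_(0 <= k <oo) u k <= 1)%E.
  apply: lime_le; first by apply: is_cvg_nneseries.
  apply: nearW => K; rewrite big_mkord; under eq_bigr do rewrite uE.
  rewrite sumEFin lee_fin -big_mkcond/=.
  apply: (@le_trans _ _ (\sum_(k < N) N%:R^-1)); last first.
    by rewrite sumr_const card_ord -[leLHS]mulr_natr mulVf// pnatr_eq0 -lt0n.
  rewrite -(big_mkord (fun k => (k < N)%N) (fun=> N%:R^-1)).
  rewrite -(big_mkord xpredT (fun=> N%:R^-1)) big_mkcond/=.
  have [KN|/ltnW NK] := leqP K N.
    rewrite [leRHS](big_cat_nat (n := K))//= -[leLHS]addr0 lerD ?sumr_ge0//.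
    by apply: ler_sum => k _; case: ifP.
  rewrite [leLHS](big_cat_nat (n := N))//=.
  have -> : \sum_(N <= k < K) (if (k < N)%N then N%:R^-1 else 0) = 0 :> R.
    by rewrite big_nat big1// => k /andP[Nk _]; rewrite ltnNge Nk.
  by rewrite addr0; apply: ler_sum => k _; case: ifP.
rewrite -(poweR1r q^-1); apply: gt0_ler_poweR => //.
- by rewrite invr_ge0 ltW.
- by rewrite in_itv/= s0 leey.
- by rewrite in_itv/= lee_fin ler01 leey.
Qed.

Lemma lap_extremal_carrier : hol_carrier (lap alpha p) (horner lap_extremal).
Proof.
split; last by rewrite (le_lt_trans lap_norm_extremal)// ltry.
move=> z _; under eq_fun do rewrite taylor_coef_horner.
exact: cvg_series_horner.
Qed.

(** Every r^k with k < N is at least 1/e, so r may be replaced by 1; [sum_powR_ge] then gives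
    (N/2)^alpha. *)
Lemma lap_extremal_ge (r : R) : 0 <= r < 1 -> N.-1%:R * (1 - r) <= r ->
  expR (-1) * 2 `^ (- alpha) * N%:R `^ (alpha - e) <= normc lap_extremal.[r%:C].
Proof.
move=> r01 Nr; have /andP[r0 r1] := r01.
have -> : lap_extremal.[r%:C] =
    (\sum_(k < N) k.+1%:R `^ (alpha - 1) * N%:R `^ (- e) * r ^+ k)%:C.
  rewrite horner_poly rmorph_sum/=; apply: eq_bigr => k _.
  by rewrite [in RHS]rmorphM rmorphXn.
have a0 : 0 <= alpha - 1 by rewrite subr_ge0.
rewrite normc_real ger0_norm; last first.
  by apply: sumr_ge0 => k _; rewrite !mulr_ge0 ?powR_ge0 ?exprn_ge0.
apply: (@le_trans _ _ (\sum_(k < N) k.+1%:R `^ (alpha - 1) * N%:R `^ (- e) * expR (-1))).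
  rewrite -!mulr_suml; apply: (@le_trans _ _ ((N%:R / 2) * (N%:R / 2) `^ (alpha - 1) * N%:R `^ (- e) * expR (-1))); last first.
    by rewrite !ler_wpM2r ?powR_ge0 ?expR_ge0// sum_powR_ge.
  have Np : N%:R != 0 :> R by rewrite pnatr_eq0 -lt0n.
  rewrite mulr_powRB1 ?divr_ge0// ?(lt_le_trans ltr01)//.
  rewrite powRM// -powR_inv1// -powRrM mulN1r powRD ?Np ?implybT//; lra.
apply: ler_sum => k _; rewrite ler_wpM2l ?mulr_ge0 ?powR_ge0//.
apply: exprn_ge_expRN1 => //; apply: le_trans Nr.
by rewrite ler_wpM2r ?subr_ge0 ?(ltW r1)// ler_nat -ltnS prednK.
Qed.

End TestFunction.

Lemma powR_invr (x s : R) : 0 <= x -> x^-1 `^ s = (x `^ s)^-1.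
Proof. by move=> x0; rewrite -powR_inv1// -powRrM mulN1r powRN. Qed.

Lemma lap_lower (alpha : R) (p : \bar R) : 1 <= alpha -> (1 <= p)%E ->
  exists2 c : R, 0 < c & forall (n : nat) (r : R), (1 <= n)%N -> 0 <= r < 1 ->
    ((c * (1 / (1 - r) `^ (alpha - fine (p^-1)%E)))%:E
       <= interp_const_nr n r (lap alpha p) (Hinf R))%E.
Proof.
move=> alpha1 p1; set e := fine _.
have e1 : e <= 1.
  rewrite /e; case: p p1 {e} => [q| |//]; last by rewrite invey.
  by rewrite fine_invr lee_fin => q1; rewrite invf_le1// (lt_le_trans ltr01).
exists (expR (-1) * 2 `^ (- alpha) * 2 `^ (- (alpha - e))).
  by rewrite !mulr_gt0 ?expR_gt0 ?powR_gt0.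
move=> n r n1 r01; have /andP[r0 r1] := r01.
have r1' : 0 < 1 - r by rewrite subr_gt0.
have x1 : 1 <= (1 - r)^-1 by rewrite invf_ge1//; lra.
have /andP[Nx xN] := truncn_itv (le_trans ler01 x1).
(* N is the integer part of 1/(1 - r). From N(1 - r) <= 1 follows (N - 1)(1 - r) <= r, and N + 1 <=
   2N gives N >= 1/(2(1 - r)). As e <= 1 <= alpha, the power alpha - e preserves this last
   inequality. *)
set N := Num.truncn _ in Nx xN.
have N0 : (0 < N)%N.
  by rewrite lt0n; apply/eqP => N0; move: xN; rewrite N0 ltNge x1.
apply: (@interp_const_nr_ge _ _ _ _ (horner (lap_extremal alpha p N))) => //.
- exact: lap_extremal_carrier.
- exact: lap_norm_extremal.
- have Nr : N.-1%:R * (1 - r) <= r.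
    have : N%:R * (1 - r) <= 1 by rewrite -ler_pdivlMr// div1r.
    by rewrite -{1}(prednK N0) -natr1; lra.
  apply: (le_trans _ (@lap_extremal_ge alpha p N alpha1 N0 r r01 Nr)).
  rewrite -/e -mulrA ler_wpM2l ?mulr_ge0 ?expR_ge0 ?powR_ge0//.
  have -> : 2 `^ (- (alpha - e)) * (1 / (1 - r) `^ (alpha - e)) = ((1 - r)^-1 / 2) `^ (alpha - e).
    by rewrite powRM ?invr_ge0 ?(ltW r1')// !powR_invr ?(ltW r1')// powRN mulrC div1r.
  rewrite ge0_ler_powR ?nnegrE ?divr_ge0 ?invr_ge0 ?(ltW r1')//; first by lra.
  rewrite ler_pdivrMr// (le_trans (ltW xN))// -natrM ler_nat.
  by rewrite muln2 -addnn -addn1 leq_add2l.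
Qed.

End LowerBound.

(** * Goursat's theorem and Taylor expansions *)

Section SegmentIntegral.
Variable R : realType.
Implicit Types (f g : R -> R) (a b c d e : R).
Local Notation mu := (@lebesgue_measure R).

Definition itg f a b : R := \int[mu]_(x in `[a, b]) f x.

(** Continuity is taken in the whole line, end points included, so that it passes to every
    subsegment. *)
Definition cts f a b := forall x, a <= x <= b -> {for x, continuous f}.

Lemma ctsW f a b c d : a <= c -> d <= b -> cts f a b -> cts f c d.
Proof. by move=> ac db H x /andP[cx xd]; apply: H; rewrite (le_trans ac)//= (le_trans xd). Qed.

Lemma ctsD f g a b : cts f a b -> cts g a b -> cts (fun x => f x + g x) a b.
Proof. by move=> Hf Hg x xab; apply: cvgD; [exact: Hf|exact: Hg]. Qed.

Lemma ctsB f g a b : cts f a b -> cts g a b -> cts (fun x => f x - g x) a b.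
Proof. by move=> Hf Hg x xab; apply: cvgB; [exact: Hf|exact: Hg]. Qed.

Lemma ctsZ k f a b : cts f a b -> cts (fun x => k * f x) a b.
Proof. by move=> Hf x xab; apply: cvgMr; exact: Hf. Qed.

Lemma cts_integrable f a b : cts f a b -> mu.-integrable `[a, b] (EFin \o f).
Proof.
move=> Hf; apply: continuous_compact_integrable; first exact: segment_compact.
apply: continuous_in_subspaceT => x; rewrite inE/= in_itv/= => xab; exact: Hf.
Qed.

Lemma itgD f g a b : cts f a b -> cts g a b ->
  itg (fun x => f x + g x) a b = itg f a b + itg g a b.
Proof. by move=> Hf Hg; apply: RintegralD => //; exact: cts_integrable. Qed.

Lemma itgB f g a b : cts f a b -> cts g a b ->
  itg (fun x => f x - g x) a b = itg f a b - itg g a b.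
Proof. by move=> Hf Hg; apply: RintegralB => //; exact: cts_integrable. Qed.

Lemma itgZ k f a b : cts f a b -> itg (fun x => k * f x) a b = k * itg f a b.
Proof. by move=> Hf; apply: RintegralZl => //; exact: cts_integrable. Qed.

Lemma itg_cst k a b : a <= b -> itg (fun=> k) a b = k * (b - a).
Proof.
move=> ab; have muab : mu `[a, b]%classic = (b - a)%:E.
  rewrite lebesgue_measure_itv/= lte_fin.
  by case: ltgtP ab => // ->; rewrite subrr.
by rewrite /itg Rintegral_cst// [X in fine X]muab.
Qed.

Lemma eq_itg f g a b : (forall x, a <= x <= b -> f x = g x) -> itg f a b = itg g a b.
Proof. by move=> fg; apply: eq_Rintegral => x; rewrite inE/= in_itv/=; exact: fg. Qed.

Lemma itg_norm_le f a b M : a <= b -> cts f a b ->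
  (forall x, a <= x <= b -> `|f x| <= M) -> `|itg f a b| <= M * (b - a).
Proof.
move=> ab Hf fM; rewrite (le_trans (le_normr_Rintegral _ (cts_integrable Hf)))//.
rewrite -(itg_cst M ab); apply: le_Rintegral => //.
  by apply: cts_integrable => x xab; apply: cvg_norm; exact: Hf.
by apply: cts_integrable => x _; exact: cvg_cst.
Qed.

Lemma itg_cat f a b c : a <= c -> c <= b -> cts f a b ->
  itg f a b = itg f a c + itg f c b.
Proof.
move=> ac cb Hf; have intf := cts_integrable Hf.
have /eqP := Rintegral_itvB (a := BLeft a) (b := BRight b) (x := c) intf ac cb.
rewrite subr_eq addrC => /eqP; rewrite -/(itg f a b) -/(itg f a c) => ->.
congr (_ + _); rewrite Rintegral_itv_obnd_cbnd//.
apply: integrableS intf => //.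
by apply: subset_itv; rewrite bnd_simp.
Qed.

End SegmentIntegral.

(** * Goursat's theorem on rectangles *)

Section Goursat.
Variable R : realType.
Implicit Types (P Q : R -> R -> R) (a b c d e x y : R).

(* Boundary integral of P dx + Q dy over [a, b] x [c, d]; the sign of P is reversed, so
   that it vanishes for closed forms with [dP/dy + dQ/dx = 0]. *)
Definition bint P Q a b c d : R :=
  itg (fun y => Q b y - Q a y) c d + itg (fun x => P x d - P x c) a b.

Lemma bint_sym P Q a b c d :
  bint P Q a b c d = bint (fun x y => Q y x) (fun x y => P y x) c d a b.
Proof. exact: addrC. Qed.

Lemma bint_catx P Q a b c d e : a <= e -> e <= b ->
  cts (Q a) c d -> cts (Q b) c d -> cts (Q e) c d ->
  cts (P^~ c) a b -> cts (P^~ d) a b ->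
  bint P Q a b c d = bint P Q a e c d + bint P Q e b c d.
Proof.
move=> ae eb Qa Qb Qe Pc Pd; rewrite /bint.
rewrite (@itg_cat _ (fun x => P x d - P x c) a b e)//; last exact: ctsB.
have -> : itg (fun y => Q b y - Q a y) c d =
    itg (fun y => Q e y - Q a y) c d + itg (fun y => Q b y - Q e y) c d.
  rewrite -itgD; [|exact: ctsB|exact: ctsB].
  by apply: eq_itg => y _; ring.
by rewrite addrACA.
Qed.

Lemma bint_caty P Q a b c d e : c <= e -> e <= d ->
  cts (Q a) c d -> cts (Q b) c d ->
  cts (P^~ c) a b -> cts (P^~ d) a b -> cts (P^~ e) a b ->
  bint P Q a b c d = bint P Q a b c e + bint P Q a b e d.
Proof.
move=> *; rewrite (bint_sym P Q a b c d) (bint_sym P Q a b c e) (bint_sym P Q a b e d).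
exact: bint_catx.
Qed.

(* The form P dx + Q dy (with the sign convention of [bint]) is differentiable at (x0, y0)
   and closed there. *)
Definition closed_at P Q x0 y0 := exists p1 q1 q2 : R, forall eps, 0 < eps ->
  exists2 del : R, 0 < del & forall x y, `|x - x0| < del -> `|y - y0| < del ->
    `|P x y - P x0 y0 - (p1 * (x - x0) - q1 * (y - y0))| <= eps * (`|x - x0| + `|y - y0|)
    /\ `|Q x y - Q x0 y0 - (q1 * (x - x0) + q2 * (y - y0))| <= eps * (`|x - x0| + `|y - y0|).

Lemma lin_approx_continuous (f : R -> R) x0 (l : R) :
  (forall eps, 0 < eps -> exists2 del : R, 0 < del & forall x, `|x - x0| < del ->
    `|f x - f x0 - l * (x - x0)| <= eps * `|x - x0|) -> {for x0, continuous f}.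
Proof.
move=> /(_ 1 ltr01)[del del0 H]; apply/cvgrPdist_lt => eps eps0.
have l0 : 0 < `|l| + 1 by rewrite ltr_wpDl.
apply/nbhs_ballP; exists (Num.min del (eps / (`|l| + 1))).
  by rewrite /= lt_min del0 divr_gt0.
move=> x; rewrite /ball/= distrC lt_min => /andP[xd xe]; rewrite distrC.
apply: le_lt_trans (_ : `|x - x0| * (`|l| + 1) < eps); last by rewrite -ltr_pdivlMr.
rewrite -[f x - f x0](subrK (l * (x - x0))) (le_trans (ler_normD _ _))// normrM.
by have := H x xd; rewrite mul1r; lra.
Qed.

Lemma bint_quad P Q a e b c d f : a <= e <= b -> c <= f <= d ->
  (forall y, c <= y <= d -> cts (P^~ y) a b) ->
  (forall x, a <= x <= b -> cts (Q x) c d) ->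
  bint P Q a b c d = bint P Q a e c f + bint P Q a e f d +
    (bint P Q e b c f + bint P Q e b f d).
Proof.
move=> /andP[ae eb] /andP[cf fd] HP HQ.
have ab := le_trans ae eb; have cd := le_trans cf fd.
have [Pc Pd Pf] : [/\ cts (P^~ c) a b, cts (P^~ d) a b & cts (P^~ f) a b].
  by split; apply: HP; rewrite ?lexx ?cd ?cf.
have [Qa Qb Qe] : [/\ cts (Q a) c d, cts (Q b) c d & cts (Q e) c d].
  by split; apply: HQ; rewrite ?lexx ?ab ?ae.
rewrite (bint_catx ae eb)// (bint_caty (e := f))//; [|exact: ctsW eb _..].
by rewrite (bint_caty (a := e) (e := f))//; exact: ctsW ae (lexx _) _.
Qed.

Lemma closed_at_continuous P Q x y : closed_at P Q x y ->
  [/\ {for x, continuous (P^~ y)}, {for y, continuous (P x)},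
      {for x, continuous (Q^~ y)} & {for y, continuous (Q x)}].
Proof.
move=> [p1 [q1 [q2 H]]]; split.
- apply: (@lin_approx_continuous _ _ p1) => eps /H[del del0 Hd].
  exists del => // t td; have [|h _] := Hd t y td; first by rewrite subrr normr0.
  by move: h; rewrite subrr mulr0 subr0 normr0 addr0.
- apply: (@lin_approx_continuous _ _ (- q1)) => eps /H[del del0 Hd].
  exists del => // t td; have [|h _] := Hd x t _ td; first by rewrite subrr normr0.
  by move: h; rewrite subrr mulr0 sub0r normr0 add0r mulNr.
- apply: (@lin_approx_continuous _ _ q1) => eps /H[del del0 Hd].
  exists del => // t td; have [|_ h] := Hd t y td; first by rewrite subrr normr0.
  by move: h; rewrite subrr mulr0 addr0 normr0 addr0.
- apply: (@lin_approx_continuous _ _ q2) => eps /H[del del0 Hd].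
  exists del => // t td; have [|_ h] := Hd x t _ td; first by rewrite subrr normr0.
  by move: h; rewrite subrr mulr0 add0r normr0 add0r.
Qed.

(** The linear parts contribute q1 (b - a)(d - c) and its opposite. What remains are the errors, at
    most 2 eps times the half-perimeter on each pair of opposite sides. *)
Lemma bint_local P Q x0 y0 : closed_at P Q x0 y0 -> forall eps, 0 < eps ->
  exists2 del : R, 0 < del & forall a b c d, a <= x0 <= b -> c <= y0 <= d ->
    b - a < del -> d - c < del ->
    cts (Q a) c d -> cts (Q b) c d -> cts (P^~ c) a b -> cts (P^~ d) a b ->
    `|bint P Q a b c d| <= 2 * eps * ((b - a) + (d - c)) ^+ 2.
Proof.
move=> [p1 [q1 [q2 H]]] eps eps0; have [del del0 Hd] := H _ eps0; exists del => //.
move=> a b c d /andP[ax xb] /andP[cy yd] ba dc Qa Qb Pc Pd.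
have ab : a <= b by exact: le_trans xb.
have cd : c <= d by exact: le_trans yd.
have nx x : a <= x <= b -> `|x - x0| <= b - a.
  by move=> /andP[h1 h2]; rewrite ler_norml; apply/andP; split; lra.
have ny y : c <= y <= d -> `|y - y0| <= d - c.
  by move=> /andP[h1 h2]; rewrite ler_norml; apply/andP; split; lra.
have Hx x : a <= x <= b -> `|x - x0| < del by move=> /nx/le_lt_trans; apply.
have Hy y : c <= y <= d -> `|y - y0| < del by move=> /ny/le_lt_trans; apply.
set L := (b - a) + (d - c).
have bnd x y : a <= x <= b -> c <= y <= d ->
    eps * (`|x - x0| + `|y - y0|) <= eps * L.
  by move=> xab ycd; rewrite ler_wpM2l ?(ltW eps0)// /L lerD ?nx ?ny.
have aab : a <= a <= b by rewrite lexx.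
have bab : a <= b <= b by rewrite lexx andbT.
have ccd : c <= c <= d by rewrite lexx.
have dcd : c <= d <= d by rewrite lexx andbT.
have ck (k u v : R) : cts (fun=> k) u v by move=> x _; exact: cvg_cst.
have E1 : `|itg (fun y => Q b y - Q a y - q1 * (b - a)) c d| <= 2 * (eps * L) * (d - c).
  apply: itg_norm_le => //; first by apply: ctsB; [exact: ctsB|exact: ck].
  move=> y ycd; have [_ h1] := Hd b y (Hx _ bab) (Hy _ ycd).
  have [_ h2] := Hd a y (Hx _ aab) (Hy _ ycd).
  have := bnd b y bab ycd; have := bnd a y aab ycd.
  rewrite ler_norml; move: h1 h2; rewrite !ler_norml => /andP[h1 h1'] /andP[h2 h2'] h3 h4.
  by apply/andP; split; lra.
have E2 : `|itg (fun x => P x d - P x c - (- q1 * (d - c))) a b| <= 2 * (eps * L) * (b - a).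
  apply: itg_norm_le => //; first by apply: ctsB; [exact: ctsB|exact: ck].
  move=> x xab; have [h1 _] := Hd x d (Hx _ xab) (Hy _ dcd).
  have [h2 _] := Hd x c (Hx _ xab) (Hy _ ccd).
  have := bnd x d xab dcd; have := bnd x c xab ccd.
  rewrite ler_norml; move: h1 h2; rewrite !ler_norml => /andP[h1 h1'] /andP[h2 h2'] h3 h4.
  by apply/andP; split; lra.
rewrite itgB ?itg_cst// in E1; last exact: ctsB.
rewrite itgB ?itg_cst// in E2; last exact: ctsB.
rewrite /bint; move: E1 E2; set I1 := itg _ c d; set I2 := itg _ a b => E1 E2.
have -> : I1 + I2 = (I1 - q1 * (b - a) * (d - c)) + (I2 - - q1 * (d - c) * (b - a)) by ring.
rewrite (le_trans (ler_normD _ _))// (le_trans (lerD E1 E2))// /L expr2; lra.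
Qed.

Lemma nested_intervals (u : nat -> R) (l : nat -> R) : (forall n, 0 <= l n) ->
  (forall n, u n <= u n.+1) -> (forall n, u n.+1 + l n.+1 <= u n + l n) ->
  exists x, forall n, u n <= x <= u n + l n.
Proof.
move=> l0 u1 u2.
have mono n m : (n <= m)%N -> u n <= u m.
  by move=> /subnK <-; elim: (m - n)%N => [|k IH]; rewrite ?addSn// (le_trans IH).
have anti n m : (n <= m)%N -> u m + l m <= u n + l n.
  by move=> /subnK <-; elim: (m - n)%N => [|k IH]; rewrite ?addSn// (le_trans _ IH).
have ub n m : u m <= u n + l n.
  have [nm|/ltnW mn] := leqP n m.
    by apply: le_trans (anti _ _ nm); rewrite lerDl.
  by apply: le_trans (mono _ _ mn) _; rewrite lerDl.
exists (sup (range u)) => n; apply/andP; split.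
  apply: ub_le_sup; last by exists n.
  by exists (u 0%N + l 0%N) => _ [m _ <-].
by apply: ge_sup; [exists (u 0%N), 0%N|move=> _ [m _ <-]].
Qed.

Let sum4_norm (A B C D : R) :
  `|A| * 4 < `|B + C + (D + A)| -> `|C| * 4 < `|B + C + (D + A)| ->
  `|D| * 4 < `|B + C + (D + A)| -> `|B| * 4 < `|B + C + (D + A)| -> False.
Proof.
have := ler_normD (B + C) (D + A); have := ler_normD B C; have := ler_normD D A; lra.
Qed.

Theorem goursat P Q a b c d : a <= b -> c <= d ->
  (forall x y, a <= x <= b -> c <= y <= d -> closed_at P Q x y) ->
  bint P Q a b c d = 0.
Proof.
move=> ab cd H.
pose l n := (b - a) / 2 ^+ n; pose m n := (d - c) / 2 ^+ n.
have l0 n : 0 <= l n by rewrite divr_ge0 ?subr_ge0// exprn_ge0.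
have m0 n : 0 <= m n by rewrite divr_ge0 ?subr_ge0// exprn_ge0.
have lS n : l n = l n.+1 + l n.+1 by rewrite /l exprS; field.
have mS n : m n = m n.+1 + m n.+1 by rewrite /m exprS; field.
pose J n (s : R * R) := bint P Q s.1 (s.1 + l n) s.2 (s.2 + m n).
pose valid n (s : R * R) := [/\ a <= s.1, s.1 + l n <= b, c <= s.2 & s.2 + m n <= d].
(* Dependent choice asks for a successor of every element, hence the implication from [valid]. The
   depth is stored next to the corner since it determines the side lengths. *)
pose step (t t' : nat * (R * R)) := t'.1 = t.1.+1 /\ (valid t.1 t.2 ->
  [/\ valid t'.1 t'.2, t.2.1 <= t'.2.1 /\ t'.2.1 + l t'.1 <= t.2.1 + l t.1,
      t.2.2 <= t'.2.2 /\ t'.2.2 + m t'.1 <= t.2.2 + m t.1 &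
      `|J t.1 t.2| <= 4 * `|J t'.1 t'.2|]).
have Px x y : a <= x <= b -> c <= y <= d -> {for x, continuous (P^~ y)}.
  by move=> h1 h2; have [] := closed_at_continuous (H x y h1 h2).
have Qy x y : a <= x <= b -> c <= y <= d -> {for y, continuous (Q x)}.
  by move=> h1 h2; have [] := closed_at_continuous (H x y h1 h2).
have Pc y : c <= y <= d -> cts (P^~ y) a b by move=> h x hx; exact: Px.
have Qc x : a <= x <= b -> cts (Q x) c d by move=> h y hy; exact: Qy.
have /dependent_choice : forall t, {t' | step t t'}.
  move=> [n [x y]]; apply: cid; apply: contrapT => /forallNP N.
  have [v|nv] := pselect (valid n (x, y)); last first.
    by apply: (N (n.+1, (x, y))); split.
  have [/= ax xb cy yd] := v.
  have {}N x' y' : x' = x \/ x' = x + l n.+1 -> y' = y \/ y' = y + m n.+1 ->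
      `|J n.+1 (x', y')| * 4 < `|J n (x, y)|.
    have h1 := l0 n.+1; have h2 := m0 n.+1; have h3 := lS n; have h4 := mS n.
    move=> hx hy.
    have {}hx : x <= x' /\ x' + l n.+1 <= x + l n by case: hx => ->; split; lra.
    have {}hy : y <= y' /\ y' + m n.+1 <= y + m n by case: hy => ->; split; lra.
    rewrite ltNge; apply/negP => h.
    apply: (N (n.+1, (x', y'))); split => // _ /=; rewrite (mulrC 4).
    by split => //; split => /=; lra.
  have h1 := l0 n.+1; have h2 := m0 n.+1; have h3 := lS n; have h4 := mS n.
  have := N x y (or_introl erefl) (or_introl erefl).
  have := N (x + l n.+1) y (or_intror erefl) (or_introl erefl).
  have := N x (y + m n.+1) (or_introl erefl) (or_intror erefl).
  have := N (x + l n.+1) (y + m n.+1) (or_intror erefl) (or_intror erefl).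
  suff : J n (x, y) = J n.+1 (x, y) + J n.+1 (x, y + m n.+1) +
      (J n.+1 (x + l n.+1, y) + J n.+1 (x + l n.+1, y + m n.+1)).
    move=> ->; set A := J _ _; set B := J _ _; set C := J _ _; set D := J _ _.
    exact: sum4_norm.
  rewrite /J/= lS mS !(addrA x) !(addrA y) (@bint_quad P Q x (x + l n.+1) _ y _ (y + m n.+1))//.
  - by rewrite !lerDl h1.
  - by rewrite !lerDl h2.
  - by move=> z hz; apply: ctsW (Pc z _); lra.
  - by move=> z hz; apply: ctsW (Qc z _); lra.
move=> /(_ (0%N, (a, c)))[s [s0 sS]].
have sn n : (s n).1 = n.
  by elim: n => [|n IH]; [rewrite s0|have [-> _] := sS n; rewrite IH].
have sv n : valid n (s n).2.
  elim: n => [|n IH]; first by rewrite s0 /valid /l /m/= expr0 !divr1; split; lra.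
  by have [_] := sS n; rewrite !sn => /(_ IH)[].
have sJ n : `|bint P Q a b c d| <= 4 ^+ n * `|J n (s n).2|.
  elim: n => [|n IH].
    rewrite expr0 mul1r s0 /J /l /m/= expr0 !divr1.
    by rewrite (_ : a + (b - a) = b) 1?(_ : c + (d - c) = d)//; ring.
  have [_] := sS n; rewrite !sn => /(_ (sv n))[_ _ _ h].
  by rewrite (le_trans IH)// exprSr -mulrA ler_wpM2l ?exprn_ge0.
have [||x0 Hx0] := @nested_intervals (fun n => (s n).2.1) l l0.
- by move=> n; have [_] := sS n; rewrite !sn => /(_ (sv n))[_ []].
- by move=> n; have [_] := sS n; rewrite !sn => /(_ (sv n))[_ []].
have [||y0 Hy0] := @nested_intervals (fun n => (s n).2.2) m m0.
- by move=> n; have [_] := sS n; rewrite !sn => /(_ (sv n))[_ _ []].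
- by move=> n; have [_] := sS n; rewrite !sn => /(_ (sv n))[_ _ []].
have x0ab : a <= x0 <= b by have [] := sv 0%N; have := Hx0 0%N; lra.
have y0cd : c <= y0 <= d by have [] := sv 0%N; have := Hy0 0%N; lra.
apply/eqP; rewrite -normr_le0; apply/ler_addgt0Pr => e e0; rewrite add0r.
pose K := 2 * ((b - a) + (d - c)) ^+ 2.
have K0 : 0 <= K by rewrite mulr_ge0 ?sqr_ge0.
have eK : 0 < e / (K + 1) by rewrite divr_gt0// ltr_wpDl.
have [del del0 Hdel] := bint_local (H _ _ x0ab y0cd) eK.
have [n [ln mn]] : exists n, l n < del /\ m n < del.
  have : geometric ((b - a) + (d - c)) 2^-1 @ \oo --> (0 : R).
    by apply: cvg_geometric; rewrite ger0_norm; lra.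
  move=> /cvgrPdist_lt/(_ _ del0)[n _ /(_ n (leqnn _))].
  rewrite /= sub0r normrN exprVn ger0_norm; last first.
    by rewrite mulr_ge0 ?invr_ge0 ?exprn_ge0//; lra.
  have p2 : 0 <= (2 ^+ n)^-1 :> R by rewrite invr_ge0 exprn_ge0.
  by exists n; have := mulr_ge0 (_ : 0 <= b - a) p2; have := mulr_ge0 (_ : 0 <= d - c) p2; rewrite /l /m !subr_ge0 => /(_ cd) h1 /(_ ab) h2; split; lra.
have [/= h1 h2 h3 h4] := sv n.
have hx := Hx0 n; have hy := Hy0 n.
have ln0 := l0 n; have mn0 := m0 n.
have := Hdel (s n).2.1 ((s n).2.1 + l n) (s n).2.2 ((s n).2.2 + m n) hx hy.
have addKl (u v : R) : u + v - u = v by rewrite addrAC subrr add0r.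
rewrite !addKl => /(_ ln mn) B.
rewrite (le_trans (sJ n))// /J.
apply: (@le_trans _ _ (4 ^+ n * (2 * (e / (K + 1)) * (l n + m n) ^+ 2))).
  rewrite ler_wpM2l ?exprn_ge0//; apply: B.
  - by apply: ctsW (Qc _ _); lra.
  - by apply: ctsW (Qc _ _); lra.
  - by apply: ctsW (Pc _ _); lra.
  - by apply: ctsW (Pc _ _); lra.
(* The factor 4^n lost in choosing quarters is exactly compensated by the square of the halved side
   lengths. *)
have E : 4 ^+ n * (l n + m n) ^+ 2 = (b - a + (d - c)) ^+ 2.
  have -> : 4 ^+ n = 2 ^+ n ^+ 2 :> R by rewrite -exprM mulnC exprM expr2 -natrM.
  by rewrite -exprMn /l /m -mulrDl mulrC divfK// expf_neq0.
have -> : 4 ^+ n * (2 * (e / (K + 1)) * (l n + m n) ^+ 2) = K * (e / (K + 1)).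
  by rewrite /K -E; ring.
rewrite mulrA ler_pdivrMr ?ltr_wpDl// mulrC ler_wpM2l ?(ltW e0)// lerDl//.
Qed.

End Goursat.

(** * Rectangles with a bounded isolated singularity *)

Section Puncture.
Variable R : realType.
Implicit Types (P Q : R -> R -> R) (a b c d x y : R).

(** Cuts along the sides of a square of half-side s around the puncture leave pieces to which
    [goursat] applies, and the square, whose boundary integral is at most M times its perimeter
    8s. *)
Lemma goursat_puncture P Q a b c d x0 y0 : a < x0 < b -> c < y0 < d ->
  (forall x y, a <= x <= b -> c <= y <= d -> x != x0 \/ y != y0 -> closed_at P Q x y) ->
  (exists M s0 : R, 0 < s0 /\ forall x y, `|x - x0| <= s0 -> `|y - y0| <= s0 ->
     `|P x y| <= M /\ `|Q x y| <= M) ->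
  bint P Q a b c d = 0.
Proof.
move=> /andP[ax xb] /andP[cy yd] H [M [s0 [s00 HM]]].
have M0 : 0 <= M.
  have [||h _] := HM x0 y0; rewrite ?subrr ?normr0 ?(ltW s00)//.
  exact: le_trans h.
have Px x y : a <= x <= b -> c <= y <= d -> x != x0 \/ y != y0 -> {for x, continuous (P^~ y)}.
  by move=> h1 h2 h3; have [] := closed_at_continuous (H x y h1 h2 h3).
have Qy x y : a <= x <= b -> c <= y <= d -> x != x0 \/ y != y0 -> {for y, continuous (Q x)}.
  by move=> h1 h2 h3; have [] := closed_at_continuous (H x y h1 h2 h3).
have Pc y : c <= y <= d -> y != y0 -> cts (P^~ y) a b.
  by move=> h h' x hx; apply: Px => //; right.
have Qc x : a <= x <= b -> x != x0 -> cts (Q x) c d.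
  by move=> h h' y hy; apply: Qy => //; left.
apply/eqP; rewrite -normr_le0; apply/ler_addgt0Pr => e e0; rewrite add0r.
have [s [/andP[sp s1] sa sb [sc sd] se]] : exists s : R, [/\ 0 < s <= s0, a <= x0 - s, x0 + s <= b,
    c <= y0 - s /\ y0 + s <= d & 8 * M * s <= e].
  pose s := Num.min s0 (Num.min (Num.min (x0 - a) (b - x0)) (Num.min (Num.min (y0 - c) (d - y0)) (e / (8 * M + 1)))).
  have M8 : 0 < 8 * M + 1 by rewrite ltr_wpDl// mulr_ge0.
  have sp : 0 < s by rewrite !lt_min s00 !subr_gt0 ax xb cy yd divr_gt0.
  exists s; split => //.
  - by rewrite sp ge_min lexx.
  - by have : s <= x0 - a; [rewrite !ge_min lexx !orbT|lra].
  - by have : s <= b - x0; [rewrite !ge_min lexx !orbT|lra].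
  - have h1 : s <= y0 - c by rewrite !ge_min lexx !orbT.
    have h2 : s <= d - y0 by rewrite !ge_min lexx !orbT.
    by split; lra.
  - have : s <= e / (8 * M + 1) by rewrite !ge_min lexx !orbT.
    rewrite ler_pdivlMr// mulrDr mulr1; lra.
have xne1 : x0 - s != x0 by rewrite lt_eqF//; lra.
have xne2 : x0 + s != x0 by rewrite gt_eqF//; lra.
have yne1 : y0 - s != y0 by rewrite lt_eqF//; lra.
have yne2 : y0 + s != y0 by rewrite gt_eqF//; lra.
have ane : a != x0 by rewrite lt_eqF.
have bne : b != x0 by rewrite gt_eqF.
have cne : c != y0 by rewrite lt_eqF.
have dne : d != y0 by rewrite gt_eqF.
have Qa : cts (Q a) c d by apply: Qc => //; lra.
have Qb : cts (Q b) c d by apply: Qc => //; lra.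
have Q1 : cts (Q (x0 - s)) c d by apply: Qc => //; lra.
have Q2 : cts (Q (x0 + s)) c d by apply: Qc => //; lra.
have Pcc : cts (P^~ c) a b by apply: Pc => //; lra.
have Pd : cts (P^~ d) a b by apply: Pc => //; lra.
have P1 : cts (P^~ (y0 - s)) a b by apply: Pc => //; lra.
have P2 : cts (P^~ (y0 + s)) a b by apply: Pc => //; lra.
have xs : x0 - s <= x0 + s by lra.
have ys : y0 - s <= y0 + s by lra.
have ax1 : a <= x0 + s by lra.
have xb1 : x0 - s <= b by lra.
have cy1 : c <= y0 + s by lra.
have yd1 : y0 - s <= d by lra.
rewrite (bint_catx (e := x0 - s))// (@goursat _ P Q a (x0 - s)) ?add0r//; last 2 first.
- lra.
- by move=> x y hx hy; apply: H; [lra|lra|left; rewrite lt_eqF//; lra].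
rewrite (bint_catx (a := x0 - s) (e := x0 + s))//; [|exact: ctsW Pcc|exact: ctsW Pd].
rewrite (@goursat _ P Q (x0 + s) b) ?addr0//; last 2 first.
- lra.
- by move=> x y hx hy; apply: H; [lra|lra|left; rewrite gt_eqF//; lra].
rewrite (bint_caty (e := y0 - s))//; [|exact: ctsW Pcc|exact: ctsW Pd|exact: ctsW P1].
rewrite (@goursat _ P Q (x0 - s) (x0 + s) c (y0 - s)) ?add0r//; last first.
- by move=> x y hx hy; apply: H; [lra|lra|right; rewrite lt_eqF//; lra].
rewrite (bint_caty (c := y0 - s) (e := y0 + s))//; first last.
- exact: ctsW P2.
- exact: ctsW Pd.
- exact: ctsW P1.
- exact: ctsW Q2.
- exact: ctsW Q1.
rewrite (@goursat _ P Q (x0 - s) (x0 + s) (y0 + s) d) ?addr0//; last first.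
- by move=> x y hx hy; apply: H; [lra|lra|right; rewrite gt_eqF//; lra].
rewrite (le_trans _ se)// /bint (le_trans (ler_normD _ _))//.
have nx x : x0 - s <= x <= x0 + s -> `|x - x0| <= s0 by rewrite -ler_distl => /le_trans; apply.
have ny y : y0 - s <= y <= y0 + s -> `|y - y0| <= s0 by rewrite -ler_distl => /le_trans; apply.
have MM (u v : R) : `|u| <= M -> `|v| <= M -> `|u - v| <= 2 * M.
  by move=> hu hv; rewrite (le_trans (ler_normB _ _))// mulr2n mulrDl mul1r lerD.
have xsm : x0 - s <= x0 - s <= x0 + s by rewrite lexx.
have xsp : x0 - s <= x0 + s <= x0 + s by rewrite lexx xs.
have ysm : y0 - s <= y0 - s <= y0 + s by rewrite lexx.
have ysp : y0 - s <= y0 + s <= y0 + s by rewrite lexx ys.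
have -> : 8 * M * s = 2 * M * (y0 + s - (y0 - s)) + 2 * M * (x0 + s - (x0 - s)) by ring.
apply: lerD; apply: itg_norm_le => //.
- by apply: ctsB; [exact: ctsW Q2|exact: ctsW Q1].
- by move=> y /ny hy; apply: MM; [have [] := HM _ _ (nx _ xsp) hy|have [] := HM _ _ (nx _ xsm) hy].
- by apply: ctsB; [exact: ctsW P2|exact: ctsW P1].
- by move=> x /nx hx; apply: MM; [have [] := HM _ _ hx (ny _ ysp)|have [] := HM _ _ hx (ny _ ysm)].
Qed.

End Puncture.

(** * Logarithmic coordinates *)

Section LogCoordinates.
Variable R : realType.
Local Notation C := R[i].
Implicit Types (x y : R) (F : C -> C).

Definition cexp x y : C := (expR x * cos y) +i* (expR x * sin y).

Lemma normc_cexp x y : normc (cexp x y) = expR x.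
Proof.
apply/eqP; rewrite -(@eqrXn2 _ 2) ?normc_ge0 ?expR_ge0// sqr_normcE/= !exprMn -mulrDr.
by rewrite cos2Dsin2 mulr1.
Qed.

Lemma cexpD x y x' y' : cexp (x + x') (y + y') = cexp x y * cexp x' y'.
Proof.
rewrite /cexp expRD cosD sinD; apply/eqP; rewrite eq_complex/=; apply/andP; split; apply/eqP; ring.
Qed.

Lemma cexp_neq0 x y : cexp x y != 0.
Proof. by rewrite -normc_gt0 normc_cexp expR_gt0. Qed.

Lemma cexp_2pi x : cexp x (pi *+ 2) = cexp x 0.
Proof. by rewrite /cexp cos2pi sin2pi cos0 sin0. Qed.

(** As y0 is interior, |y - y0| stays below 2 pi. Its half t then lies in [0, pi), where cos(2t) = 1
    forces sin t = 0 and hence t = 0. *)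
Lemma cexp_inj x y x0 y0 : cexp x y = cexp x0 y0 ->
  0 <= y <= pi *+ 2 -> 0 < y0 < pi *+ 2 -> x = x0 /\ y = y0.
Proof.
move=> E hy hy0; have Ex : expR x = expR x0 by rewrite -(normc_cexp x y) E normc_cexp.
have {}Ex : x = x0 by exact: expR_inj.
move: E; rewrite Ex => -[/(mulfI (lt0r_neq0 (expR_gt0 _))) Ec /(mulfI (lt0r_neq0 (expR_gt0 _))) Es].
split => //; apply/eqP; rewrite -subr_eq0 -normr_eq0; apply/negPn/negP => dn0.
pose t := `|y - y0| / 2.
have t0 : 0 < t by rewrite divr_gt0// lt_def dn0 normr_ge0.
have tp : t < pi.
  rewrite /t ltr_pdivrMr// mulr_natr ltr_norml.
  by move: hy hy0 => /andP[h1 h2] /andP[h3 h4]; apply/andP; split; lra.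
have c1 : cos (t + t) = 1.
  have -> : t + t = `|y - y0| by rewrite /t -splitr.
  have cn (u : R) : cos `|u| = cos u.
    by have [u0|u0] := leP 0 u; [rewrite ger0_norm|rewrite ltr0_norm// cosN].
  by rewrite cn cosB Ec Es -!expr2 cos2Dsin2.
have := cos2Dsin2 t; move: c1; rewrite cosD -!expr2 => c1 c2.
have : 0 < sin t by rewrite sin_gt0_pi// t0.
have : sin t ^+ 2 = 0 by lra.
by move=> /eqP; rewrite sqrf_eq0 => /eqP ->; rewrite ltxx.
Qed.

Lemma cexp_surj (a : C) : Im a != 0 -> exists x0 y0, [/\ 0 < y0 < pi *+ 2, a = cexp x0 y0 &
  x0 = ln (normc a)].
Proof.
case: a => u v /= v0; pose r := normc (u +i* v).
have r0 : 0 < r by rewrite normc_gt0 eq_complex/= negb_and v0 orbT.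
have r2 : r ^+ 2 = u ^+ 2 + v ^+ 2 by rewrite /r sqr_normcE.
have v2 : 0 < v ^+ 2 by rewrite exprn_even_gt0.
pose c := u / r.
have c2 : c ^+ 2 < 1 by rewrite /c expr_div_n ltr_pdivrMr ?exprn_gt0// mul1r r2; lra.
have c1 : -1 < c < 1 by rewrite -ltr_norml -(@ltr_pXn2r _ 2) ?nnegrE// real_normK ?num_real// expr1n.
have /andP[cl cu] := c1.
have c1' : -1 <= c <= 1 by rewrite !ltW.
have ac0 : 0 < acos c by apply: acos_gt0; rewrite cu ltW.
have acp : acos c < pi by apply: acos_ltpi; rewrite cl ltW.
have cac : cos (acos c) = c by case: (acos_def c1').
have sac : sin (acos c) = `|v| / r.
  rewrite sin_acos// (_ : 1 - c ^+ 2 = (v / r) ^+ 2).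
    by rewrite sqrtr_sqr normrM normfV (gtr0_norm r0).
  rewrite /c !expr_div_n r2 -[X in X - _](@divff _ (u ^+ 2 + v ^+ 2)); last by rewrite -r2 expf_neq0// gt_eqF.
  by rewrite -mulrBl addrAC subrr add0r.
have er : expR (ln r) = r by rewrite lnK.
have pp : 0 < pi :> R by exact: pi_gt0.
have [vp|vn] := ltP 0 v.
- exists (ln r), (acos c); split => //.
    by rewrite ac0/= (lt_trans acp)// mulr2n ltrDl.
  by rewrite /cexp er cac sac gtr0_norm// /c ![r * _]mulrC !divfK ?gt_eqF.
- exists (ln r), (- acos c + pi *+ 2); split => //.
    by rewrite mulr2n; lra.
  rewrite /cexp er (periodicn (@cosD2pi R) 1) (periodicn (@sinD2pi R) 1) cosN sinN cac sac.
  by rewrite ler0_norm// mulNr opprK /c ![r * _]mulrC !divfK ?gt_eqF.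
Qed.

Lemma is_derive_approx (f : R -> R) x l : is_derive x 1 f l -> forall e, 0 < e ->
  exists2 d : R, 0 < d & forall h, `|h| < d -> `|f (x + h) - f x - l * h| <= e * `|h|.
Proof.
move=> [/cvg_ex[l' cl] fl] e e0.
have ll : l' = l by rewrite -fl; apply/esym/cvg_lim.
move: cl => /cvgrPdist_le/(_ _ e0); rewrite /prop_near1 => -[d /= d0 Hd].
exists d => // h hd; have [->|h0] := eqVneq h 0.
  by rewrite addr0 mulr0 subrr subr0 normr0 mulr0.
have := Hd h; rewrite /= sub0r normrN => /(_ hd h0).
rewrite /GRing.scale/= mulr1 ll (addrC h) => H.
rewrite -ler_pdivrMr ?normr_gt0// -normfV -normrM mulrBl mulfK// distrC mulrC.
by rewrite [X in _ - X]mulrC in H *; rewrite mulrC in H *.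
Qed.

Lemma cexp_approx e : 0 < e -> exists2 d : R, 0 < d & forall x y, `|x| < d -> `|y| < d ->
  normc (cexp x y - 1 - (x +i* y)) <= e * (`|x| + `|y|).
Proof.
(* The errors below add up to e1 |x| + 7 e1 |y|, hence the 8. *)
move=> e0; have [e1 [e10 e11 e18]] : exists e1 : R, [/\ 0 < e1, e1 <= 1 & e1 <= e / 8].
  exists (Num.min 1 (e / 8)); split; rewrite ?ge_min ?lexx ?orbT//.
  by rewrite lt_min ltr01 divr_gt0.
have [d1 d10 H1] := is_derive_approx (is_derive_expR (0 : R)) e10.
have [d2 d20 H2] := is_derive_approx (is_derive_cos (0 : R)) e10.
have [d3 d30 H3] := is_derive_approx (is_derive_sin (0 : R)) e10.
exists (Num.min (Num.min d1 d2) (Num.min d3 e1)); first by rewrite !lt_min d10 d20 d30.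
move=> x y; rewrite !lt_min => /andP[/andP[x1 x2] /andP[x3 x4]] /andP[/andP[y1 y2] /andP[y3 y4]].
have := H1 x x1; have := H2 y y2; have := H3 y y3.
rewrite !add0r expR0 cos0 sin0 !oppr0 mul0r !(oppr0, addr0) !mul1r => h3 h2 h1.
have nx := normr_ge0 x; have ny := normr_ge0 y.
have cy : `|cos y| <= 1 by rewrite ler_norml cos_geN1 cos_le1.
have ex : `|expR x - 1| <= 2 * `|x|.
  rewrite -[expR x - 1](subrK x) (le_trans (ler_normD _ _))//.
  by have := ler_wpM2r nx e11; lra.
have sy : `|sin y| <= 2 * `|y|.
  rewrite -[sin y](subrK y) (le_trans (ler_normD _ _))//.
  by have := ler_wpM2r ny e11; lra.
apply: le_trans (normc_le_ReIm _) _.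
have -> : Re (cexp x y - 1 - (x +i* y)) = (expR x - 1 - x) * cos y + (1 + x) * (cos y - 1).
  rewrite /cexp/=; ring.
have -> : Im (cexp x y - 1 - (x +i* y)) = (expR x - 1) * sin y + (sin y - y).
  rewrite /cexp/=; ring.
have A1 : `|(expR x - 1 - x) * cos y| <= e1 * `|x|.
  by rewrite normrM (le_trans (ler_pM _ _ h1 cy))// mulr1.
have A2 : `|(1 + x) * (cos y - 1)| <= 2 * (e1 * `|y|).
  rewrite normrM ler_pM// (le_trans (ler_normD _ _))// normr1.
  by have := ltW x4; lra.
have A3 : `|(expR x - 1) * sin y| <= 4 * (e1 * `|y|).
  rewrite normrM (le_trans (ler_pM _ _ ex sy))//.
  by have := ler_wpM2r ny (ltW x4); lra.
rewrite (le_trans (lerD (ler_normD _ _) (ler_normD _ _)))//.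
have := ler_wpM2r nx e18; have := ler_wpM2r ny e18.
have := mulr_ge0 (ltW e0) nx; have := mulr_ge0 (ltW e0) ny.
by move: A1 A2 A3 h3; clear; lra.
Qed.

Let Re_lin (A B w : C) x y :
  Re (A - B - w * (x +i* y)) = Re A - Re B - (Re w * x - Im w * y).
Proof. by case: A B w => [? ?] [? ?] [? ?]. Qed.

Let Im_lin (A B w : C) x y :
  Im (A - B - w * (x +i* y)) = Im A - Im B - (Im w * x + Re w * y).
Proof. case: A B w => [? ?] [? ?] [? ?] /=; ring. Qed.

(** Chain rule for F after exp. The derivative is multiplication by the complex number l z0, and
    this is what the Cauchy-Riemann pattern p1 = q2 = Re, q1 = Im of [closed_at] expresses. *)
Lemma closed_at_log F x0 y0 : derivable F (cexp x0 y0) 1 ->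
  closed_at (fun x y => Re (F (cexp x y))) (fun x y => Im (F (cexp x y))) x0 y0.
Proof.
set z0 := cexp x0 y0 => /derivable_normcP[l Hl].
exists (Re (l * z0)), (Im (l * z0)), (Re (l * z0)) => e e0.
pose Z := normc z0; pose L := normc l.
have Z0 : 0 < Z by rewrite /Z normc_gt0 cexp_neq0.
have L0 : 0 <= L by exact: normc_ge0.
have e20 : 0 < e / (4 * Z) by rewrite divr_gt0// mulr_gt0.
have [d2 d20 H2] := Hl _ e20.
have LZ : 0 <= L * Z by rewrite mulr_ge0// ltW.
have [e1 [e10 e11 e12]] : exists e1 : R, [/\ 0 < e1, e1 <= 1 & L * Z * e1 <= e / 2].
  have LZ1 : 0 < 2 * (L * Z + 1) by rewrite mulr_gt0// ltr_wpDl.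
  exists (Num.min 1 (e / (2 * (L * Z + 1)))); split.
  - by rewrite lt_min ltr01 divr_gt0.
  - by rewrite ge_min lexx.
  apply: (@le_trans _ _ (L * Z * (e / (2 * (L * Z + 1))))).
    by rewrite ler_wpM2l// ge_min lexx orbT.
  by rewrite mulrA ler_pdivrMr//; have := mulr_ge0 LZ (ltW e0); lra.
have [d1 d10 H1] := cexp_approx e10.
exists (Num.min d1 (d2 / (4 * Z))).
  by rewrite lt_min d10 divr_gt0// mulr_gt0.
move=> x y; rewrite !lt_min => /andP[x1 x2] /andP[y1 y2].
set dx := x - x0; set dy := y - y0; pose s := `|dx| + `|dy|.
have s0 : 0 <= s by rewrite addr_ge0.
have zE : cexp x y = z0 * cexp dx dy by rewrite -cexpD /dx /dy [x0 + _]addrC [y0 + _]addrC !subrK.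
pose k := z0 * (cexp dx dy - 1).
have zk : cexp x y = z0 + k by rewrite zE /k; ring.
have dn : normc (dx +i* dy) <= s by exact: normc_le_ReIm.
have kn : normc k <= 2 * Z * s.
  rewrite /k normcM -/Z mulrAC mulrC ler_wpM2r ?(ltW Z0)//.
  rewrite -[cexp dx dy - 1](subrK (dx +i* dy)) (le_trans (ler_normcD _ _))//.
  have := H1 dx dy x1 y1; have := ler_wpM2r s0 e11; rewrite -/s; lra.
have kd : normc k < d2.
  apply: le_lt_trans kn _; move: x2 y2; rewrite !ltr_pdivlMr ?mulr_gt0// /s; lra.
have key : normc (F (cexp x y) - F z0 - l * z0 * (dx +i* dy)) <= e * s.
  rewrite zk; have -> : F (z0 + k) - F z0 - l * z0 * (dx +i* dy) =
    (F (z0 + k) - F z0 - l * k) + l * z0 * (cexp dx dy - 1 - (dx +i* dy)) by rewrite /k; ring.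
  rewrite (le_trans (ler_normcD _ _))// [e]splitr mulrDl lerD//.
    rewrite (le_trans (H2 _ kd))// (le_trans (ler_wpM2l (ltW e20) kn))//.
    have -> // : e / (4 * Z) * (2 * Z * s) = e / 2 * s by field; rewrite gt_eqF.
  rewrite !normcM -/L -/Z (le_trans (ler_wpM2l LZ (H1 _ _ x1 y1)))// mulrA.
  by rewrite ler_wpM2r.
by rewrite -Re_lin -Im_lin; split; apply: le_trans key; [exact: normc_Re|exact: normc_Im].
Qed.

End LogCoordinates.

(** * Integrals over circles centered at 0 *)

Section CircleIntegral.
Variable R : realType.
Local Notation C := R[i].
Implicit Types (phi psi : R -> C) (x y : R) (F : C -> C).
Local Notation pi2 := (pi *+ 2 : R).

Let pi2_ge0 : 0 <= pi2. Proof. by rewrite mulrn_wge0// pi_ge0. Qed.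

(** The integral is taken in the angle: on a circle dy = dz/(iz), so it corresponds to the form dz/z
    rather than dz. *)
Definition cint phi : C :=
  itg (fun y => Re (phi y)) 0 pi2 +i* itg (fun y => Im (phi y)) 0 pi2.

Definition ccts phi :=
  cts (fun y => Re (phi y)) 0 pi2 /\ cts (fun y => Im (phi y)) 0 pi2.

Let eq_cts (f g : R -> R) a b : f =1 g -> cts f a b -> cts g a b.
Proof. by move=> /funext ->. Qed.

Lemma cctsD phi psi : ccts phi -> ccts psi -> ccts (fun y => phi y + psi y).
Proof.
move=> [f1 f2] [g1 g2]; split.
- by apply: eq_cts (ctsD f1 g1) => y /=; case: (phi y) (psi y) => [? ?] [].
- by apply: eq_cts (ctsD f2 g2) => y /=; case: (phi y) (psi y) => [? ?] [].
Qed.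

Lemma cintD phi psi : ccts phi -> ccts psi ->
  cint (fun y => phi y + psi y) = cint phi + cint psi.
Proof.
move=> [f1 f2] [g1 g2]; rewrite /cint.
rewrite (_ : _ + _ = (itg (fun y => Re (phi y)) 0 pi2 + itg (fun y => Re (psi y)) 0 pi2)
   +i* (itg (fun y => Im (phi y)) 0 pi2 + itg (fun y => Im (psi y)) 0 pi2))//.
rewrite -itgD// -itgD//; congr (_ +i* _); apply: eq_itg => y _;
  by case: (phi y) (psi y) => [? ?] [].
Qed.

Lemma cctsZ (k : C) phi : ccts phi -> ccts (fun y => k * phi y).
Proof.
case: k => u v [f1 f2]; split.
- apply: eq_cts (ctsB (ctsZ (k := u) f1) (ctsZ (k := v) f2)) => y /=.
  by case: (phi y).
- apply: eq_cts (ctsD (ctsZ (k := u) f2) (ctsZ (k := v) f1)) => y /=.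
  by case: (phi y).
Qed.

Lemma cintZ (k : C) phi : ccts phi -> cint (fun y => k * phi y) = k * cint phi.
Proof.
case: k => u v [f1 f2]; rewrite /cint.
rewrite (_ : _ * _ = (u * itg (fun y => Re (phi y)) 0 pi2 - v * itg (fun y => Im (phi y)) 0 pi2)
   +i* (u * itg (fun y => Im (phi y)) 0 pi2 + v * itg (fun y => Re (phi y)) 0 pi2))//.
rewrite -!itgZ// -itgB; [|exact: ctsZ|exact: ctsZ].
rewrite -itgD; [|exact: ctsZ|exact: ctsZ].
by congr (_ +i* _); apply: eq_itg => y _; case: (phi y).
Qed.

Lemma ccts0 : ccts (fun=> 0).
Proof. by split => x _; exact: cvg_cst. Qed.

Lemma ccts_sum n (phi : nat -> R -> C) : (forall k, ccts (phi k)) ->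
  ccts (fun y => \sum_(k < n) phi k y).
Proof.
move=> H; elim: n => [|n IH].
  by rewrite (_ : (fun y => _) = fun=> 0); [exact: ccts0|apply/funext => y; rewrite big_ord0].
rewrite (_ : (fun y => _) = fun y => \sum_(k < n) phi k y + phi n y); first exact: cctsD.
by apply/funext => y; rewrite big_ord_recr.
Qed.

Lemma cint_sum n (phi : nat -> R -> C) : (forall k, ccts (phi k)) ->
  cint (fun y => \sum_(k < n) phi k y) = \sum_(k < n) cint (phi k).
Proof.
move=> H; elim: n => [|n IH].
  rewrite big_ord0 (_ : (fun y => _) = fun y => 0 * (fun=> 0) y); first by rewrite cintZ ?mul0r//; exact: ccts0.
  by apply/funext => y; rewrite big_ord0 mul0r.
rewrite (_ : (fun y => _) = fun y => \sum_(k < n) phi k y + phi n y).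
  by rewrite cintD ?IH ?big_ord_recr//; exact: ccts_sum.
by apply/funext => y; rewrite big_ord_recr.
Qed.

Lemma eq_cint phi psi : (forall y, phi y = psi y) -> cint phi = cint psi.
Proof. by move=> /funext ->. Qed.

Lemma cint_cst (k : C) : cint (fun=> k) = k * pi2%:C.
Proof.
rewrite /cint !itg_cst// subr0; case: k => u v /=; apply/eqP; rewrite eq_complex/=.
by rewrite !mulr0 subr0 add0r !eqxx.
Qed.

(** The factor 2 comes from treating real and imaginary parts separately; it is harmless for
    integrals shown to tend to 0. *)
Lemma cint_norm_le phi M : ccts phi -> (forall y, 0 <= y <= pi2 -> normc (phi y) <= M) ->
  normc (cint phi) <= 2 * M * pi2.
Proof.
move=> [f1 f2] H; rewrite (le_trans (normc_le_ReIm _))//=.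
have -> : 2 * M * pi2 = M * (pi2 - 0) + M * (pi2 - 0) by rewrite subr0; ring.
by rewrite lerD// itg_norm_le// => y hy; apply: le_trans (H y hy); [exact: normc_Re|exact: normc_Im].
Qed.

Lemma ccts_bounded phi : ccts phi -> exists2 M : R, 0 <= M & forall y, 0 <= y <= pi2 -> normc (phi y) <= M.
Proof.
have bd (f : R -> R) : cts f 0 pi2 -> exists M : R, forall y, 0 <= y <= pi2 -> `|f y| <= M.
  move=> Hf; have [|c _ Hc] := @EVT_max R (fun y => `|f y|) 0 pi2 pi2_ge0.
    apply: continuous_in_subspaceT => x; rewrite inE/= in_itv/= => xab.
    by apply: cvg_norm; exact: Hf.
  by exists (`|f c|) => y hy; apply: Hc; rewrite in_itv.
move=> [/bd[M1 H1] /bd[M2 H2]]; exists (M1 + M2).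
  have h0 : 0 <= (0 : R) <= pi2 by rewrite lexx pi2_ge0.
  by apply: addr_ge0; [exact: le_trans (H1 _ h0)|exact: le_trans (H2 _ h0)].
by move=> y hy; rewrite (le_trans (normc_le_ReIm _))// lerD ?H1 ?H2.
Qed.

Lemma ccts_cexp F x : (forall y, 0 <= y <= pi2 -> derivable F (cexp x y) 1) ->
  ccts (fun y => F (cexp x y)).
Proof.
by move=> H; split => y hy; have [_ h1 _ h2] := closed_at_continuous (closed_at_log (H y hy)).
Qed.

(** Here [bint] is minus the real part of the contour integral of F(exp w) dw over the rectangle.
    Its horizontal sides cancel by periodicity, which leaves the imaginary parts of the two circle
    integrals. The real parts follow from the same argument for iF, hence the closure condition on
    P. *)
Let cint_of_bint (P : (C -> C) -> Prop) x1 x2 :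
  (forall F, P F -> P (fun z => 'i%C * F z)) ->
  (forall F, P F -> ccts (fun y => F (cexp x1 y)) /\ ccts (fun y => F (cexp x2 y))) ->
  (forall F, P F -> bint (fun x y => Re (F (cexp x y))) (fun x y => Im (F (cexp x y))) x1 x2 0 pi2 = 0) ->
  forall F, P F -> cint (fun y => F (cexp x1 y)) = cint (fun y => F (cexp x2 y)).
Proof.
move=> Pi Pc Pb.
have HIm F : P F -> itg (fun y => Im (F (cexp x1 y))) 0 pi2 = itg (fun y => Im (F (cexp x2 y))) 0 pi2.
  move=> PF; have := Pb F PF; rewrite /bint [X in _ + X](@eq_itg _ _ (fun x => 0 * 0)).
    have [[_ c1] [_ c2]] := Pc F PF.
    rewrite (itgB c2 c1) itgZ; last by move=> x _; exact: cvg_cst.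
    by rewrite mul0r addr0 => /subr0_eq ->.
  by move=> x _; rewrite cexp_2pi subrr mulr0.
have ImiF (F : C -> C) z : Im ('i%C * F z) = Re (F z).
  by case: (F z) => u v /=; rewrite mul0r mul1r add0r.
move=> F PF; rewrite /cint (HIm F PF); congr (_ +i* _).
have := HIm _ (Pi _ PF).
by under eq_itg do rewrite ImiF; under [in RHS]eq_itg do rewrite ImiF.
Qed.

Lemma derivable_mulCl (k : C) F z : derivable F z 1 -> derivable (fun w => k * F w) z 1.
Proof. by move=> H; apply: derivableM; [exact: derivable_cst|exact: H]. Qed.

Lemma cint_circle F x1 x2 : x1 <= x2 ->
  (forall x y, x1 <= x <= x2 -> 0 <= y <= pi2 -> derivable F (cexp x y) 1) ->
  cint (fun y => F (cexp x1 y)) = cint (fun y => F (cexp x2 y)).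
Proof.
move=> x12; apply: (cint_of_bint (P := fun F => forall x y, x1 <= x <= x2 -> 0 <= y <= pi2 -> derivable F (cexp x y) 1)) => {}F.
- by move=> H x y hx hy; apply: derivable_mulCl; exact: H.
- by move=> H; split; apply: ccts_cexp => y hy; apply: H; rewrite ?lexx ?x12.
- by move=> H; apply: goursat => // x y hx hy; apply: closed_at_log; exact: H.
Qed.

Lemma cint_circle_puncture F x1 x2 x0 y0 : x1 < x0 < x2 -> 0 < y0 < pi2 ->
  (forall x y, x1 <= x <= x2 -> 0 <= y <= pi2 -> x != x0 \/ y != y0 -> derivable F (cexp x y) 1) ->
  (exists M s0 : R, 0 < s0 /\ forall x y, `|x - x0| <= s0 -> `|y - y0| <= s0 -> normc (F (cexp x y)) <= M) ->
  cint (fun y => F (cexp x1 y)) = cint (fun y => F (cexp x2 y)).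
Proof.
move=> /andP[x10 x02] hy0 H1 H2; have x12 : x1 <= x2 by rewrite ltW// (lt_trans x10).
apply: (cint_of_bint (P := fun F =>
  (forall x y, x1 <= x <= x2 -> 0 <= y <= pi2 -> x != x0 \/ y != y0 -> derivable F (cexp x y) 1) /\
  exists M s0 : R, 0 < s0 /\ forall x y, `|x - x0| <= s0 -> `|y - y0| <= s0 -> normc (F (cexp x y)) <= M)) (conj H1 H2) => {H1 H2}F [H1 H2].
- split; first by move=> x y hx hy h; apply: derivable_mulCl; exact: H1.
  have [M [s0 [s00 HM]]] := H2; exists M, s0; split => // x y hx hy.
  by rewrite normcM (_ : normc 'i%C = 1) ?mul1r ?HM// /normc expr0n expr1n add0r sqrtr1.
- by split; apply: ccts_cexp => y hy; apply: H1; rewrite ?lexx ?x12//; left; rewrite ?(lt_eqF x10) ?(gt_eqF x02).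
- have [M [s0 [s00 HM]]] := H2.
  apply: (@goursat_puncture _ _ _ _ _ _ _ x0 y0) => //.
  + by rewrite x10.
  + by move=> x y hx hy h; apply: closed_at_log; exact: H1.
  + exists M, s0; split => // x y hx hy.
    by split; apply: le_trans (HM x y hx hy); [exact: normc_Re|exact: normc_Im].
Qed.

End CircleIntegral.

(** * Cauchy's formula and Taylor expansion *)

Section Taylor.
Variable R : realType.
Local Notation C := R[i].
Implicit Types (x y : R) (F : C -> C).
Local Notation pi2 := (pi *+ 2 : R).

Let pi2_gt0 : 0 < pi2. Proof. by rewrite mulrn_wgt0// pi_gt0. Qed.

Let pi2C_neq0 : pi2%:C != 0 :> C.
Proof. by rewrite eq_complex/= eqxx andbT gt_eqF. Qed.

Lemma derivable_invX (z : C) k : z != 0 -> derivable (fun w : C => w^-1 ^+ k) z 1.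
Proof.
move=> z0; have dV : derivable (fun w : C => w^-1) z 1.
  by apply: derivableV => //; exact: derivable_id.
elim: k => [|k IH].
  by rewrite (_ : (fun w => _) = cst 1); [exact: derivable_cst|apply/funext => w; rewrite expr0].
rewrite (_ : (fun w => _) = (fun w : C => w^-1) * (fun w : C => w^-1 ^+ k)).
  by apply: derivableM; [exact: dV|exact: IH].
by apply/funext => w; rewrite exprS.
Qed.

Lemma ccts_invX k x : ccts (fun y => (cexp x y)^-1 ^+ k).
Proof.
by apply: (ccts_cexp (F := fun w => w^-1 ^+ k)) => y _; apply: derivable_invX; exact: cexp_neq0.
Qed.

(** By homogeneity, passing from radius 1 to radius e multiplies the integral by exp(-k), while
    [cint_circle] says that it does not change. *)
Lemma cint_invX k x : (0 < k)%N -> cint (fun y => (cexp x y)^-1 ^+ k) = 0.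
Proof.
move=> k0.
have E x' : cint (fun y => (cexp x' y)^-1 ^+ k) = (cexp x' 0)^-1 ^+ k * cint (fun y => (cexp 0 y)^-1 ^+ k).
  rewrite -cintZ; last exact: ccts_invX.
  by apply: eq_cint => y; rewrite -exprMn -invfM -cexpD addr0 add0r.
have := E 1; rewrite -(@cint_circle _ (fun w => w^-1 ^+ k) 0 1)//; last first.
  by move=> x' y _ _; apply: derivable_invX; exact: cexp_neq0.
rewrite (E x); set I := cint _ => /eqP.
rewrite -[X in X == _]mul1r -subr_eq0 -mulrBl mulf_eq0 => /orP[|/eqP ->]; last by rewrite mulr0.
rewrite subr_eq0 => /eqP/(congr1 (@normc _)).
rewrite normc1 normcX normcV normc_cexp -expRN => h.
have : expR (-1) ^+ k < 1 :> R by rewrite expr_lt1 ?expR_ge0// expR_lt1 oppr_lt0.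
by rewrite -h ltxx.
Qed.

Variable f : C -> C.
Hypothesis Hf : Hol f.

Lemma disc_cexp x y : x < 0 -> disc (cexp x y).
Proof. by move=> x0; rewrite /disc /mkset normc_cexp expR_lt1. Qed.

Let dfk k x y : x < 0 -> derivable (fun z => f z * z^-1 ^+ k) (cexp x y) 1.
Proof.
move=> x0; apply: derivableM; first by apply: Hf; exact: disc_cexp.
by apply: derivable_invX; exact: cexp_neq0.
Qed.

(** Cauchy's formula for the k-th coefficient. The radius 1/e is an arbitrary choice below 1;
    [cint_circle_coef] passes to any other. *)
Definition circle_coef k : C := cint (fun y => f (cexp (-1) y) * (cexp (-1) y)^-1 ^+ k) / pi2%:C.

Lemma cint_circle_coef k x : x < 0 ->
  cint (fun y => f (cexp x y) * (cexp x y)^-1 ^+ k) = circle_coef k * pi2%:C.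
Proof.
move=> x0; rewrite /circle_coef (divfK pi2C_neq0).
have [h|/ltW h] := leP x (-1).
  apply: (cint_circle (F := fun z => f z * z^-1 ^+ k) h) => x' y /andP[_ h'] _.
  by apply: dfk; rewrite (le_lt_trans h')// ltrN10.
apply/esym; apply: (cint_circle (F := fun z => f z * z^-1 ^+ k) h) => x' y /andP[_ h'] _.
by apply: dfk; rewrite (le_lt_trans h').
Qed.

(* [Im a != 0] puts log a in the interior of a rectangle of imaginary side (0, 2 pi); real
   points are then reached by continuity. *)
Section CauchyKernel.
Variable a : C.
Hypotheses (da : disc a) (ia : Im a != 0).

(** Difference quotient of f at a; the extra factor z turns dz into the angular measure of [cint].
    At z = a its value is 0, which does not spoil boundedness. *)
Let Phi (z : C) : C := (f z - f a) * (z * (z - a)^-1).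

Let a_neq0 : a != 0.
Proof. by apply/eqP => a0; move: ia; rewrite a0 eqxx. Qed.

Let na0 : 0 < normc a. Proof. by rewrite normc_gt0. Qed.

Let dPhi z : disc z -> z != a -> derivable Phi z 1.
Proof.
move=> dz za; apply: derivableM.
  by apply: derivableB; [exact: Hf|exact: derivable_cst].
apply: derivableM; first exact: derivable_id.
apply: derivableV; first by rewrite subr_eq0.
by apply: derivableB; [exact: derivable_id|exact: derivable_cst].
Qed.

Let Phi_bounded : exists M d : R, 0 < d /\ forall z, normc (z - a) < d -> normc (Phi z) <= M.
Proof.
have /derivable_normcP[l /(_ 1 ltr01)[d d0 Hd]] := Hf da.
have l1 : 0 <= normc l + 1 by rewrite addr_ge0 ?normc_ge0.
exists ((normc l + 1) * (normc a + d)), d; split => // z zd.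
have zn : normc z <= normc a + d.
  by rewrite -[z](subrK a) (le_trans (ler_normcD _ _))// addrC lerD2l ltW.
have [->|za] := eqVneq z a.
  by rewrite /Phi subrr mul0r normc0 mulr_ge0// addr_ge0 ?normc_ge0 ?(ltW d0).
have := Hd _ zd; rewrite (addrC a) subrK mul1r => H.
have fz : normc (f z - f a) <= (normc l + 1) * normc (z - a).
  rewrite -[f z - f a](subrK (l * (z - a))) (le_trans (ler_normcD _ _))// normcM.
  by rewrite mulrDl mul1r addrC lerD2l.
have za0 : 0 < normc (z - a) by rewrite normc_gt0 subr_eq0.
rewrite /Phi !normcM normcV mulrCA mulrC ler_pM ?normc_ge0//.
  by rewrite mulr_ge0 ?normc_ge0// invr_ge0 ltW.
by rewrite ler_pdivrMr.
Qed.

Let x_a := ln (normc a).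

Let expR_xa : expR x_a = normc a. Proof. by rewrite /x_a lnK. Qed.

Let xa_lt0 : x_a < 0. Proof. by rewrite -expR_lt1 expR_xa. Qed.

Let cexp_ne x y : x != x_a -> cexp x y != a.
Proof.
move=> xa; apply/eqP => /(congr1 (@normc _)); rewrite normc_cexp -expR_xa => /expR_inj.
by move/eqP: xa.
Qed.

Let ccts_Phi x : x < 0 -> x != x_a -> ccts (fun y => Phi (cexp x y)).
Proof.
by move=> x0 xa; apply: ccts_cexp => y _; apply: dPhi; [exact: disc_cexp|exact: cexp_ne].
Qed.

Let cint_Phi_const x1 x2 : x1 < x_a -> x_a < x2 -> x2 < 0 ->
  cint (fun y => Phi (cexp x1 y)) = cint (fun y => Phi (cexp x2 y)).
Proof.
move=> x1a ax2 x20; have [x0 [y0 [hy0 aE x0E]]] := cexp_surj ia.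
have {}x0E : x0 = x_a by [].
rewrite {}x0E in aE *.
apply: (@cint_circle_puncture _ _ x1 x2 x_a y0) => //; first by rewrite x1a.
  move=> x y /andP[_ xx2] hy h; apply: dPhi; first by apply: disc_cexp; exact: le_lt_trans xx2 x20.
  apply/eqP => E; have [] : x = x_a /\ y = y0 by apply: cexp_inj => //; rewrite E.
  by move: h => [/eqP|/eqP].
have [M [d [d0 HM]]] := Phi_bounded.
have [s s0 Hs] := cexp_approx (@ltr01 R).
pose s1 := Num.min (s / 2) (d / (8 * normc a)).
have s10 : 0 < s1 by rewrite lt_min !divr_gt0// mulr_gt0.
exists M, s1; split => // x y hx hy; apply: HM.
have h1 : s1 < s by rewrite gt_min; apply/orP; left; rewrite ltr_pdivrMr// ltr_pMr// ltr1n.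
have hd : 8 * normc a * s1 <= d.
  have : s1 <= d / (8 * normc a) by rewrite ge_min lexx orbT.
  by rewrite ler_pdivlMr ?mulr_gt0// mulrC.
have -> : cexp x y - a = a * (cexp (x - x_a) (y - y0) - 1).
  by rewrite mulrBr mulr1 {2}aE -cexpD [x_a + _]addrC [y0 + _]addrC !subrK.
have := Hs (x - x_a) (y - y0) (le_lt_trans hx h1) (le_lt_trans hy h1).
set w := cexp _ _ - 1 => Hw.
have wn : normc w <= 4 * s1.
  rewrite -[w](subrK ((x - x_a) +i* (y - y0))) (le_trans (ler_normcD _ _))//.
  have := normc_le_ReIm ((x - x_a) +i* (y - y0)); rewrite /= => h3.
  rewrite (le_trans (lerD Hw h3))// mul1r (le_trans (lerD (lerD hx hy) (lerD hx hy)))//.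
  by rewrite [leRHS](_ : _ = s1 + s1 + (s1 + s1))//; ring.
rewrite normcM (le_lt_trans (ler_wpM2l (ltW na0) wn))// (lt_le_trans _ hd)//.
by rewrite mulrCA -mulrA ltr_pM2r ?mulr_gt0// ltr_nat.
Qed.

(** The circle is pulled across a down to a small radius t. There |z| = t, |f(z) - f(a)| <= K and |z
    - a| >= |a|/2, so the integral is O(t). *)
Let cint_Phi x2 : x_a < x2 -> x2 < 0 -> cint (fun y => Phi (cexp x2 y)) = 0.
Proof.
move=> ax2 x20; apply/eqP; rewrite -normc_eq0 eq_le normc_ge0 andbT.
apply/ler_addgt0Pr => e e0; rewrite add0r.
have d0 : disc (0 : C) by rewrite /disc /mkset normc0.
have [d dp Hd] := derivable_continuous_normc (Hf d0) ltr01.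
pose K := 1 + normc (f 0 - f a).
have K0 : 0 < K by rewrite ltr_pwDl// normc_ge0.
have [t [t0 td ta te]] : exists t : R,
    [/\ 0 < t, t < d, t < normc a / 2 & t < e * normc a / (4 * K * pi2)].
  pose m := Num.min (Num.min d (normc a / 2)) (e * normc a / (4 * K * pi2)).
  have m0 : 0 < m by rewrite /m !lt_min dp !divr_gt0// !mulr_gt0.
  have : m / 2 < m by rewrite ltr_pdivrMr// ltr_pMr// ltr1n.
  rewrite {2}/m !lt_min => /andP[/andP[td ta] te].
  by exists (m / 2); rewrite divr_gt0.
have lnt : ln t < x_a by rewrite ltr_ln ?posrE//; apply: lt_trans ta _; rewrite ltr_pdivrMr// ltr_pMr// ltr1n.
rewrite -(cint_Phi_const lnt ax2 x20).
have lnt0 : ln t < 0 by exact: lt_trans xa_lt0.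
apply: (@le_trans _ _ (2 * (K * (t * (2 / normc a))) * pi2)).
  apply: cint_norm_le => [|y _]; first by apply: ccts_Phi => //; rewrite lt_eqF.
  set z := cexp _ _; have zt : normc z = t by rewrite /z normc_cexp lnK.
  rewrite /Phi !normcM normcV zt ler_pM ?mulr_ge0 ?invr_ge0 ?normc_ge0 ?(ltW t0)//.
    have /Hd : normc z < d by rewrite zt.
    rewrite add0r => h; rewrite (le_trans (ler_distcD (f 0) _ _))// /K lerD2r; exact: ltW.
  rewrite ler_wpM2l ?(ltW t0)//.
  rewrite -[2 / normc a]invrK invf_div lef_pV2 ?posrE ?divr_gt0//; last first.
    by rewrite normc_gt0 subr_eq0; apply: cexp_ne; rewrite lt_eqF.
  rewrite normc_distC (le_trans _ (lerB_normc _ _))// zt.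
  by move: ta; lra.
have -> : 2 * (K * (t * (2 / normc a))) * pi2 = t * (4 * K * pi2) / normc a by field; rewrite gt_eqF.
rewrite ler_pdivrMr// -ler_pdivlMr ?mulr_gt0//; exact: ltW.
Qed.

Lemma cvg_circle_coef : series (fun k => circle_coef k * a ^+ k) @ \oo --> f a.
Proof.
have [x2 [ax2 x20]] : exists x2, x_a < x2 /\ x2 < 0.
  by exists (x_a / 2); have := xa_lt0; split; lra.
have xne : x2 != x_a by rewrite gt_eqF.
have cP := ccts_Phi x20 xne.
have [M M0 HM] := ccts_bounded cP.
pose q := normc a / expR x2.
have q0 : 0 <= q by rewrite divr_ge0 ?normc_ge0 ?expR_ge0.
have q1 : q < 1 by rewrite ltr_pdivrMr ?expR_gt0// mul1r -expR_xa ltr_expR.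
have main K : (0 < K)%N ->
    normc (series (fun k => circle_coef k * a ^+ k) K - f a) <= 2 * (M * q ^+ K).
  move=> K0.
  (* The finite geometric expansion of z/(z - a) splits Phi exactly into K terms g k = (f(z) -
     f(a))(a/z)^k and the remainder (a/z)^K Phi. Only finite sums are thus exchanged with the
     integral, and the remainder is O(q^K). *)
  pose g k y : C := a ^+ k * (f (cexp x2 y) * (cexp x2 y)^-1 ^+ k) + (- (f a * a ^+ k)) * (cexp x2 y)^-1 ^+ k.
  pose rem y : C := a ^+ K * ((cexp x2 y)^-1 ^+ K * Phi (cexp x2 y)).
  have cfk k : ccts (fun y => f (cexp x2 y) * (cexp x2 y)^-1 ^+ k).
    by apply: (ccts_cexp (F := fun z => f z * z^-1 ^+ k)) => y _; exact: dfk.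
  have cg k : ccts (g k) by apply: cctsD; apply: cctsZ => //; exact: ccts_invX.
  have cr0 : ccts (fun y => (cexp x2 y)^-1 ^+ K * Phi (cexp x2 y)).
    apply: (ccts_cexp (F := fun z => z^-1 ^+ K * Phi z)) => y _.
    apply: derivableM; first by apply: derivable_invX; exact: cexp_neq0.
    by apply: dPhi; [exact: disc_cexp|apply: cexp_ne; rewrite gt_eqF].
  have cr : ccts rem by exact: cctsZ.
  have E : cint (fun y => \sum_(k < K) g k y + rem y) = 0.
    apply: (etrans _ (cint_Phi ax2 x20)); apply: eq_cint => y; rewrite /rem /Phi.
    set z := cexp x2 y.
    have z0 : z != 0 by exact: cexp_neq0.
    have za : z - a != 0 by rewrite subr_eq0; apply: cexp_ne; rewrite gt_eqF.
    have -> : \sum_(k < K) g k y = (f z - f a) * \sum_(k < K) (a / z) ^+ k.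
      by rewrite mulr_sumr; apply: eq_bigr => k _; rewrite /g -/z exprMn; ring.
    have geo : \sum_(k < K) (a / z) ^+ k = (1 - (a / z) ^+ K) * (z * (z - a)^-1).
      have := subrX1 (a / z) K => S.
      have nz : a / z - 1 != 0.
        by rewrite subr_eq0; apply/eqP => /(congr1 (fun w => w * z)); rewrite mul1r divfK// => /esym/eqP; rewrite -subr_eq0 (negPf za).
      apply: (mulfI nz); rewrite -S; field.
      by rewrite z0 za.
    by rewrite geo exprMn; move: (z^-1 ^+ K) (a ^+ K) (z * (z - a)^-1) => u v w; ring.
  rewrite cintD// in E; last exact: ccts_sum.
  rewrite cint_sum// in E.
  have gE k : cint (g k) = (circle_coef k * a ^+ k - (f a * a ^+ k) *+ (k == 0%N)) * pi2%:C.
    rewrite /g cintD; [|exact: cctsZ|by apply: cctsZ; exact: ccts_invX].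
    rewrite cintZ// cint_circle_coef// cintZ; last exact: ccts_invX.
    case: k => [|k] /=; last by rewrite cint_invX// mulr0 addr0 mulr0n subr0; ring.
    by rewrite (_ : (fun y => _) = fun=> 1) ?cint_cst//; ring.
  have SE : \sum_(k < K) cint (g k) = (series (fun k => circle_coef k * a ^+ k) K - f a) * pi2%:C.
    under eq_bigr do rewrite gE.
    rewrite -mulr_suml sumrB; congr ((_ - _) * _); first by rewrite /series/= big_mkord.
    rewrite (bigD1 (Ordinal K0))//= mulr1n expr0 mulr1 big1 ?addr0// => i i0.
    by case: eqP => // ik; case/eqP: i0; exact: val_inj.
  have {E} : normc ((series (fun k => circle_coef k * a ^+ k) K - f a) * pi2%:C) <= 2 * (q ^+ K * M) * pi2.
    rewrite -SE (_ : \sum_(k < K) _ = - cint rem); last by apply/eqP; rewrite -addr_eq0 E.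
    rewrite normcNE; apply: cint_norm_le => // y hy.
    rewrite /rem mulrA normcM -exprMn normcX normcM normcV normc_cexp.
    by rewrite ler_wpM2l ?exprn_ge0// HM.
  rewrite normcM normc_real gtr0_norm// ler_pM2r// => h.
  by rewrite (le_trans h)// [M * _]mulrC.
apply/cvg_normcP => e e0.
have /cvgrPdist_lt/(_ _ e0)[N _ HN] : geometric (2 * M) q @ \oo --> (0 : R).
  by apply: cvg_geometric; rewrite ger0_norm.
exists N.+1 => K NK.
have := HN K (ltnW NK); rewrite /= sub0r normrN ger0_norm; last by rewrite !mulr_ge0// exprn_ge0.
apply: le_lt_trans; rewrite -mulrA; apply: main; exact: leq_trans NK.
Qed.

End CauchyKernel.

Lemma tame_circle_coef : tame circle_coef.
Proof.
(* The test point is taken on the imaginary axis, where the expansion is already known. *)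
move=> x /andP[x0 x1]; pose z : C := 0 +i* ((x + 1) / 2).
have h : 0 < (x + 1) / 2 by lra.
have zn : normc z = (x + 1) / 2 by rewrite /z/= expr0n/= add0r sqrtr_sqr gtr0_norm.
have dz : disc z by rewrite /disc /mkset zn; lra.
have iz : Im z != 0 by rewrite /= gt_eqF.
have [M HM] := cvg_series_normc_bounded (cvg_circle_coef dz iz).
exists M => k; apply: le_trans (HM k); rewrite (normcM (circle_coef k)) normcX zn.
by rewrite ler_wpM2l ?normc_ge0// lerXn2r ?nnegrE ?(ltW h)//; lra.
Qed.

Lemma Hol_psum_circle_coef z : disc z -> f z = psum circle_coef z.
Proof.
move=> dz; have [iz|iz] := eqVneq (Im z) 0; last first.
  by rewrite (psumE (cvg_circle_coef dz iz)).
apply/eqP; rewrite -subr_eq0 -normc_eq0 eq_le normc_ge0 andbT.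
apply/ler_addgt0Pr => e e0; rewrite add0r.
have e2 : 0 < e / 2 by rewrite divr_gt0.
have [d1 d10 H1] := derivable_continuous_normc (Hf dz) e2.
have [d2 d20 H2] := derivable_continuous_normc (derivable_psum tame_circle_coef dz) e2.
have [d3 d30 [x /andP[_ x1] H3]] := disc_near dz.
pose t := Num.min (Num.min d1 d2) d3 / 2.
have t00 : 0 < Num.min (Num.min d1 d2) d3 by rewrite !lt_min d10 d20.
have t0 : 0 < t by rewrite divr_gt0.
have : t < Num.min (Num.min d1 d2) d3 by rewrite ltr_pdivrMr// ltr_pMr// ltr1n.
rewrite !lt_min => /andP[/andP[t1 t2] t3].
pose h : C := 0 +i* t.
have hn : normc h = t by rewrite /h/= expr0n/= add0r sqrtr_sqr gtr0_norm.
have dzh : disc (z + h) by rewrite /disc /mkset (le_lt_trans _ x1)// H3// hn.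
have izh : Im (z + h) != 0.
  by rewrite /h; case: z iz {dz H1 H2 H3 dzh} => u v /= ->; rewrite add0r gt_eqF.
rewrite (le_trans (ler_distcD (f (z + h)) _ _))// [e]splitr lerD//.
  by rewrite normc_distC ltW// H1// hn.
by rewrite -(psumE (cvg_circle_coef dzh izh)) ltW// H2// hn.
Qed.

End Taylor.

Theorem Hol_power_series (R : realType) (f : R[i] -> R[i]) : Hol f ->
  exists a, tame a /\ forall z, disc z -> f z = psum a z.
Proof.
move=> Hf; exists (circle_coef f); split; first exact: tame_circle_coef.
by move=> z; exact: Hol_psum_circle_coef.
Qed.

(** * Lebesgue measure on the plane *)

Section PlaneMeasure.
Variable R : realType.
Local Notation C := R[i].
Local Notation mu := (@lebesgue_measure R).
Local Notation mu2 := (mu \x mu)%E.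
Implicit Types (c s : R) (G : R * R -> \bar R) (phi psi : R * R -> R * R).

(** The pushforward of Lebesgue measure under translation agrees with it on half-open intervals,
    hence everywhere by uniqueness. *)
Lemma ge0_integral_translation (h : R -> \bar R) c :
  measurable_fun setT h -> (forall x, (0 <= h x)%E) ->
  (\int[mu]_x h ((x : R) + c)%R = \int[mu]_x h x)%E.
Proof.
move=> mh h0.
have mt : measurable_fun (setT : set (measurableTypeR R)) ((fun x => x + c) : _ -> measurableTypeR R).
  by apply: measurable_funD => //; exact: measurable_cst.
rewrite -[LHS](ge0_integral_pushforward mt mu measurableT mh); last by move=> x _.
apply: eq_measure_integral => A mA _; apply/esym.
apply: lebesgue_measure_unique => // X [[a b] _ <-] /=.
rewrite /pushforward /=.
have -> : (+%R^~ c) @^-1` `]a, b]%classic = `]a - c, b - c]%classic.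
  by apply/seteqP; split=> x /=; rewrite !in_itv/= ltrBlDr lerBrDr.
rewrite !lebesgue_measure_itv/= !lte_fin ltrD2r.
by case: ifP => // _; rewrite -!EFinB; congr (_%:E); ring.
Qed.

Definition measure_preserving phi := measurable_fun setT phi /\
  forall G, measurable_fun setT G -> (forall w, (0 <= G w)%E) ->
    (\int[mu2]_w G (phi w) = \int[mu2]_w G w)%E.

Lemma measure_preserving_comp phi psi :
  measure_preserving phi -> measure_preserving psi -> measure_preserving (phi \o psi).
Proof.
move=> [mphi iphi] [mpsi ipsi]; split; first exact: measurableT_comp.
move=> G mG G0; rewrite -[RHS]iphi// -[RHS]ipsi//.
exact: measurableT_comp.
Qed.

(** For a fixed second coordinate the map is a translation, so Tonelli reduces to one dimension. The
    constant c makes s = 0 a translation of the plane. *)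
Lemma measure_preserving_shear_x s c :
  measure_preserving (fun w => (w.1 + (s * w.2 + c), w.2)).
Proof.
have mphi : measurable_fun setT (fun w : R * R => (w.1 + (s * w.2 + c), w.2)).
  apply: measurable_fun_pair; last exact: measurable_snd.
  apply: measurable_funD; first exact: measurable_fst.
  apply: measurable_funD; last exact: measurable_cst.
  by apply: measurable_funM; [exact: measurable_cst|exact: measurable_snd].
split=> // G mG G0.
rewrite (@fubini_tonelli2 _ _ _ _ R mu mu (fun w => G (w.1 + (s * w.2 + c), w.2))
  (measurableT_comp mG mphi))//.
rewrite (@fubini_tonelli2 _ _ _ _ R mu mu G mG G0); apply: eq_integral => y _.
apply: (@ge0_integral_translation (fun x => G (x, y)) (s * y + c)) => //.
by apply: measurableT_comp mG _; exact: measurable_pair2.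
Qed.

Lemma measure_preserving_shear_y s c :
  measure_preserving (fun w => (w.1, w.2 + (s * w.1 + c))).
Proof.
have mphi : measurable_fun setT (fun w : R * R => (w.1, w.2 + (s * w.1 + c))).
  apply: measurable_fun_pair; first exact: measurable_fst.
  apply: measurable_funD; first exact: measurable_snd.
  apply: measurable_funD; last exact: measurable_cst.
  by apply: measurable_funM; [exact: measurable_cst|exact: measurable_fst].
split=> // G mG G0.
rewrite (@fubini_tonelli1 _ _ _ _ R mu mu (fun w => G (w.1, w.2 + (s * w.1 + c)))
  (measurableT_comp mG mphi))//.
rewrite (@fubini_tonelli1 _ _ _ _ R mu mu G mG G0); apply: eq_integral => x _.
apply: (@ge0_integral_translation (fun y => G (x, y)) (s * x + c)) => //.
by apply: measurableT_comp mG _; exact: measurable_pair1.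
Qed.

Definition plane_mul (z : C) (w : R * R) : R * R :=
  (Re (z * (w.1 +i* w.2)), Im (z * (w.1 +i* w.2))).

Lemma plane_mulE z w : (plane_mul z w).1 +i* (plane_mul z w).2 = z * (w.1 +i* w.2).
Proof. by rewrite /plane_mul /=; case: (z * _). Qed.

(* A rotation by an angle other than pi is a product of three shears. *)
Lemma measure_preserving_rotation z : normc z = 1 -> z != -1 ->
  measure_preserving (plane_mul z).
Proof.
(* t is the tangent of half the angle of rotation, which is why z = -1 is excluded. *)
move=> z1 zN1; pose c := Re z; pose s := Im z; pose t := s / (1 + c).
have cs : c ^+ 2 + s ^+ 2 = 1 by rewrite -sqr_normcE z1 expr1n.
have c1 : 1 + c != 0.
  apply: contra zN1 => /eqP h; have c1 : c = -1 by lra.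
  move: cs; rewrite c1 sqrrN expr1n => /eqP; rewrite -subr_eq0 addrAC subrr add0r.
  rewrite sqrf_eq0 => /eqP s0; move: c1 s0; rewrite /c /s.
  by case: z {z1 c s t h} => /= a b -> ->; rewrite eq_complex/= oppr0 !eqxx.
have ts : t * s = 1 - c.
  rewrite /t mulrAC -expr2; apply: (mulIf c1); rewrite mulfVK//.
  by move: cs; lra.
have tc : t * (1 + c) = s by rewrite /t mulfVK.
have -> : plane_mul z = (fun w => (w.1 + (- t * w.2 + 0), w.2)) \o
  (fun w => (w.1, w.2 + (s * w.1 + 0))) \o (fun w => (w.1 + (- t * w.2 + 0), w.2)).
  apply/funext => -[x y]; rewrite /plane_mul /=.
  have -> : z = c +i* s by rewrite /c /s; case: (z).
  rewrite /=; clear -ts tc; congr pair; last first.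
    transitivity ((1 - t * s) * y + s * x); last by ring.
    by rewrite ts; ring.
  have -> : x + (- t * y + 0) + (- t * (y + (s * (x + (- t * y + 0)) + 0)) + 0)
    = x * (1 - t * s) - y * (t * (2 - t * s)) by ring.
  have -> : 2 - t * s = 1 + c by rewrite ts; ring.
  by rewrite ts tc; ring.
apply: measure_preserving_comp; last exact: measure_preserving_shear_x.
by apply: measure_preserving_comp; [exact: measure_preserving_shear_x|exact: measure_preserving_shear_y].
Qed.

Lemma measure_preserving_iter phi j : measure_preserving phi ->
  measure_preserving (iter j phi).
Proof.
move=> mp; elim: j => [|j ih]; first by split=> //; exact: measurable_id.
exact: (measure_preserving_comp mp ih).
Qed.

(** Each iterate of phi preserves the integral of g over A, so this integral equals that of the
    average over N iterates, which is at least c - e on A. The pair N, phi may depend on e; the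
    finite area of A allows e to tend to 0. *)
Lemma integral_ge_average (A : set (R * R)) (g : R * R -> R) (c : R) :
  measurable A -> measurable_fun A g -> (forall w, A w -> 0 <= g w) -> 0 <= c ->
  (forall e, 0 < e -> exists N phi, [/\ (0 < N)%N, measure_preserving phi,
     forall w, A (phi w) <-> A w &
     forall w, A w -> c - e <= N%:R^-1 * \sum_(j < N) g (iter j phi w)]) ->
  (mu2 A < +oo)%E ->
  (c%:E * mu2 A <= \int[mu2]_(w in A) (g w)%:E)%E.
Proof.
move=> mA mg g0 c0 H Afin.
have A0 : (0 <= mu2 A)%E by exact: measure_ge0.
have [a aA] : exists a, mu2 A = a%:E.
  by exists (fine (mu2 A)); rewrite fineK// ge0_fin_numE.
have a0 : 0 <= a by rewrite -lee_fin -aA.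
pose G := (EFin \o g) \_ A.
have mG : measurable_fun setT G.
  by apply/(measurable_restrictT (EFin \o g) mA)/measurable_EFinP.
have G0 w : (0 <= G w)%E by apply: erestrict_ge0 => x /g0; rewrite lee_fin.
have key e : 0 < e -> ((c - e)%:E * mu2 A <= \int[mu2]_w G w)%E.
  move=> e0; have [ce|ce] := leP (c - e) 0.
    apply: (@le_trans _ _ 0%E); last exact: integral_ge0.
    by rewrite aA -EFinM lee_fin mulr_le0_ge0.
  have [N [phi [N0 mp Ainv HA]]] := H e e0.
  have Ait j w : A (iter j phi w) <-> A w.
    by elim: j => // j ih; rewrite /= Ainv.
  have mit j : measurable_fun setT (fun w => G (iter j phi w)).
    by apply: measurableT_comp mG _; have [] := measure_preserving_iter j mp.
  have e1 : (\int[mu2]_w (\sum_(j < N) G (iter j phi w)) = N%:R%:E * \int[mu2]_w G w)%E.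
    rewrite (ge0_integral_sum mu2 measurableT (fun j : 'I_N => mit j))//.
    under eq_bigr do rewrite (measure_preserving_iter _ mp).2//.
    by rewrite sumr_const card_ord mule_natl.
  have e2 : ((N%:R * (c - e))%:E * mu2 A <= \int[mu2]_w (\sum_(j < N) G (iter j phi w)))%E.
    rewrite -integral_cst// integral_mkcond.
    apply: ge0_le_integral => //.
    - by move=> w _; apply: erestrict_ge0 => x _; rewrite lee_fin mulr_ge0// ltW.
    - by apply/(measurable_restrictT (cst (N%:R * (c - e))%:E) mA); exact: measurable_cst.
    - exact: (emeasurable_sum _ (fun j : 'I_N => mit j)).
    - move=> w _; rewrite patchE; case: ifPn => [|_]; last by apply: sume_ge0 => j _; exact: G0.
      rewrite inE => Aw.
      have -> : \sum_(j < N) G (iter j phi w) = \sum_(j < N) (g (iter j phi w))%:E.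
        by apply: eq_bigr => j _; rewrite /G patchE mem_set//; exact/Ait.
      rewrite sumEFin lee_fin -ler_pdivlMl ?ltr0n//; exact: HA.
  rewrite e1 in e2; move: e2; rewrite EFinM -muleA lee_pmul2l// ?lte_fin ?ltr0n//.
rewrite integral_mkcond -/G.
case: (\int[mu2]_w G w)%E key => [v| |] key.
- rewrite aA -EFinM lee_fin; apply/ler_addgt0Pr => e e0.
  have d0 : 0 < e / (a + 1) by rewrite divr_gt0// ltr_wpDl.
  have := key _ d0; rewrite aA -EFinM lee_fin mulrBl lerBlDr => /le_trans; apply.
  rewrite lerD2l mulrAC ler_pdivrMr ?ltr_wpDl// ler_pM2l//; lra.
- by rewrite leey.
- by have := key 1 ltr01; rewrite aA -EFinM.
Qed.

End PlaneMeasure.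

(** * Measurability and areas in the plane *)

Section PlaneSets.
Variable R : realType.
Local Notation C := R[i].
Local Notation mu := (@lebesgue_measure R).
Local Notation mu2 := (mu \x mu)%E.
Implicit Types (c s : R) (A : set (R * R)) (f g : R * R -> C).

Definition plane (w : R * R) : C := w.1 +i* w.2.

Definition measurable_cfun f :=
  measurable_fun setT (fun w => Re (f w)) /\ measurable_fun setT (fun w => Im (f w)).

Lemma measurable_cfun_cst (z : C) : measurable_cfun (fun=> z).
Proof. by split; exact: measurable_cst. Qed.

Lemma measurable_cfun_plane : measurable_cfun plane.
Proof. by split; [exact: measurable_fst|exact: measurable_snd]. Qed.

Lemma measurable_cfunD f g : measurable_cfun f -> measurable_cfun g ->
  measurable_cfun (fun w => f w + g w).
Proof.
move=> [f1 f2] [g1 g2]; split.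
  by under eq_fun do rewrite raddfD/=; exact: measurable_funD.
by under eq_fun do rewrite raddfD/=; exact: measurable_funD.
Qed.

Lemma measurable_cfunM f g : measurable_cfun f -> measurable_cfun g ->
  measurable_cfun (fun w => f w * g w).
Proof.
move=> [f1 f2] [g1 g2]; split.
  rewrite (_ : (fun _ => _) = fun w => Re (f w) * Re (g w) - Im (f w) * Im (g w)).
    by apply: measurable_funB; exact: measurable_funM.
  by apply/funext => w; case: (f w) (g w) => ? ? [].
rewrite (_ : (fun _ => _) = fun w => Re (f w) * Im (g w) + Im (f w) * Re (g w)).
  by apply: measurable_funD; exact: measurable_funM.
by apply/funext => w; case: (f w) (g w) => ? ? [].
Qed.

Lemma measurable_cfun_sum (h : nat -> R * R -> C) n : (forall k, measurable_cfun (h k)) ->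
  measurable_cfun (fun w => \sum_(k < n) h k w).
Proof.
move=> mh; elim: n => [|n ih].
  by under eq_fun do rewrite big_ord0; exact: measurable_cfun_cst.
by under eq_fun do rewrite big_ord_recr/=; exact: measurable_cfunD.
Qed.

Lemma measurable_cfunX f n : measurable_cfun f -> measurable_cfun (fun w => f w ^+ n).
Proof.
move=> mf; elim: n => [|n ih].
  by under eq_fun do rewrite expr0; exact: measurable_cfun_cst.
by under eq_fun do rewrite exprS; exact: measurable_cfunM.
Qed.

Lemma measurable_normc f : measurable_cfun f -> measurable_fun setT (fun w => normc (f w)).
Proof.
move=> [f1 f2].
rewrite (_ : (fun _ => _) = fun w => Num.sqrt (Re (f w) ^+ 2 + Im (f w) ^+ 2)).
  have ms : measurable_fun setT (@Num.sqrt R).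
    by apply: continuous_measurable_fun; exact: sqrt_continuous.
  by apply: (measurableT_comp ms); apply: measurable_funD; exact: measurable_funX.
by apply/funext => w; case: (f w).
Qed.

Lemma measurable_normc_lt (x : R) : measurable [set w | normc (plane w) < x].
Proof.
have := measurable_normc measurable_cfun_plane => /(_ measurableT `]-oo, x[%classic (measurable_itv _)).
by rewrite setTI preimage_itvNyo.
Qed.

(** Pointwise limit of moduli of polynomials. Measurability of members of the Bergman space is
    derived from their Taylor series in this way. *)
Lemma measurable_normc_psum (a : nat -> C) : tame a ->
  measurable_fun [set w | disc (plane w)] (fun w => normc (psum a (plane w))).
Proof.
move=> ta.
apply: (measurable_fun_cvg (h := fun n w => normc (\sum_(k < n) a k * plane w ^+ k))).
- move=> n; apply: measurable_funTS; apply: measurable_normc.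
  apply: (@measurable_cfun_sum (fun k w => a k * plane w ^+ k)) => k; apply: measurable_cfunM.
    exact: measurable_cfun_cst.
  exact: measurable_cfunX measurable_cfun_plane.
- move=> w dw; apply/cvgrPdist_lt => e e0.
  have [N HN] := (cvg_normcP _ _).1 (psum_cvg ta dw) _ e0.
  exists N => // n /= nN; rewrite distrC ltr_norml; apply/andP; split.
    rewrite ltrNl opprB; apply: le_lt_trans (lerB_normc _ _) _.
    by rewrite normc_distC; have := HN n nN; rewrite /series/= big_mkord.
  apply: le_lt_trans (lerB_normc _ _) _.
  by have := HN n nN; rewrite /series/= big_mkord.
Qed.

(** The centered square of side d has half-diagonal less than d. *)
Lemma area_disc (d : R) : 0 < d -> ((d ^+ 2)%:E <= mu2 [set w | (normc (plane w) < d)%R])%E.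
Proof.
move=> d0; pose I : set R := `](- (d / 2)), (d / 2)]%classic.
have muI : mu I = d%:E.
  rewrite lebesgue_measure_itv/= !lte_fin gtrN ?divr_gt0//.
  by rewrite -EFinB; congr (_%:E); field.
have sq (t : R) : - (d / 2) < t -> t <= d / 2 -> t ^+ 2 <= (d / 2) ^+ 2.
  move=> t1 t2; rewrite -[t ^+ 2]real_normK ?num_real//.
  by rewrite lerXn2r ?nnegrE ?divr_ge0 ?(ltW d0)// ler_norml (ltW t1).
have <- : (mu2 (I `*` I) = (d ^+ 2)%:E)%E.
  rewrite product_measure1E//; try exact: measurable_itv.
  by rewrite expr2 EFinM; exact: (congr2 mule muI muI).
apply: le_measure; rewrite ?inE; [by apply: measurableX; exact: measurable_itv|exact: measurable_normc_lt|].
move=> [x y] []; rewrite /I /= !in_itv/= => /andP[x1 x2] /andP[y1 y2].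
have n2 : normc (plane (x, y)) ^+ 2 = x ^+ 2 + y ^+ 2 := sqr_normcE _.
suff : normc (plane (x, y)) ^+ 2 < d ^+ 2.
  by rewrite ltr_pXn2r ?nnegrE ?normc_ge0 ?ltW.
rewrite n2.
have h1 := sq _ x1 x2; have h2 := sq _ y1 y2.
have h3 : 0 < d ^+ 2 by rewrite exprn_gt0.
by move: h1 h2; rewrite !expr_div_n; lra.
Qed.

Lemma area_bounded A (x : R) : measurable A -> (forall w, A w -> normc (plane w) < x) ->
  (mu2 A < +oo)%E.
Proof.
move=> mA Ax; pose I : set R := `[- x, x]%classic.
apply: (@le_lt_trans _ _ (mu2 (I `*` I))).
  apply: le_measure; rewrite ?inE//; first by apply: measurableX; exact: measurable_itv.
  move=> w /Ax wx; split; rewrite /I /= in_itv/= -ler_norml (le_trans _ (ltW wx))//.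
    exact: (normc_Re (plane w)).
  exact: (normc_Im (plane w)).
have [a muI] : exists a : R, mu I = a%:E.
  by rewrite lebesgue_measure_itv/=; case: ifP => _; [exists (x - - x)|exists 0].
rewrite product_measure1E//; try exact: measurable_itv.
have /= -> := congr2 mule muI muI.
by rewrite -EFinM ltry.
Qed.

Lemma measurable_annulus (x y : R) : measurable [set w | x < normc (plane w) < y].
Proof.
set A := [set w | _].
rewrite (_ : A = [set w | normc (plane w) < y]
   `\` [set w | normc (plane w) <= x]).
  apply: measurableD; first exact: measurable_normc_lt.
  have := measurable_normc measurable_cfun_plane => /(_ measurableT `]-oo, x]%classic (measurable_itv _)).
  by rewrite setTI preimage_itvNyc.
apply/seteqP; split=> w; rewrite /A /=.
  by move=> /andP[h1 h2]; split=> //; apply/negP; rewrite -ltNge.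
by move=> [h1 /negP]; rewrite -ltNge => h2; rewrite h2.
Qed.

(** It is enough to look above 0 < x <= 1/2. The vertical section there contains an interval from a
    to b of length (b^2 - a^2)/(b + a) >= d/2, because b + a is at most the sum of the two radii. *)
Lemma area_annulus (d : R) : 0 < d -> d <= 1 / 4 ->
  ((d / 4)%:E <= mu2 [set w | (1 - d < normc (plane w) < 1 - d / 2)%R])%E.
Proof.
move=> d0 d4; set A := [set w | _].
have mA : measurable A by exact: measurable_annulus.
have sec (x : R) : `]0, 1 / 2]%classic x -> ((d / 2)%:E <= mu (xsection A x))%E.
  rewrite /= in_itv/= => /andP[x0 x2].
  pose a := Num.sqrt ((1 - d) ^+ 2 - x ^+ 2).
  pose b := Num.sqrt ((1 - d / 2) ^+ 2 - x ^+ 2).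
  have x24 : x ^+ 2 <= 1 / 4.
    have -> : (1 / 4 : R) = (1 / 2) ^+ 2 by field.
    by rewrite lerXn2r ?nnegrE// (ltW x0).
  have d916 : 9 / 16 <= (1 - d) ^+ 2.
    have -> : (9 / 16 : R) = (3 / 4) ^+ 2 by field.
    by rewrite lerXn2r ?nnegrE//; lra.
  have dd : (1 - d) ^+ 2 < (1 - d / 2) ^+ 2 by rewrite ltrXn2r ?nnegrE//; lra.
  have a2 : a ^+ 2 = (1 - d) ^+ 2 - x ^+ 2 by rewrite sqr_sqrtr//; lra.
  have b2 : b ^+ 2 = (1 - d / 2) ^+ 2 - x ^+ 2 by rewrite sqr_sqrtr//; lra.
  have a0 : 0 <= a := sqrtr_ge0 _.
  have b0 : 0 <= b := sqrtr_ge0 _.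
  clearbody a b.
  have a1 : a <= 1 - d by rewrite -(@ler_pXn2r _ 2) ?nnegrE//; [have := sqr_ge0 x; lra|lra].
  have b1 : b <= 1 - d / 2 by rewrite -(@ler_pXn2r _ 2) ?nnegrE//; [have := sqr_ge0 x; lra|lra].
  have ab : d / 2 <= b - a.
    have ab0 : 0 < b + a.
      rewrite ltNge; apply/negP => h.
      have b00 : b = 0 by apply/le_anti; rewrite b0 andbT; lra.
      by move: b2; rewrite b00 expr0n/=; lra.
    rewrite -(ler_pM2r ab0) -subr_sqr b2 a2.
    have -> : (1 - d / 2) ^+ 2 - x ^+ 2 - ((1 - d) ^+ 2 - x ^+ 2)
       = d / 2 * (2 - d - d / 2) by field.
    by rewrite ler_pM2l ?divr_gt0//; lra.
  apply: (@le_trans _ _ (mu `]a, b[%classic)).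
    rewrite lebesgue_measure_itv/= lte_fin; case: ifPn => h; first by rewrite -EFinB lee_fin.
    by exfalso; move: h; rewrite -leNgt; lra.
  apply: le_measure; rewrite ?inE; [exact: measurable_itv|exact: measurable_xsection|].
  move=> y; rewrite /= in_itv/= => /andP[ay yb].
  have y0 : 0 <= y by rewrite (le_trans a0)// ltW.
  have s1 : 0 <= 1 - d by lra.
  have s2 : 0 <= 1 - d / 2 by lra.
  have n2 : normc (plane (x, y)) ^+ 2 = x ^+ 2 + y ^+ 2 := sqr_normcE _.
  have ya2 : a ^+ 2 < y ^+ 2 by rewrite ltrXn2r.
  have yb2 : y ^+ 2 < b ^+ 2 by rewrite ltrXn2r.
  rewrite /xsection /mkset inE /A /mkset; apply/andP; split.
    by rewrite -(@ltr_pXn2r _ 2) ?nnegrE ?normc_ge0// n2; lra.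
  by rewrite -(@ltr_pXn2r _ 2) ?nnegrE ?normc_ge0// n2; lra.
have -> : (mu2 A = \int[mu]_x mu (xsection A x))%E by [].
apply: (@le_trans _ _ (\int[mu]_(x in `]0%R, (1 / 2)%R]%classic) (d / 2)%:E)%E).
  rewrite integral_cst//= lebesgue_measure_itv/= lte_fin ifT ?divr_gt0//.
  by rewrite -EFinB -EFinM lee_fin; lra.
apply: (@le_trans _ _ (\int[mu]_(x in `]0%R, (1 / 2)%R]%classic) mu (xsection A x))%E).
  apply: ge0_le_integral => //.
  - by move=> x _; rewrite lee_fin divr_ge0 ?ltW.
  - by apply: measurable_funTS; exact: measurable_fun_xsection.
apply: ge0_subset_integral => //.
exact: measurable_fun_xsection.
Qed.

End PlaneSets.

(** * Discrete means over roots of unity *)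

Section RootsOfUnity.
Variable R : realType.
Local Notation C := R[i].
Implicit Types (N : nat) (z zeta : C) (u a b : nat -> C).

Lemma primitive_root_exists N : (0 < N)%N -> exists zeta : C, N.-primitive_root zeta.
Proof.
move=> N0; pose p : {poly C} := 'X^N - 1; have [r Dp] := closed_field_poly_normal p.
rewrite (monicP _) ?monicXnsubC// scale1r in Dp.
have rN1 : all N.-unity_root r by apply/allP=> z; rewrite -root_prod_XsubC -Dp.
have sz_r : (N < (size r).+1)%N by rewrite -(size_prod_XsubC r id) -Dp size_XnsubC.
have [|z] := hasP (has_prim_root N0 rN1 _ sz_r); last by exists z.
by rewrite -separable_prod_XsubC -Dp separable_Xn_sub_1// pnatr_eq0 -lt0n.
Qed.

Lemma normc_prim_root N zeta : N.-primitive_root zeta -> normc zeta = 1.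
Proof.
move=> pz; apply/eqP; rewrite -(@pexpr_eq1 _ _ N) ?normc_ge0 ?(prim_order_gt0 pz)//.
by rewrite -normcX (prim_expr_order pz) normc1.
Qed.

Lemma prim_root_neqN1 N zeta : (2 < N)%N -> N.-primitive_root zeta -> zeta != -1.
Proof.
move=> N2 pz; apply/eqP => zN1; have := dvdn_leq (isT : (0 < 2)%N).
have := prim_order_dvd pz 2; rewrite zN1 sqrrN expr1n eqxx => /[swap] /[apply].
by rewrite leqNgt N2.
Qed.

Lemma sum_unity_root N (w : C) : w ^+ N = 1 -> w != 1 -> \sum_(j < N) w ^+ j = 0.
Proof.
move=> wN w1; have := subrX1 w N; rewrite wN subrr => /esym/eqP.
by rewrite mulf_eq0 subr_eq0 (negbTE w1)/= => /eqP.
Qed.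

(** Orthogonality of the characters of Z/N: the sum stops at N, so distinct indices stay distinct
    modulo N. *)
Lemma parseval_discrete N zeta u : N.-primitive_root zeta ->
  \sum_(j < N) normc (\sum_(k < N) u k * zeta ^+ (j * k)) ^+ 2
  = N%:R * \sum_(k < N) normc (u k) ^+ 2.
Proof.
move=> pz; have z1 := normc_prim_root pz.
have zc : zeta * zeta^* = 1 by rewrite mulconjc z1 expr1n.
have zcN : zeta^* ^+ N = 1.
  by rewrite -[LHS]mul1r -{1}(prim_expr_order pz) -exprMn zc expr1n.
have orth (k l : 'I_N) : \sum_(j < N) (zeta ^+ k * zeta^* ^+ l) ^+ j
    = if k == l then N%:R else 0.
  case: eqP => [->|/eqP kl].
    rewrite -exprMn zc expr1n; under eq_bigr do rewrite expr1n.
    by rewrite sumr_const card_ord.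
  apply: sum_unity_root.
    rewrite exprMn -!exprM mulnC (mulnC l) !exprM (prim_expr_order pz).
    by rewrite zcN !expr1n mulr1.
  apply: contra kl => /eqP h.
  have : zeta ^+ k = zeta ^+ l.
    by rewrite -[RHS]mul1r -h -mulrA (mulrC (zeta^* ^+ l)) -exprMn zc expr1n mulr1.
  by move/eqP; rewrite (eq_prim_root_expr pz) !modn_small.
suff : (\sum_(j < N) normc (\sum_(k < N) u k * zeta ^+ (j * k)) ^+ 2)%:C
  = (N%:R * \sum_(k < N) normc (u k) ^+ 2)%:C :> C by move=> /complexI.
rewrite rmorph_sum/=.
have e1 (j : 'I_N) : (normc (\sum_(k < N) u k * zeta ^+ (j * k)) ^+ 2)%:C
   = \sum_(k < N) \sum_(l < N) u k * (u l)^* * (zeta ^+ k * zeta^* ^+ l) ^+ j.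
  rewrite -mulconjc rmorph_sum/= big_distrl/=; apply: eq_bigr => k _.
  rewrite big_distrr/=; apply: eq_bigr => l _.
  rewrite rmorphM/= rmorphXn/= exprMn -!exprM mulrACA.
  by rewrite (mulnC k) (mulnC l).
under eq_bigr do rewrite e1.
rewrite exchange_big/= rmorphM/= rmorph_nat rmorph_sum mulr_sumr.
apply: eq_bigr => k _; rewrite exchange_big/=.
under eq_bigr do rewrite -mulr_sumr orth.
rewrite (bigD1 k)//= eqxx big1 ?addr0; first by rewrite mulconjc mulrC.
by move=> l lk; rewrite eq_sym (negbTE lk) mulr0.
Qed.

Lemma mean_discrete N zeta u : N.-primitive_root zeta ->
  \sum_(j < N) (\sum_(k < N) u k * zeta ^+ (j * k)) = N%:R * u 0%N.
Proof.
move=> pz; have N0 := prim_order_gt0 pz.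
rewrite exchange_big/= (bigD1 (Ordinal N0))//= [X in _ + X]big1 ?addr0.
  under eq_bigr do rewrite muln0 expr0 mulr1.
  by rewrite sumr_const card_ord mulr_natl.
move=> k k0; rewrite -mulr_sumr.
under eq_bigr do rewrite mulnC exprM.
rewrite sum_unity_root ?mulr0//; first by rewrite -exprM mulnC exprM (prim_expr_order pz) expr1n.
rewrite -(prim_order_dvd pz) /dvdn modn_small//.
Qed.

Lemma geometric_eventually_lt (M q e : R) : 0 <= q < 1 -> 0 < e ->
  exists N0, forall n, (N0 <= n)%N -> M * q ^+ n < e.
Proof.
move=> /andP[q0 q1] e0; have /cvgrPdist_lt/(_ _ e0)[N _ HN] : geometric M q @ \oo --> (0 : R).
  by apply: cvg_geometric; rewrite ger0_norm.
exists N => n /HN /=; rewrite sub0r normrN; apply: le_lt_trans.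
exact: ler_norm.
Qed.

(** The mean over N-th roots of unity is exact for the Taylor polynomial of degree below N, and the
    tail is less than e uniformly on |z| <= x. N > 2 keeps zeta away from -1, as the decomposition
    into shears demands. *)
Lemma mean_value_average b (x e : R) : tame b -> 0 <= x < 1 -> 0 < e ->
  exists N zeta, [/\ (2 < N)%N, N.-primitive_root zeta &
    forall z, normc z <= x ->
      normc (b 0%N) - e <= N%:R^-1 * \sum_(j < N) normc (psum b (zeta ^+ j * z))].
Proof.
move=> tb x01 e0; have [M [q [M0 q01 H]]] := psum_tail tb x01.
have [N0 HN] := geometric_eventually_lt M q01 e0.
pose N := maxn N0 3; have N2 : (2 < N)%N by rewrite leq_maxr.
have [zeta pz] := primitive_root_exists (ltn_trans (isT : (0 < 2)%N) N2).
exists N, zeta; split=> // z zx.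
have Np : 0 < N%:R :> R by rewrite ltr0n (ltn_trans _ N2).
have z1 := normc_prim_root pz.
rewrite ler_pdivlMl// mulrBr lerBlDr.
have -> : N%:R * normc (b 0%N) = normc (\sum_(j < N) (\sum_(k < N) b k * z ^+ k * zeta ^+ (j * k))).
  by rewrite (@mean_discrete N zeta (fun k => b k * z ^+ k))// expr0 mulr1 normcM normc_nat.
rewrite (le_trans (normc_sum _ _ _))//.
have -> : N%:R * e = \sum_(j < N) e by rewrite sumr_const card_ord mulr_natl.
rewrite -big_split/=; apply: ler_sum => j _.
have := H (zeta ^+ j * z) N; rewrite normcM normcX z1 expr1n mul1r => /(_ zx) h.
have -> : \sum_(k < N) b k * z ^+ k * zeta ^+ (j * k) = \sum_(k < N) b k * (zeta ^+ j * z) ^+ k.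
  by apply: eq_bigr => k _; rewrite exprMn -exprM -mulrA (mulrC (z ^+ k)).
have := lerB_normc (\sum_(k < N) b k * (zeta ^+ j * z) ^+ k) (psum b (zeta ^+ j * z)).
rewrite normc_distC; have := HN N (leq_maxl _ _).
move: h; lra.
Qed.

Lemma parseval_average a K (x e : R) : tame a -> 0 <= x < 1 -> 0 < e ->
  exists N zeta, [/\ (2 < N)%N, N.-primitive_root zeta &
    forall z, normc z <= x ->
      \sum_(k < K) normc (a k) ^+ 2 * normc z ^+ k ^+ 2 - e
        <= N%:R^-1 * \sum_(j < N) normc (psum a (zeta ^+ j * z)) ^+ 2].
Proof.
move=> ta x01 e0; have [M [q [M0 q01 H]]] := psum_tail ta x01.
have [B B0 HB] := psum_bounded ta x01.
(* With T = M q^N <= M bounding the tail and |f| <= B, one has (|f| + T)^2 - |f|^2 <= (2B + M) T. *)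
have [N0 HN] := geometric_eventually_lt ((B *+ 2 + M) * M) q01 e0.
pose N := maxn (maxn N0 K) 3; have N2 : (2 < N)%N by rewrite leq_maxr.
have KN : (K <= N)%N by rewrite !leq_max leqnn orbT.
have NN : (N0 <= N)%N by rewrite !leq_max leqnn.
have [zeta pz] := primitive_root_exists (ltn_trans (isT : (0 < 2)%N) N2).
exists N, zeta; split=> // z zx.
have Np : 0 < N%:R :> R by rewrite ltr0n (ltn_trans _ N2).
have z1 := normc_prim_root pz.
rewrite ler_pdivlMl// mulrBr lerBlDr.
apply: (@le_trans _ _ (N%:R * \sum_(k < N) normc (a k * z ^+ k) ^+ 2)).
  rewrite ler_pM2l//.
  under [leRHS]eq_bigr do rewrite normcM normcX exprMn.
  rewrite (big_ord_widen N (fun k => normc (a k) ^+ 2 * normc z ^+ k ^+ 2))//.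
  rewrite [leLHS]big_mkcond/=; apply: ler_sum => k _; case: ifP => // _.
  by rewrite mulr_ge0 ?sqr_ge0.
rewrite -(parseval_discrete (fun k => a k * z ^+ k) pz).
have -> : N%:R * e = \sum_(j < N) e by rewrite sumr_const card_ord mulr_natl.
rewrite -big_split/=; apply: ler_sum => j _.
have zjx : normc (zeta ^+ j * z) <= x by rewrite normcM normcX z1 expr1n mul1r.
have -> : \sum_(k < N) a k * z ^+ k * zeta ^+ (j * k) = \sum_(k < N) a k * (zeta ^+ j * z) ^+ k.
  by apply: eq_bigr => k _; rewrite exprMn -exprM -mulrA (mulrC (z ^+ k)).
have hT := H _ N zjx; have hB := HB _ zjx; have hN := HN N NN.
set f := psum a _ in hT hB *; set P := \sum_(k < N) _ in hT *.
have f0 := normc_ge0 f; have P0 := normc_ge0 P.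
have q0 : 0 <= q by case/andP: q01.
have T0 : 0 <= M * q ^+ N by rewrite mulr_ge0 ?exprn_ge0.
have TM : M * q ^+ N <= M.
  by rewrite ler_piMr// exprn_ile1// ltW//; case/andP: q01.
rewrite -mulrA in hN; move: (M * q ^+ N) hT hN T0 TM => T hT hN T0 TM.
have hP : normc P <= normc f + T.
  by have := lerB_normc P f; rewrite normc_distC; move: hT; lra.
have : normc P ^+ 2 <= (normc f + T) ^+ 2 by rewrite lerXn2r ?nnegrE// addr_ge0.
move/le_trans; apply; rewrite sqrrD -addrA lerD2l.
apply: le_trans (ltW hN); rewrite mulrDl lerD//.
  by rewrite -mulrnAl ler_wpM2r// ler_wMn2r.
by rewrite expr2 ler_wpM2r.
Qed.

Local Notation mu := (@lebesgue_measure R).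
Local Notation mu2 := (mu \x mu)%E.

Lemma plane_iter zeta j (w : R * R) : plane (iter j (plane_mul zeta) w) = zeta ^+ j * plane w.
Proof.
elim: j => [|j ih]; first by rewrite mul1r.
by rewrite iterS /plane plane_mulE -/(plane _) ih mulrA exprS.
Qed.

Lemma radial_integral_ge (A : set (R * R)) (g : C -> R) (c : R) :
  measurable A -> (mu2 A < +oo)%E -> measurable_fun A (g \o @plane R) ->
  (forall zeta (w : R * R), normc zeta = 1 -> A w -> A (plane_mul zeta w)) ->
  (forall w, A w -> 0 <= g (plane w)) -> 0 <= c ->
  (forall e, 0 < e -> exists N zeta, [/\ (2 < N)%N, N.-primitive_root zeta &
    forall w, A w -> c - e <= N%:R^-1 * \sum_(j < N) g (zeta ^+ j * plane w)]) ->
  (c%:E * mu2 A <= \int[mu2]_(w in A) (g (plane w))%:E)%E.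
Proof.
move=> mA Afin mg Arad g0 c0 H; apply: integral_ge_average => // e e0.
have [N [zeta [N2 pz Hz]]] := H e e0.
have z1 := normc_prim_root pz.
exists N, (plane_mul zeta); split.
- exact: ltn_trans N2.
- by apply: measure_preserving_rotation => //; exact: prim_root_neqN1 pz.
- move=> w; split; last exact: Arad.
  have -> : A w = A (plane_mul zeta^-1 (plane_mul zeta w)).
    congr A; rewrite {1}/plane_mul !plane_mulE mulKf//.
      by case: w.
    by rewrite -normc_gt0 z1.
  by apply: Arad; rewrite normcV z1 invr1.
- move=> w Aw; under eq_bigr do rewrite /= plane_iter.
  exact: Hz.
Qed.

End RootsOfUnity.

(** * Weighted Bergman spaces *)

Lemma Hol_affine (R : realType) (f : R[i] -> R[i]) (c s : R[i]) : Hol f ->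
  (forall z, disc z -> disc (c + s * z)) -> Hol (fun z => f (c + s * z)).
Proof.
move=> Hf cs z dz; have [l Hl] := (derivable_normcP _ _).1 (Hf _ (cs z dz)).
apply/derivable_normcP; exists (l * s) => e e0.
have k0 : 0 < normc s + 1 by rewrite ltr_wpDl ?normc_ge0.
have e1 : 0 < e / (normc s + 1) by rewrite divr_gt0.
have [d d0 Hd] := Hl _ e1; exists (d / (normc s + 1)); first by rewrite divr_gt0.
move=> h; rewrite ltr_pdivlMr// => hd.
have shd : normc (s * h) <= normc h * (normc s + 1).
  by rewrite (normcM s) mulrC ler_wpM2l ?normc_ge0// lerDl.
have := Hd _ (le_lt_trans shd hd); rewrite mulrA mulrDr addrA => /le_trans; apply.
by rewrite mulrAC ler_pdivrMr// -mulrA ler_wpM2l// ltW.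
Qed.

Section Bergman.
Variables (R : realType) (beta p : R).
Hypotheses (beta_gtN1 : -1 < beta) (p_ge1 : 1 <= p) (p_le2 : p <= 2).
Local Notation C := R[i].
Local Notation mu := (@lebesgue_measure R).
Local Notation mu2 := (mu \x mu)%E.
Local Notation D := [set w | disc (@plane R w)].

(** After taking logarithms, |ln x - ln d| <= ln K; the absolute value of beta handles both signs of
    the exponent. *)
Lemma powR_comparable (K d x : R) : 1 <= K -> 0 < d -> d / K <= x -> x <= K * d ->
  K `^ (- `|beta|) * d `^ beta <= x `^ beta.
Proof.
move=> K1 d0 dx xd; have K0 : 0 < K := lt_le_trans ltr01 K1.
have x0 : 0 < x by rewrite (lt_le_trans _ dx)// divr_gt0.
rewrite /powR !gt_eqF// -expRD ler_expR.
have l1 : ln d - ln K <= ln x by rewrite -ln_div ?posrE// ler_ln ?posrE ?divr_gt0.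
have l2 : ln x <= ln K + ln d by rewrite -lnM ?posrE// ler_ln ?posrE ?mulr_gt0.
have : `|beta * (ln x - ln d)| <= `|beta| * ln K.
  by rewrite normrM ler_wpM2l// ler_norml; apply/andP; split; lra.
by rewrite ler_norml => /andP[h _]; move: h; rewrite mulrBr mulNr; lra.
Qed.

Let beta2_ge0 : 0 <= beta + 2.
Proof. by move: beta_gtN1; lra. Qed.

Lemma powR_antitone (m s q x y : R) : 0 < m -> 0 <= s -> 0 <= q -> 0 < x -> x <= y ->
  (m * y `^ s) `^ (- q) <= (m * x `^ s) `^ (- q).
Proof.
move=> m0 s0 q0 x0 xy; have y0 : 0 < y := lt_le_trans x0 xy.
have h0 z : 0 < z -> 0 < m * z `^ s by move=> z0; rewrite mulr_gt0// powR_gt0.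
rewrite !powRN lef_pV2; [|by rewrite posrE powR_gt0 ?h0..].
apply: ge0_ler_powR; rewrite ?nnegrE//; [exact: ltW (h0 _ x0)|exact: ltW (h0 _ y0)|].
by apply: (ler_wpM2l (ltW m0)); apply: ge0_ler_powR => //; rewrite nnegrE ltW.
Qed.

Lemma le_1_powR (y : R) : 0 <= y -> y <= 1 + y `^ p.
Proof.
move=> y0; have [y1|y1] := leP y 1.
  by rewrite (le_trans y1)// lerDl powR_ge0.
have h : y `^ 1 <= y `^ p by rewrite ler_powR// ltW.
by rewrite powRr1// in h; rewrite (le_trans h)// lerDr.
Qed.

Variable f : C -> C.
Hypothesis mf : measurable_fun D (fun w => normc (f (plane w))).
Hypothesis norm_f : (\int[mu2]_(w in D)
   (normc (f (plane w)) `^ p * (1 - normc (plane w) ^+ 2) `^ beta)%:E <= 1)%E.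

Let mD : measurable D := measurable_normc_lt 1.

Lemma measurable_fun_translated (A : set (R * R)) (c : C) :
  (forall w, A w -> disc (c + plane w)) -> measurable A ->
  measurable_fun A (fun w => normc (f (c + plane w))).
Proof.
move=> AD mA.
pose tau (w : R * R) := (Re c + w.1, Im c + w.2).
have tauE w : plane (tau w) = c + plane w by rewrite /tau /plane/=; case: (c).
apply: (eq_measurable_fun ((fun w => normc (f (plane w))) \o tau)).
  by move=> w _ /=; rewrite tauE.
apply: measurable_comp mD _ mf _.
  by move=> _ [w /AD dw <-]; rewrite /mkset tauE.
apply: measurable_funTS; apply: measurable_fun_pair.
  by apply: measurable_funD; [exact: measurable_cst|exact: measurable_fst].
by apply: measurable_funD; [exact: measurable_cst|exact: measurable_snd].
Qed.

Lemma bergman_local_integral (A : set (R * R)) (c : C) (kappa : R) : measurable A -> 0 < kappa ->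
  (forall w, A w -> disc (c + plane w) /\ kappa <= (1 - normc (c + plane w) ^+ 2) `^ beta) ->
  (\int[mu2]_(w in A) (normc (f (c + plane w)) `^ p)%:E <= (kappa^-1)%:E)%E.
Proof.
move=> mA kappa0 Ac.
have AD w : A w -> disc (c + plane w) by move=> /Ac[].
pose h (w : R * R) := (normc (f (plane w)) `^ p * (1 - normc (plane w) ^+ 2) `^ beta)%:E.
have mh : measurable_fun D h.
  apply/measurable_EFinP; apply: measurable_funM.
    exact: (measurableT_comp (measurable_powR _)).
  apply: (measurableT_comp (measurable_powR _)).
  apply: measurable_funB; first exact: measurable_cst.
  apply: measurable_funX; apply: measurable_funTS.
  exact: measurable_normc (measurable_cfun_plane R).
have h0 w : (0 <= h w)%E by rewrite lee_fin mulr_ge0 ?powR_ge0.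
pose H := h \_ D.
have mH : measurable_fun setT H by exact/(measurable_restrictT h mD).
have H0 w : (0 <= H w)%E by apply: erestrict_ge0 => x _; exact: h0.
(* Translation by c, spelled out as the composition of two shears of slope 0. *)
pose tau (w : R * R) := (w.1 + (0 * w.2 + Re c), w.2 + (0 * (w.1 + (0 * w.2 + Re c)) + Im c)).
have mp : measure_preserving tau.
  exact: measure_preserving_comp (measure_preserving_shear_y 0 (Im c)) (measure_preserving_shear_x 0 (Re c)).
have tauE w : plane (tau w) = c + plane w.
  rewrite /tau /plane/= !mul0r !add0r; case: (c) => x y.
  by rewrite [LHS](_ : _ = (w.1 + x) +i* (w.2 + y))// [w.1 + x]addrC [w.2 + y]addrC.
have : (\int[mu2]_w H (tau w) <= 1)%E.
  by rewrite mp.2// /H -integral_mkcond.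
have mHt : measurable_fun setT (fun w => H (tau w)) by exact: measurableT_comp mH mp.1.
move=> I1; apply: (@le_trans _ _ ((kappa^-1)%:E * \int[mu2]_w H (tau w))%E); last first.
  by rewrite -[leRHS]mule1 lee_wpmul2l// lee_fin invr_ge0 ltW.
rewrite -ge0_integralZl//; last by rewrite lee_fin invr_ge0 ltW.
apply: (@le_trans _ _ (\int[mu2]_(w in A) ((kappa^-1)%:E * H (tau w)))%E); last first.
  apply: ge0_subset_integral => //.
  - exact: measurable_funeM.
  - by move=> w _; rewrite mule_ge0// lee_fin invr_ge0 ltW.
apply: ge0_le_integral => //.
- by move=> w _; rewrite lee_fin powR_ge0.
- apply/measurable_EFinP; apply: (measurableT_comp (measurable_powR _)).
  exact: measurable_fun_translated.
- by apply: measurable_funTS; exact: measurable_funeM.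
- move=> w Aw; have [dw kw] := Ac w Aw.
  rewrite /H patchE mem_set; last by rewrite /mkset tauE.
  by rewrite /h tauE -EFinM lee_fin ler_pdivlMl// mulrC ler_wpM2l// powR_ge0.
Qed.

Hypothesis Hf : Hol f.

(** Mean value property on the disc of radius d = (1 - |c|)/2 about c, where 1 - |z|^2 lies between
    d and 6d. The factor 2 arises because the two terms of the bound on the mean of |f| are each at
    most t. *)
Lemma bergman_growth (c : C) : disc c ->
  normc (f c) <= 2 * (6 `^ (- `|beta|) * ((1 - normc c) / 2) `^ (beta + 2)) `^ (- p^-1).
Proof.
rewrite /disc /mkset => c1.
have [d [d0 cd]] : exists d : R, 0 < d /\ normc c = 1 - 2 * d.
  by exists ((1 - normc c) / 2); split; [rewrite divr_gt0// subr_gt0|field].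
have -> : (1 - normc c) / 2 = d by rewrite cd; field.
have p0 : 0 < p := lt_le_trans ltr01 p_ge1.
have [kappa [kappa0 kappaE]] : exists kappa : R, 0 < kappa /\ kappa = 6 `^ (- `|beta|) * d `^ beta.
  by eexists; split; last reflexivity; rewrite mulr_gt0 ?powR_gt0.
have [L [L0 LE]] : exists L : R, 0 < L /\ L = kappa * d ^+ 2.
  by eexists; split; last reflexivity; rewrite mulr_gt0// exprn_gt0.
have -> : 6 `^ (- `|beta|) * d `^ (beta + 2) = L.
  by rewrite LE kappaE -mulrA powRD ?powR_mulrn ?ltW//; apply/implyP => _; rewrite gt_eqF.
have [t [t0 tE tL]] : exists t : R, [/\ 0 < t, t = L `^ (- p^-1) & t `^ p * L = 1].
  exists (L `^ (- p^-1)); split=> //; first by rewrite powR_gt0.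
  by rewrite -powRrM mulNr mulVf ?gt_eqF// powRN powRr1 ?ltW// mulVf ?gt_eqF.
rewrite -tE.
pose A := [set w : R * R | normc (plane w) < d].
have mA : measurable A := measurable_normc_lt d.
have Afin : (mu2 A < +oo)%E by apply: (area_bounded mA (x := d)).
have [a aA] : exists a, mu2 A = a%:E.
  by exists (fine (mu2 A)); rewrite fineK// ge0_fin_numE// measure_ge0.
have da : d ^+ 2 <= a by rewrite -lee_fin -aA; exact: area_disc.
have a0 : 0 < a by rewrite (lt_le_trans _ da)// exprn_gt0.
have cA w : A w -> normc (c + plane w) < 1 - d.
  by rewrite /A /mkset => wd; rewrite (le_lt_trans (ler_normcD _ _))// cd; lra.
have AD w : A w -> disc (c + plane w).
  by move=> /cA h; rewrite /disc /mkset (lt_le_trans h)// gerBl ltW.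
have I1 : (\int[mu2]_(w in A) (normc (f (c + plane w)) `^ p)%:E <= (kappa^-1)%:E)%E.
  apply: bergman_local_integral => // w Aw; split; first exact: AD.
  rewrite kappaE; have h1 := cA w Aw; have h0 := normc_ge0 (c + plane w).
  have h2 : 1 - 3 * d <= normc (c + plane w).
    have := lerB_normc c (- plane w); rewrite opprK normcNE cd.
    by move: Aw; rewrite /A /mkset; lra.
  move: (normc (c + plane w)) h0 h1 h2 => x x0 x1 x2.
  have -> : 1 - x ^+ 2 = (1 - x) * (1 + x) by ring.
  apply: powR_comparable => //; first lra.
    apply: (@le_trans _ _ d); first by rewrite ler_pdivrMr// ler_peMr ?ltW//; lra.
    have : d * 1 <= (1 - x) * (1 + x) by apply: ler_pM; lra.
    by rewrite mulr1.
  have : (1 - x) * (1 + x) <= (3 * d) * 2 by apply: ler_pM; lra.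
  by lra.
(* [x <= t + t L x^p], as [t^p L = 1], trades the mean of |f| for that of |f|^p. *)
have I2 : (\int[mu2]_(w in A) (normc (f (c + plane w)))%:E
   <= (t * a + t * L * kappa^-1)%:E)%E.
  have mA1 : measurable_fun A (fun w => normc (f (c + plane w))).
    exact: measurable_fun_translated.
  have mA2 : measurable_fun A (fun w => (normc (f (c + plane w)) `^ p)%:E).
    by apply/measurable_EFinP; exact: (measurableT_comp (measurable_powR _)).
  apply: (@le_trans _ _ (\int[mu2]_(w in A) (t%:E + (t * L)%:E * (normc (f (c + plane w)) `^ p)%:E))%E).
    apply: ge0_le_integral => //.
    - by move=> w _; rewrite lee_fin normc_ge0.
    - exact/measurable_EFinP.
    - by apply: emeasurable_funD; [exact: measurable_cst|exact: measurable_funeM].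
    - move=> w _; rewrite -EFinM -EFinD lee_fin.
      have x0 := normc_ge0 (f (c + plane w)); move: (normc _) x0 => x x0.
      have := le_1_powR (divr_ge0 x0 (ltW t0)).
      rewrite ler_pdivrMr// => /le_trans; apply; rewrite mulrDl mul1r lerD2l.
      rewrite powRM ?invr_ge0 ?(ltW t0)// -powR_inv1 ?(ltW t0)// -powRrM mulN1r powRN.
      have -> : (t `^ p)^-1 = L by apply: (mulfI (lt0r_neq0 (powR_gt0 p t0))); rewrite mulfV ?tL// gt_eqF// powR_gt0.
      by rewrite mulrC [x `^ p * L]mulrC mulrA.
  have tL0 : 0 <= t * L by rewrite mulr_ge0 ?ltW.
  rewrite ge0_integralD//=.
  - rewrite integral_cst//= aA -EFinM ge0_integralZl//=.
    + rewrite EFinD leeD2l//.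
      by rewrite [leRHS]EFinM lee_wpmul2l// lee_fin.
    + by move=> w _; rewrite lee_fin powR_ge0.
  - by move=> w _; rewrite lee_fin ltW.
  - by move=> w _; rewrite -EFinM lee_fin mulr_ge0 ?powR_ge0.
  - exact: measurable_funeM.
have I3 : ((normc (f c))%:E * mu2 A <= \int[mu2]_(w in A) (normc (f (c + plane w)))%:E)%E.
  apply: (radial_integral_ge (g := fun z => normc (f (c + z)))) => //.
  - exact: measurable_fun_translated.
  - by move=> z w z1; rewrite /A /mkset /plane plane_mulE (normcM z) z1 mul1r.
  - by move=> w _; rewrite normc_ge0.
  - by rewrite normc_ge0.
  move=> e e0.
  (* Rescaling by 2d = 1 - |c| maps the unit disc into itself around c, and turns the points of A
     into points with |z| <= 1/2, where averages are uniform. *)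
  have Hg : Hol (fun z => f (c + (2 * d)%:C * z)).
    apply: Hol_affine => // z; rewrite /disc /mkset => z1.
    have d2 : 0 < 2 * d by lra.
    rewrite (le_lt_trans (ler_normcD _ _))// (normcM (2 * d)%:C) normc_real gtr0_norm// cd.
    by rewrite -ltrBrDl opprB addrCA subrr addr0 gtr_pMr.
  have [b [tb bE]] := Hol_power_series Hg.
  have h12 : 0 <= (1 / 2 : R) < 1 by lra.
  have [N [zeta [N2 pz HN]]] := mean_value_average tb h12 e0.
  exists N, zeta; split=> // w Aw.
  have dC : (2 * d)%:C != 0 :> C by rewrite -normc_gt0 normc_real gtr0_norm; lra.
  have b0 : b 0%N = f c.
    have d0' : disc (0 : C) by rewrite /disc /mkset normc0.
    by have := bE 0 d0'; rewrite mulr0 addr0 (psum_shift tb d0') mul0r addr0.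
  have z12 : normc (plane w / (2 * d)%:C) <= 1 / 2.
    rewrite normcf_div normc_real gtr0_norm; last by lra.
    by rewrite ler_pdivrMr; [move: Aw; rewrite /A /mkset; lra|lra].
  have := HN _ z12; rewrite b0 => /le_trans; apply.
  rewrite ler_wpM2l ?invr_ge0//; apply: ler_sum => j _.
  rewrite -bE; first by rewrite mulrCA (mulrCA _ (plane w)) divff// mulr1.
  rewrite /disc /mkset (normcM (zeta ^+ j)) normcX (normc_prim_root pz) expr1n mul1r.
  by rewrite (le_lt_trans z12)//; lra.
rewrite aA -EFinM in I3; have := le_trans I3 I2; rewrite lee_fin.
have -> : t * L * kappa^-1 = t * d ^+ 2.
  by rewrite LE; field; rewrite gt_eqF.
move=> H; rewrite -(ler_pM2r a0) (le_trans H)//.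
have : t * d ^+ 2 <= t * a by rewrite ler_pM2l.
lra.
Qed.

(** The annulus is 1 - d < |z| < 1 - d/2. Its inner radius yields the powers of 1 - d, while its
    outer radius keeps (1 - |z|)/2 >= d/4 in the growth bound. The weight 1 - |z|^2 lies between d/2
    and 2d, and the area is at least d/4, whence the leading 4 and the final division by d. *)
Lemma bergman_coef (a : nat -> C) (d : R) K : tame a ->
  (forall z, disc z -> f z = psum a z) -> 0 < d -> d <= 1 / 4 ->
  \sum_(k < K) normc (a k) ^+ 2 * (1 - d) ^+ k ^+ 2
   <= 4 * (2 * (6 `^ (- `|beta|) * (d / 4) `^ (beta + 2)) `^ (- p^-1)) `^ (2 - p)
      / (2 `^ (- `|beta|) * d `^ beta * d).
Proof.
move=> ta fa d0 d4.
have d1 : 0 <= 1 - d by lra.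
have aux (x : R) : x < 1 - d / 2 -> d / 4 <= (1 - x) / 2 by lra.
have [kappa [kappa0 kappaE]] : exists kappa : R, 0 < kappa /\ kappa = 2 `^ (- `|beta|) * d `^ beta.
  by eexists; split; last reflexivity; rewrite mulr_gt0 ?powR_gt0.
have [Q [Q0 QE]] : exists Q : R, 0 <= Q /\
    Q = 2 * (6 `^ (- `|beta|) * (d / 4) `^ (beta + 2)) `^ (- p^-1).
  by eexists; split; last reflexivity; rewrite mulr_ge0 ?powR_ge0.
rewrite -kappaE -QE.
set S := \sum_(k < K) _.
have S0 : 0 <= S by apply: sumr_ge0 => k _; rewrite mulr_ge0 ?sqr_ge0.
pose A := [set w : R * R | 1 - d < normc (plane w) < 1 - d / 2].
have mA : measurable A by exact: measurable_annulus.
have Afin : (mu2 A < +oo)%E by apply: (area_bounded mA (x := 1 - d / 2)) => w /andP[].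
have AD w : A w -> disc (0 + plane w).
  by move=> /andP[_ h]; rewrite add0r /disc /mkset (lt_trans h)// gtrBl divr_gt0.
have I1 : (\int[mu2]_(w in A) (normc (f (0 + plane w)) `^ p)%:E <= (kappa^-1)%:E)%E.
  apply: bergman_local_integral => // w Aw; split; first exact: AD.
  rewrite add0r kappaE; move: Aw => /andP[]; move: (normc _) => x x1 x2.
  have -> : 1 - x ^+ 2 = (1 - x) * (1 + x) by ring.
  apply: powR_comparable => //; first lra.
    have : d / 2 * 1 <= (1 - x) * (1 + x) by apply: ler_pM; lra.
    by rewrite mulr1.
  have : (1 - x) * (1 + x) <= d * 2 by apply: ler_pM; lra.
  by rewrite [2 * d]mulrC.
have I2 : (\int[mu2]_(w in A) (normc (f (0 + plane w)) ^+ 2)%:E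
    <= (Q `^ (2 - p) * kappa^-1)%:E)%E.
  have mA1 : measurable_fun A (fun w => normc (f (0 + plane w))).
    exact: measurable_fun_translated.
  have mA2 : measurable_fun A (fun w => (normc (f (0 + plane w)) `^ p)%:E).
    by apply/measurable_EFinP; exact: (measurableT_comp (measurable_powR _)).
  apply: (@le_trans _ _ (\int[mu2]_(w in A) ((Q `^ (2 - p))%:E * (normc (f (0 + plane w)) `^ p)%:E))%E).
    apply: ge0_le_integral => //.
    - by move=> w _; rewrite lee_fin sqr_ge0.
    - by apply/measurable_EFinP; exact: measurable_funX.
    - exact: measurable_funeM.
    - move=> w Aw; rewrite -EFinM lee_fin.
      have xQ : normc (f (0 + plane w)) <= Q.
        have h0 := bergman_growth (AD _ Aw); rewrite QE.
        apply: (le_trans h0); apply: (ler_wpM2l (ler0n _ 2)).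
        have h2 : normc (0 + plane w) < 1 - d / 2 by rewrite add0r; case/andP: Aw.
        apply: powR_antitone; [exact: powR_gt0|exact: beta2_ge0|
          by rewrite invr_ge0 (le_trans ler01)|by rewrite divr_gt0|].
        exact: aux h2.
      have x0 := normc_ge0 (f (0 + plane w)); move: (normc _) x0 xQ => x x0 xQ.
      have -> : x ^+ 2 = x `^ (2 - p) * x `^ p.
        by rewrite -powRD ?subrK ?powR_mulrn//; apply/implyP => /eqP; lra.
      by rewrite ler_wpM2r ?powR_ge0//; apply: ge0_ler_powR; rewrite ?nnegrE ?subr_ge0.
  rewrite ge0_integralZl//=; last 2 first.
  - by move=> w _; rewrite lee_fin powR_ge0.
  - by rewrite lee_fin powR_ge0.
  by rewrite [leRHS]EFinM lee_wpmul2l// lee_fin powR_ge0.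
have I3 : (S%:E * mu2 A <= \int[mu2]_(w in A) (normc (f (0 + plane w)) ^+ 2)%:E)%E.
  apply: (radial_integral_ge (g := fun z => normc (f (0 + z)) ^+ 2)) => //.
  - by apply: measurable_funX; exact: measurable_fun_translated.
  - by move=> z w z1; rewrite /A /mkset /plane plane_mulE (normcM z) z1 mul1r.
  - by move=> w _; rewrite sqr_ge0.
  move=> e e0.
  have d2 : 0 <= 1 - d / 2 < 1 by lra.
  have [N [zeta [N2 pz HN]]] := parseval_average K ta d2 e0.
  exists N, zeta; split=> // w Aw; case/andP: (Aw) => w1 w2.
  have -> : \sum_(j < N) normc (f (0 + zeta ^+ j * plane w)) ^+ 2
      = \sum_(j < N) normc (psum a (zeta ^+ j * plane w)) ^+ 2.
    apply: eq_bigr => j _; rewrite add0r fa//.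
    rewrite /disc /mkset (normcM (zeta ^+ j)) normcX (normc_prim_root pz) expr1n mul1r.
    by have := AD _ Aw; rewrite add0r.
  apply: le_trans (HN _ (ltW w2)).
  rewrite lerD2r; apply: ler_sum => k _.
  rewrite ler_wpM2l ?sqr_ge0// lerXn2r ?nnegrE ?exprn_ge0 ?normc_ge0//.
  by rewrite lerXn2r ?nnegrE ?normc_ge0 ?(ltW w1).
have := le_trans I3 I2.
have : (S%:E * (d / 4)%:E <= S%:E * mu2 A)%E by rewrite lee_wpmul2l ?lee_fin// area_annulus.
move=> /le_trans /[apply]; rewrite -EFinM lee_fin => H.
rewrite ler_pdivlMr ?mulr_gt0//.
have -> : S * (kappa * d) = 4 * kappa * (S * (d / 4)) by field.
rewrite -[leLHS]mulrA ler_pM2l//.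
by rewrite -ler_pdivlMl// [leRHS]mulrC.
Qed.

(** Homogeneity in M: with g = (beta + 2)/p the exponents g(2 - p), beta, 1 and 1 add up to 2g,
    since g p = beta + 2. The remaining factors do not involve M. *)
Lemma bergman_constant : exists2 S0 : R, 0 < S0 & forall M d : R, 1 <= M -> d = (4 * M)^-1 ->
  4 * (2 * (6 `^ (- `|beta|) * (d / 4) `^ (beta + 2)) `^ (- p^-1)) `^ (2 - p)
      / (2 `^ (- `|beta|) * d `^ beta * d) * M = S0 * (M `^ ((beta + 2) / p)) ^+ 2.
Proof.
have p0 : 0 < p := lt_le_trans ltr01 p_ge1.
exists (4 * (2 * (6 `^ (- `|beta|) * (16^-1) `^ (beta + 2)) `^ (- p^-1)) `^ (2 - p)
      / (2 `^ (- `|beta|) * (4^-1) `^ beta * 4^-1)).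
  by rewrite divr_gt0 ?mulr_gt0 ?powR_gt0 ?mulr_gt0 ?powR_gt0.
move=> M d M1 ->; have M0 : 0 < M := lt_le_trans ltr01 M1.
have -> : (4 * M)^-1 / 4 = 16^-1 * M^-1 by field; rewrite gt_eqF.
have Minv s : M^-1 `^ s = M `^ (- s) by rewrite -powR_inv1 ?ltW// -powRrM mulN1r.
have [g [gE gp]] : exists g : R, (beta + 2) / p = g /\ g * p = beta + 2.
  by eexists; split; first reflexivity; rewrite divfK// gt_eqF.
rewrite gE.
have -> : (16^-1 * M^-1) `^ (beta + 2) = 16^-1 `^ (beta + 2) * M `^ (- (beta + 2)).
  by rewrite powRM ?invr_ge0 ?(ltW M0)// Minv.
rewrite mulrA.
have [X [X0 ->]] : exists X : R, 0 < X /\ 6 `^ (- `|beta|) * 16^-1 `^ (beta + 2) = X.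
  by eexists; split; last reflexivity; rewrite mulr_gt0 ?powR_gt0.
have -> : (X * M `^ (- (beta + 2))) `^ (- p^-1) = X `^ (- p^-1) * M `^ g.
  by rewrite powRM ?powR_ge0 ?(ltW X0)// -powRrM mulrNN gE.
rewrite mulrA.
have [Y [Y0 ->]] : exists Y : R, 0 < Y /\ 2 * X `^ (- p^-1) = Y.
  by eexists; split; last reflexivity; rewrite mulr_gt0 ?powR_gt0.
have -> : (Y * M `^ g) `^ (2 - p) = Y `^ (2 - p) * M `^ (g * (2 - p)).
  by rewrite powRM ?powR_ge0 ?(ltW Y0)// -powRrM.
have -> : (4 * M)^-1 `^ beta = 4^-1 `^ beta * (M `^ beta)^-1.
  by rewrite invfM powRM ?invr_ge0 ?(ltW M0)// Minv powRN.
have H : M `^ (g * (2 - p)) * M `^ beta * M * M = (M `^ g) ^+ 2.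
  have Mn0 : M != 0 by rewrite gt_eqF.
  rewrite -!mulrA -[M * M]expr2 -(powR_mulrn 2 (ltW M0)) -!powRD ?Mn0 ?implybT//.
  rewrite -[RHS](powR_mulrn 2 (powR_ge0 _ _)) -powRrM.
  by congr (_ `^ _); rewrite mulrBr gp; ring.
rewrite -H.
have W0 : 2 `^ (- `|beta|) != 0 :> R by rewrite gt_eqF// powR_gt0.
have V0 : 4^-1 `^ beta != 0 :> R by rewrite gt_eqF// powR_gt0.
have U0 : M `^ beta != 0 by rewrite gt_eqF// powR_gt0.
have Mn0 : M != 0 by rewrite gt_eqF.
move: (2 `^ _) (4^-1 `^ _) (M `^ beta) (Y `^ _) (M `^ _) W0 V0 U0 => W V U Z T W0 V0 U0.
by field; rewrite W0 V0 U0 Mn0.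
Qed.

End Bergman.

Lemma bergman_upper (R : realType) (beta p : R) : -1 < beta -> 1 <= p -> p <= 2 ->
  exists A' : R, 0 < A' /\
    forall (lambda : R[i]) (n : nat), disc lambda -> (1 <= n)%N ->
      (interp_const (nseq n lambda) (bergman beta p) (Hinf R)
       <= (A' * (n%:R / (1 - normc lambda)) `^ ((beta + 2) / p))%:E)%E.
Proof.
move=> b1 p1 p2; have [S0 S00 HS] := bergman_constant beta p1.
have c0 : 0 < 8 * expR 4 * S0 by rewrite !mulr_gt0 ?expR_gt0.
exists (Num.sqrt (8 * expR 4 * S0)); split; first by rewrite sqrtr_gt0.
move=> lambda n dl n1; have r01 : 0 <= normc lambda < 1 by rewrite normc_ge0.
have M1 := div_1_ge1 n1 r01.
have dE := invr_1_interp_radius (normc lambda) n.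
have := HS _ _ M1 dE.
set S := (X in X * _ = _) => HSM.
apply: (interp_const_le (S := S) n1 r01); rewrite ?size_nseq//.
- by move=> z /nseqP[-> _].
- by rewrite mulr_ge0 ?sqrtr_ge0 ?powR_ge0.
- by rewrite -mulrA HSM exprMn sqr_sqrtr ?(ltW c0)// !mulrA.
move=> f [Hf _] fn; have [a [ta fa]] := Hol_power_series Hf; exists a; split=> // K.
have M0 : 0 < n%:R / (1 - normc lambda) := lt_le_trans ltr01 M1.
have d0 : 0 < 1 - interp_radius (normc lambda) n by rewrite dE invr_gt0 mulr_gt0.
have d4 : 1 - interp_radius (normc lambda) n <= 1 / 4.
  have M4 : 4 <= 4 * (n%:R / (1 - normc lambda)) by rewrite ler_peMr.
  by rewrite dE div1r lef_pV2; [exact: M4|rewrite posrE mulr_gt0|rewrite posrE].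
have mf : measurable_fun [set w | disc (plane w)] (fun w => normc (f (plane w))).
  apply: (eq_measurable_fun (fun w => normc (psum a (plane w)))).
    by move=> w; rewrite inE => dw; rewrite fa.
  exact: measurable_normc_psum.
have I1 := poweR_inv_le1 (lt_le_trans ltr01 p1) (integral_ge0 _ _) fn.
have := bergman_coef b1 p1 p2 mf (I1 _) Hf K ta fa d0 d4.
by rewrite subKr; apply => w _; rewrite lee_fin mulr_ge0 ?powR_ge0.
Qed.

(* [fine (p^-1)%E] is 1/p for finite p, and 0 for p = +oo *)
Theorem mainTheorem3 (R : realType) :
  (forall (alpha : R) (p : \bar R), 1 <= alpha -> (1 <= p)%E ->
    exists c A : R, [/\ 0 < c, 0 < A &
      forall (n : nat) (r : R), (1 <= n)%N -> 0 <= r < 1 ->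
        [/\ ((c * (1 / (1 - r) `^ (alpha - fine (p^-1)%E)))%:E
               <= interp_const_nr n r (lap alpha p) (Hinf R))%E,
            (p <= 2%:E)%E ->
              (interp_const_nr n r (lap alpha p) (Hinf R)
               <= (A * (n%:R / (1 - r)) `^ (alpha - 1 / 2))%:E)%E
          & (2%:E <= p)%E ->
              (interp_const_nr n r (lap alpha p) (Hinf R)
               <= (A * (n%:R / (1 - r))
                         `^ (alpha + 1 / 2 - 2 * fine (p^-1)%E))%:E)%E]])
  /\
  (forall beta p : R, -1 < beta -> 1 <= p -> p <= 2 ->
    exists A' : R, 0 < A' /\
      forall (lambda : R[i]) (n : nat), disc lambda -> (1 <= n)%N ->
        (interp_const (nseq n lambda) (bergman beta p) (Hinf R)
         <= (A' * (n%:R / (1 - normc lambda)) `^ ((beta + 2) / p))%:E)%E).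
Proof.
split; last exact: bergman_upper.
move=> alpha p alpha1 p1; have [c c0 Hc] := lap_lower alpha1 p1.
have [A A0 HA] := lap_upper alpha1 p1; exists c, A; split=> // n r n1 r01.
by have [h1 h2] := HA n r n1 r01; split=> //; exact: Hc.
Qed.
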